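(* (Two sided sketching.) Let $A\in\mathbb{R}^{n\times d}$, let $k\ge1$ satisfy $k\le\mathrm{rank}(A)$ and $\sigma_k(A)>\sigma_{k+1}(A)$, and let $b=f+\xi\in\mathbb{R}^n$ be as in the fixed design model. Let $\nu,\delta\in(0,1/2)$ and denote $$\epsilon_2=\frac{\nu}{2(1+\nu/2)}\cdot\mathrm{gap}_k(A).$$ Suppose that $G$ is sampled from a distribution that has the $(\epsilon_2,\delta/2)$-approximate Gram matrix property for $A^{T}$. Denote $$\epsilon_1=\frac{\nu(1+\nu^2/4)^{-1/2}/2}{1+\nu(1+\nu^2/4)^{-1/2}/2}\cdot\mathrm{gap}_k(AG^{T})$$ and suppose that, conditionally on $G$ (for realizations with $\mathrm{gap}_k(AG^{T})>0$), $S$ is sampled from a distribution that has the $(\epsilon_1,\delta/2)$-approximate Gram matrix property for $AG^{T}$; both $G$ and $S$ are independent of $b$. Then for $R=G^{T}V_{SAG^{T},k}$, with probability at least $1-\delta$ over $(G,S)$, the approximate solution $Ax_{R,k}$ is a $(\nu,\nu)$-approximate PCP of rank $k$ and $$\mathcal{E}(x_{R,k})\le\mathcal{E}(x_k)+\frac{(2\nu+\nu^2)\|f\|_2^2}{n}.$$ Moreover, the conditions on $S$ and $G$ hold if, for example, $S$ is a CountSketch matrix with $\Omega\!\left(\frac{\mathrm{sr}(AG^{T})^2}{\mathrm{gap}_k(AG^{T})^2\nu^2\delta}\right)$ rows and $G$ is a subgaussian map with $\Omega\!\left(\frac{\mathrm{sr}(A)+\log(1/\delta)}{\mathrm{gap}_k(A)^2\nu^2}\right)$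 rows.
   Context: $\|\cdot\|_2$ is the Euclidean/spectral norm. $\sigma_1(X)\ge\sigma_2(X)\ge\cdots$ are the singular values of $X$ (with $\sigma_{k+1}$ read as $0$ if $k$ equals the smaller dimension). For $X\in\mathbb{R}^{m\times n}$ with thin SVD $X=U_X\Sigma_XV_X^{T}$, $U_{X,k},V_{X,k}$ are the first $k$ columns of $U_X,V_X$ and $U_{X,k+}$ the last $\min(m,n)-k$ columns of $U_X$; statements are meant for any such decomposition. $\mathrm{gap}_k(X)=(\sigma_k(X)^2-\sigma_{k+1}(X)^2)/\sigma_1(X)^2$ and $\mathrm{sr}(X)=\|X\|_F^2/\|X\|_2^2$. $X^{+}$ is the Moore–Penrose pseudo-inverse and $P_X$ the orthogonal projection onto the column space of $X$. $x_k=\arg\min_{x\in\mathrm{range}(V_{A,k})}\|Ax-b\|_2$, $b_k=Ax_k$, and $x_{R,k}=RV_{AR,k}(ARV_{AR,k})^{+}b$. A vector $\tilde b\in\mathbb{R}^n$ is an $(\epsilon',\upsilon)$-approximate PCP of rank $k$ if $\big|\,\|\tilde b-b\|_2-\|b_k-b\|_2\big|\le\epsilon'\|b\|_2$ and $\|U_{A,k+}^{T}\tilde b\|_2\le\upsilon\|b\|_2$. For a fixed $X\in\mathbb{R}^{m\times n}$ and $\epsilon,\delta\in(0,1/2)$, a distribution $\mathcal{D}$ on matrices with $m$ columns has the $(\epsilon,\delta)$-approximate Gram matrix property for $X$ if $\Pr_{S\sim\mathcal{D}}\big(\|X^{T}S^{T}SX-X^{T}X\|_2\ge\epsilon\|X\|_2^2\big)\le\delta$.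 Fixed design model: $A$ and $f\in\mathbb{R}^n$ are fixed, $b=f+\xi$ where the entries of $\xi$ are independent with mean $0$ and variance $\sigma^2$. $x^\star$ is the minimum-norm minimizer of $\mathbb{E}[\|Ax-b\|_2^2/n]$ (so $Ax^\star=P_Af$). $\mathcal{E}(\theta)=\mathbb{E}[\|A\theta-Ax^\star\|_2^2/n]$, with expectation over $\xi$ only (the sketches $S,G$ being held fixed). A CountSketch matrix is a random matrix whose columns are independent, each being a uniformly random standard basis vector multiplied by an independent uniform random sign. A subgaussian map with $t$ rows is a random matrix whose entries are $t^{-1/2}$ times i.i.d. samples from a mean-zero, unit-variance subgaussian distribution (e.g. $N(0,1)$). ''$\Omega(\cdot)$ rows'' means at least a sufficiently large constant (absolute for CountSketch, depending only on the subgaussian distribution for subgaussian maps) times the quantity in parentheses. *)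

(* Defs.v *)
From HB Require Import structures.
From mathcomp Require Import all_boot all_order all_algebra.
From mathcomp Require Import all_classical all_reals all_analysis.

Set Implicit Arguments.
Unset Strict Implicit.
Unset Printing Implicit Defensive.

Import Order.TTheory GRing.Theory Num.Theory.
Import numFieldNormedType.Exports.

Local Open Scope classical_set_scope.
Local Open Scope ring_scope.

Section LinearAlgebra.
Context {R : realType}.

Definition l2norm n (v : 'cV[R]_n) : R := Num.sqrt (\sum_i v i 0 ^+ 2).

Definition opnorm m n (X : 'M[R]_(m, n)) : R :=
  sup [set l2norm (X *m v) | v in [set v : 'cV[R]_n | l2norm v <= 1]].

Definition frobnorm m n (X : 'M[R]_(m, n)) : R :=
  Num.sqrt (\sum_i \sum_j X i j ^+ 2).

Definition thin_svd m n (X : 'M[R]_(m, n)) (U : 'M[R]_(m, minn m n))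
    (s : 'rV[R]_(minn m n)) (V : 'M[R]_(n, minn m n)) : Prop :=
  [/\ U^T *m U = 1%:M, V^T *m V = 1%:M,
      forall i, 0 <= s 0 i,
      forall i j : 'I_(minn m n), (i <= j)%N -> s 0 j <= s 0 i
    & X = U *m diag_mx s *m V^T].

(* The choice is harmless: every real matrix has a thin SVD, and all of its
   thin SVDs share the same diagonal. *)
Definition singvals m n (X : 'M[R]_(m, n)) : 'rV[R]_(minn m n) :=
  xget 0 [set s | exists U V, thin_svd X U s V].

(* Singular values are numbered from 1, and are 0 beyond the smaller
   dimension. *)
Definition sigma m n (X : 'M[R]_(m, n)) (i : nat) : R :=
  if insub i.-1 is Some j then singvals X 0 j else 0.

Definition gap m n (X : 'M[R]_(m, n)) (k : nat) : R :=
  (sigma X k ^+ 2 - sigma X k.+1 ^+ 2) / sigma X 1 ^+ 2.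

Definition stable_rank m n (X : 'M[R]_(m, n)) : R :=
  frobnorm X ^+ 2 / opnorm X ^+ 2.

(* Columns a, ..., a + q - 1 (from 0) of U; a column out of range is 0. *)
Definition cols m p (a q : nat) (U : 'M[R]_(m, p)) : 'M[R]_(m, q) :=
  \matrix_(i, j) (if insub (a + j)%N is Some l then U i l else 0).

Definition first_cols m p (k : nat) (U : 'M[R]_(m, p)) : 'M[R]_(m, k) :=
  cols 0 k U.

Definition last_cols m p (k : nat) (U : 'M[R]_(m, p)) : 'M[R]_(m, p - k) :=
  cols k (p - k) U.

Definition moore_penrose m n (X : 'M[R]_(m, n)) (Y : 'M[R]_(n, m)) : Prop :=
  [/\ X *m Y *m X = X, Y *m X *m Y = Y,
      (X *m Y)^T = X *m Y & (Y *m X)^T = Y *m X].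

Definition pinv m n (X : 'M[R]_(m, n)) : 'M[R]_(n, m) :=
  xget 0 [set Y | moore_penrose X Y].

Definition minimizers {T : Type} {disp} {O : porderType disp}
    (D : set T) (g : T -> O) : set T :=
  [set x | D x /\ forall y, D y -> (g x <= g y)%O].

(* x_k; V is a matrix of right singular vectors of A. *)
Definition pcr_sol n d p (A : 'M[R]_(n, d)) (V : 'M[R]_(d, p)) (k : nat)
    (b : 'cV[R]_n) : 'cV[R]_d :=
  xget 0 (minimizers [set x | exists y, x = first_cols k V *m y]
                     (fun x => l2norm (A *m x - b))).

(* x_{R,k}; V is a matrix of right singular vectors of A *m Rm. *)
Definition sketched_sol n d p q (A : 'M[R]_(n, d)) (Rm : 'M[R]_(d, q))
    (V : 'M[R]_(q, p)) (k : nat) (b : 'cV[R]_n) : 'cV[R]_d :=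
  Rm *m first_cols k V *m pinv (A *m Rm *m first_cols k V) *m b.

(* U and V are matrices of left and right singular vectors of A. *)
Definition approx_pcp n d p (A : 'M[R]_(n, d)) (U : 'M[R]_(n, p))
    (V : 'M[R]_(d, p)) (k : nat) (eps ups : R) (b bt : 'cV[R]_n) : Prop :=
  `| l2norm (bt - b) - l2norm (A *m pcr_sol A V k b - b) | <= eps * l2norm b
  /\ l2norm ((last_cols k U)^T *m bt) <= ups * l2norm b.

Definition eps_right (nu g : R) : R := nu / (2 * (1 + nu / 2)) * g.

Definition eps_left (nu g : R) : R :=
  let t := nu * (Num.sqrt (1 + nu ^+ 2 / 4))^-1 / 2 in t / (1 + t) * g.

End LinearAlgebra.

(* Matrices with n columns and any number of rows. Leaving the number of rows
   free lets the size of the second sketch depend on the first one. *)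
Definition mxcols (R : realType) (n : nat) : Type := {r : nat & 'M[R]_(r, n)}.

HB.instance Definition _ (R : realType) n :=
  Choice.copy (mxcols R n) {r : nat & 'M[R]_(r, n)}.
HB.instance Definition _ (R : realType) n :=
  isPointed.Build (mxcols R n)
    (existT (fun r => 'M[R]_(r, n)) 0%N (0 : 'M[R]_(0, n))).

Definition mxbox (R : realType) (n r : nat) (B : 'I_r -> 'I_n -> set R) :
    set (mxcols R n) :=
  [set existT _ r M | M in [set M : 'M[R]_(r, n) | forall i j, B i j (M i j)]].

(* The sigma-algebra generated by the boxes is the disjoint union, over the
   number of rows, of the Borel sigma-algebras of the matrix spaces. *)
Definition mxboxes (R : realType) (n : nat) : set (set (mxcols R n)) :=
  [set Y | exists r (B : 'I_r -> 'I_n -> set (measurableTypeR R)),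
     (forall i j, measurable (B i j)) /\ Y = mxbox B].

Notation rmx R n := (g_sigma_algebraType (@mxboxes R n)).

Definition mx_of (R : realType) n (S : mxcols R n) : 'M[R]_(projT1 S, n) :=
  projT2 S.

Section Sketches.
Context {R : realType}.

Definition approx_gram m n (D : {measure set (rmx R m) -> \bar R})
    (X : 'M[R]_(m, n)) (eps delta : R) : Prop :=
  (D [set S | (eps * opnorm X ^+ 2 <=
        opnorm (X^T *m (mx_of S)^T *m mx_of S *m X - X^T *m X))%R]
   <= delta%:E)%E.

(* Joint law of (G, S), for G of law D and S of law K G conditionally on G. *)
Definition joint_law d n (D : probability (rmx R d) R)
    (K : R.-pker (rmx R d) ~> (rmx R n)) (E : set (rmx R d * rmx R n)) : \bar R :=
  (\int[D]_G K G (xsection E G))%E.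

Definition countsketch_mx n r (h : {ffun 'I_n -> 'I_r})
    (z : {ffun 'I_n -> bool}) : 'M[R]_(r, n) :=
  \matrix_(i, j) (if i == h j then (-1) ^+ z j else 0).

(* D is given by its point masses; these add up to 1, so there are no others. *)
Definition countsketch n (r : nat) (D : probability (rmx R n) R) : Prop :=
  (0 < r)%N /\
  forall (h : {ffun 'I_n -> 'I_r}) (z : {ffun 'I_n -> bool}),
    D [set existT _ r (countsketch_mx h z)]
    = (\prod_(j < n) (r%:R^-1 * 2^-1))%:E.

Definition subgaussian_law (mu : probability (measurableTypeR R) R) : Prop :=
  [/\ (\int[mu]_x x%:E = 0)%E,
      (\int[mu]_x (x ^+ 2)%:E = 1)%E
    & exists2 c : R, 0 < c & (\int[mu]_x (expR ((x / c) ^+ 2))%:E <= 2%:E)%E].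

(* The t x n entries are independent, each with the law of t^{-1/2} w for w of
   law mu. *)
Definition subgaussian_map n (mu : probability (measurableTypeR R) R)
    (t : nat) (D : probability (rmx R n) R) : Prop :=
  forall B : 'I_t -> 'I_n -> set (measurableTypeR R),
    (forall i j, measurable (B i j)) ->
    D (mxbox B) =
    (\prod_i \prod_j mu ((fun w => (Num.sqrt t%:R)^-1 * w)%R @^-1` B i j))%E.

End Sketches.

Section FixedDesign.
Context {R : realType} {disp : measure_display} {Om : measurableType disp}.
Variable P : probability Om R.

Definition mutually_independent (I : finType) (X : I -> Om -> R) : Prop :=
  forall (J : {set I}) (B : I -> set (measurableTypeR R)),
    (forall i, measurable (B i)) ->
    P [set w | forall i, i \in J -> B i (X i w)]
    = (\prod_(i in J) P (X i @^-1` B i))%E.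

Definition white_noise n (s : R) (xi : 'I_n -> {RV P >-> R}) : Prop :=
  [/\ mutually_independent (fun i => xi i : Om -> R),
      forall i, ('E_P[xi i] = 0)%E
    & forall i, ('V_P[xi i] = (s ^+ 2)%:E)%E].

Definition response n (f : 'cV[R]_n) (xi : 'I_n -> {RV P >-> R}) (w : Om) :
    'cV[R]_n := f + \col_i xi i w.

Definition min_norm_minimizer n d (A : 'M[R]_(n, d)) (b : Om -> 'cV[R]_n) :
    'cV[R]_d :=
  xget 0 (minimizers
    (minimizers setT
      (fun x => 'E_P[fun w => (l2norm (A *m x - b w) ^+ 2 / n%:R)%R]%E))
    (@l2norm R d)).

(* theta is an estimator, that is a function of the response. *)
Definition excess_risk n d (A : 'M[R]_(n, d)) (b : Om -> 'cV[R]_n)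
    (theta : 'cV[R]_n -> 'cV[R]_d) : \bar R :=
  'E_P[fun w => (l2norm (A *m theta (b w) - A *m min_norm_minimizer A b) ^+ 2
                 / n%:R)%R]%E.

End FixedDesign.

(* Main.v *)
(** Let X = A G^T, and let W be the first k right singular vectors of S X. Since
    A R = X W, the estimator maps b to the orthogonal projection P of b on the
    range of X W, while A x_k is the projection of b on the range of U_k = U_{A,k}.
    The Gram matrix property of G makes U_{X,k} within nu/2 of U_k (Davis-Kahan,
    the gap of X being controlled by Weyl's inequality), and that of S bounds the
    tangent of the angle between W and V_{X,k}, hence the distance from the range
    of X W to that of U_{X,k}, by nu/2. So |P - U_k U_k^T| <= nu; all traces of
    rank k projections being k, only the bias term of the risk changes.

    CountSketch: the second moment of the Frobenius norm of the deviation, a sum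
    over collisions and signs, is at most 2 |X|_F^4 / r.

    Subgaussian maps: the singular directions of A are cut into blocks of m
    directions, m close to sr(A). The squares of the leading singular values of
    the blocks add up to at most 2 |A|^2, so that if the deviation is large, then
    so is, in a weighted average over pairs of blocks, the norm of its
    compression to a pair. A compression is handled by nets of at most 2^(18 m) points
    and the exponential moments of u^T (G^T G - I) v. *)
Require Import Defs.
From HB Require Import structures.
From mathcomp Require Import all_boot all_order all_algebra.
From mathcomp Require Import all_classical all_reals all_analysis.
From mathcomp Require Import measurable_realfun ring lra zify.

Set Implicit Arguments.
Unset Strict Implicit.
Unset Printing Implicit Defensive.

Import Order.TTheory GRing.Theory Num.Theory.
Import numFieldNormedType.Exports.

Local Open Scope classical_set_scope.
Local Open Scope ring_scope.

(** * Euclidean and operator norms *)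

Section Euclidean.
Context {R : realType}.
Implicit Types (m n p : nat).

(** The tangent rather than the sine is what passes from W to the range of X W: X stretches the
    component along V_{X,k} by at least sigma_k(X) and the rest by at most sigma_{k+1}(X), so the
    ratio of the two cannot grow. This is why the accuracy asked of S involves the sine of the angle
    with tangent nu/2. The shape h/(1+h) of both accuracies pays for Weyl's inequality: a deviation
    e lowers a gap g to g - e at worst, and e/(g-e) <= h amounts to e <= g h/(1+h). For subgaussian
    maps the obstacle is that the number of rows may depend on sr(A) only. Nets of the whole sphere,
    and likewise a union bound over the pairs of blocks, would bring in the dimension; an average
    over pairs with weights of total mass at most 1 does not. Both numbers of rows are random, so
    the good event lives on a disjoint union of matrix spaces, and singular values are obtained by a
    choice. Measurability comes from their being Lipschitz functions of the entries on each
    piece. *)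

Definition dotv n (u v : 'cV[R]_n) : R := \sum_i u i 0 * v i 0.

Lemma dotvE n (u v : 'cV[R]_n) : dotv u v = (u^T *m v) 0 0.
Proof. by rewrite mxE; apply: eq_bigr => i _; rewrite mxE. Qed.

Lemma dotvC n (u v : 'cV[R]_n) : dotv u v = dotv v u.
Proof. by apply: eq_bigr => i _; rewrite mulrC. Qed.

Lemma dotvDl n (u v w : 'cV[R]_n) : dotv (u + v) w = dotv u w + dotv v w.
Proof. by rewrite -big_split; apply: eq_bigr => i _; rewrite mxE mulrDl. Qed.

Lemma dotvDr n (u v w : 'cV[R]_n) : dotv w (u + v) = dotv w u + dotv w v.
Proof. by rewrite dotvC dotvDl !(dotvC w). Qed.

Lemma dotvZl n a (u w : 'cV[R]_n) : dotv (a *: u) w = a * dotv u w.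
Proof. by rewrite /dotv big_distrr; apply: eq_bigr => i _; rewrite mxE -mulrA. Qed.

Lemma dotvZr n a (u w : 'cV[R]_n) : dotv w (a *: u) = a * dotv w u.
Proof. by rewrite dotvC dotvZl dotvC. Qed.

Lemma dotvNl n (u w : 'cV[R]_n) : dotv (- u) w = - dotv u w.
Proof. by rewrite -scaleN1r dotvZl mulN1r. Qed.

Lemma dotvNr n (u w : 'cV[R]_n) : dotv w (- u) = - dotv w u.
Proof. by rewrite dotvC dotvNl dotvC. Qed.

Lemma dotvBl n (u v w : 'cV[R]_n) : dotv (u - v) w = dotv u w - dotv v w.
Proof. by rewrite dotvDl dotvNl. Qed.

Lemma dotvBr n (u v w : 'cV[R]_n) : dotv w (u - v) = dotv w u - dotv w v.
Proof. by rewrite dotvDr dotvNr. Qed.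

Lemma dotv0l n (v : 'cV[R]_n) : dotv 0 v = 0.
Proof. by rewrite -(scale0r (0 : 'cV[R]_n)) dotvZl mul0r. Qed.

Lemma dotv0r n (v : 'cV[R]_n) : dotv v 0 = 0.
Proof. by rewrite dotvC dotv0l. Qed.

Lemma dotv_adj m n (X : 'M[R]_(m, n)) u v :
  dotv (X *m u) v = dotv u (X^T *m v).
Proof. by rewrite !dotvE trmx_mul mulmxA. Qed.

Lemma dotv_adjr m n (X : 'M[R]_(m, n)) u v :
  dotv u (X *m v) = dotv (X^T *m u) v.
Proof. by rewrite dotvC dotv_adj dotvC. Qed.

Definition normsq n (v : 'cV[R]_n) : R := dotv v v.

Lemma normsqE n (v : 'cV[R]_n) : normsq v = \sum_i v i 0 ^+ 2.
Proof. by apply: eq_bigr => i _; rewrite expr2. Qed.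

Lemma normsq_ge0 n (v : 'cV[R]_n) : 0 <= normsq v.
Proof. by rewrite normsqE sumr_ge0 // => i _; rewrite sqr_ge0. Qed.

Lemma normsq_eq0 n (v : 'cV[R]_n) : (normsq v == 0) = (v == 0).
Proof.
apply/idP/eqP => [|->]; last by rewrite /normsq dotv0l.
rewrite normsqE psumr_eq0 => [/allP h|i _]; last by rewrite sqr_ge0.
apply/matrixP => i j; rewrite ord1 mxE; apply/eqP.
by rewrite -sqrf_eq0; apply: (h i); rewrite mem_index_enum.
Qed.

Lemma normsq_gt0 n (v : 'cV[R]_n) : (0 < normsq v) = (v != 0).
Proof. by rewrite lt_def normsq_ge0 normsq_eq0 andbT. Qed.

Lemma normsqD n (u v : 'cV[R]_n) :
  normsq (u + v) = normsq u + 2 * dotv u v + normsq v.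
Proof. rewrite /normsq dotvDl !dotvDr (dotvC v u); ring. Qed.

Lemma normsqB n (u v : 'cV[R]_n) :
  normsq (u - v) = normsq u - 2 * dotv u v + normsq v.
Proof. rewrite normsqD dotvNr /normsq dotvNl dotvNr; ring. Qed.

Lemma normsqZ n a (v : 'cV[R]_n) : normsq (a *: v) = a ^+ 2 * normsq v.
Proof. rewrite /normsq dotvZl dotvZr; ring. Qed.

Lemma normsq0 n : normsq (0 : 'cV[R]_n) = 0.
Proof. exact: dotv0l. Qed.

Lemma cauchy_schwarz n (u v : 'cV[R]_n) : dotv u v ^+ 2 <= normsq u * normsq v.
Proof.
have [->|v0] := eqVneq v 0; first by rewrite dotv0r expr0n normsq0 mulr0.
have vp : 0 < normsq v by rewrite normsq_gt0.
have := normsq_ge0 (u - (dotv u v / normsq v) *: v).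
rewrite normsqB normsqZ dotvZr -/(normsq v).
set a := dotv u v; set b := normsq v in vp *; set c := normsq u.
have -> : c - 2 * (a / b * a) + (a / b) ^+ 2 * b = (c * b - a ^+ 2) / b.
  by field; rewrite gt_eqF.
by rewrite pmulr_lge0 ?invr_gt0// subr_ge0.
Qed.

Lemma l2norm_ge0 n (v : 'cV[R]_n) : 0 <= l2norm v.
Proof. exact: sqrtr_ge0. Qed.

Lemma l2normE n (v : 'cV[R]_n) : l2norm v = Num.sqrt (normsq v).
Proof. by rewrite /l2norm -normsqE. Qed.

Lemma sqr_l2norm n (v : 'cV[R]_n) : l2norm v ^+ 2 = normsq v.
Proof. by rewrite l2normE sqr_sqrtr // normsq_ge0. Qed.

Lemma l2norm0 n : l2norm (0 : 'cV[R]_n) = 0.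
Proof. by rewrite l2normE normsq0 sqrtr0. Qed.

Lemma l2norm_eq0 n (v : 'cV[R]_n) : (l2norm v == 0) = (v == 0).
Proof. by rewrite -sqrf_eq0 sqr_l2norm normsq_eq0. Qed.

Lemma l2normZ n a (v : 'cV[R]_n) : l2norm (a *: v) = `|a| * l2norm v.
Proof. by rewrite !l2normE normsqZ sqrtrM ?sqr_ge0// sqrtr_sqr. Qed.

Lemma l2normN n (v : 'cV[R]_n) : l2norm (- v) = l2norm v.
Proof. by rewrite -scaleN1r l2normZ normrN1 mul1r. Qed.

Lemma l2norm_le n m (u : 'cV[R]_n) (v : 'cV[R]_m) c : 0 <= c ->
  (l2norm u <= c * l2norm v) = (normsq u <= c ^+ 2 * normsq v).
Proof.
move=> c0; rewrite -!sqr_l2norm -exprMn ler_pXn2r // ?nnegrE ?l2norm_ge0//.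
by rewrite mulr_ge0 // l2norm_ge0.
Qed.

Lemma dotv_le n (u v : 'cV[R]_n) : dotv u v <= l2norm u * l2norm v.
Proof.
apply: le_trans (ler_norm _) _.
rewrite -(ler_pXn2r (n := 2)) ?nnegrE ?mulr_ge0 ?l2norm_ge0//.
by rewrite exprMn !sqr_l2norm real_normK ?num_real// cauchy_schwarz.
Qed.

Lemma l2normD n (u v : 'cV[R]_n) : l2norm (u + v) <= l2norm u + l2norm v.
Proof.
rewrite -(ler_pXn2r (n := 2)) ?nnegrE ?addr_ge0 ?l2norm_ge0//.
rewrite sqr_l2norm normsqD sqrrD !sqr_l2norm lerD2r lerD2l.
by rewrite -[leRHS]mulr_natl ler_pM2l ?dotv_le.
Qed.

Lemma l2normB_ge n (u v : 'cV[R]_n) : `|l2norm u - l2norm v| <= l2norm (u - v).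
Proof.
rewrite ler_norml; apply/andP; split.
  rewrite lerBrDl lerBlDr -[l2norm (u - v)]l2normN opprB addrC.
  by rewrite -{1}(subrK u v) l2normD.
by rewrite lerBlDr -{1}(subrK v u) l2normD.
Qed.

Lemma row_dotv m n (X : 'M[R]_(m, n)) (v : 'cV[R]_n) i :
  (X *m v) i 0 = dotv (row i X)^T v.
Proof. by rewrite mxE; apply: eq_bigr => j _; rewrite !mxE. Qed.

Lemma sqr_frobnorm m n (X : 'M[R]_(m, n)) :
  frobnorm X ^+ 2 = \sum_i \sum_j X i j ^+ 2.
Proof.
by rewrite sqr_sqrtr // !sumr_ge0 // => i _; rewrite sumr_ge0 // => j _;
  rewrite sqr_ge0.
Qed.

Lemma frobnorm_ge0 m n (X : 'M[R]_(m, n)) : 0 <= frobnorm X.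
Proof. exact: sqrtr_ge0. Qed.

Lemma frobnorm_bound m n (X : 'M[R]_(m, n)) v :
  l2norm (X *m v) <= frobnorm X * l2norm v.
Proof.
rewrite l2norm_le ?frobnorm_ge0// sqr_frobnorm normsqE mulr_suml.
apply: ler_sum => i _; rewrite row_dotv (le_trans (cauchy_schwarz _ _))//.
by rewrite normsqE; under eq_bigr do rewrite !mxE.
Qed.

Let opset m n (X : 'M[R]_(m, n)) :=
  [set l2norm (X *m v) | v in [set v : 'cV[R]_n | l2norm v <= 1]].

Let opset_sup m n (X : 'M[R]_(m, n)) : has_sup (opset X).
Proof.
split; first by exists (l2norm (X *m 0)), 0 => //=; rewrite l2norm0.
exists (frobnorm X) => _ [v /= v1 <-]; apply: le_trans (frobnorm_bound _ _) _.
by rewrite ler_piMr ?frobnorm_ge0.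
Qed.

Lemma opnorm_ge0 m n (X : 'M[R]_(m, n)) : 0 <= opnorm X.
Proof.
apply: (ub_le_sup (proj2 (opset_sup X))); exists 0; first by rewrite /= l2norm0.
by rewrite mulmx0 l2norm0.
Qed.

Lemma opnorm_bound m n (X : 'M[R]_(m, n)) v :
  l2norm (X *m v) <= opnorm X * l2norm v.
Proof.
have [->|v0] := eqVneq v 0; first by rewrite mulmx0 !l2norm0 mulr0.
have vp : 0 < l2norm v by rewrite lt_def l2norm_eq0 v0 l2norm_ge0.
rewrite mulrC -ler_pdivrMl //; apply: (ub_le_sup (proj2 (opset_sup X))).
exists ((l2norm v)^-1 *: v) => /=.
  by rewrite l2normZ ger0_norm ?invr_ge0 ?l2norm_ge0// mulVf ?gt_eqF.
by rewrite -scalemxAr l2normZ ger0_norm ?invr_ge0 ?l2norm_ge0.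
Qed.

Lemma opnorm_le m n (X : 'M[R]_(m, n)) c : 0 <= c ->
  (forall v, l2norm (X *m v) <= c * l2norm v) -> opnorm X <= c.
Proof.
move=> c0 Xc; apply: ge_sup; first by case: (opset_sup X).
move=> _ [v /= v1 <-]; apply: le_trans (Xc v) _; exact: ler_piMr.
Qed.

Lemma opnorm_le_frob m n (X : 'M[R]_(m, n)) : opnorm X <= frobnorm X.
Proof. apply: opnorm_le; [exact: frobnorm_ge0|exact: frobnorm_bound]. Qed.

Lemma opnormD m n (X Y : 'M[R]_(m, n)) : opnorm (X + Y) <= opnorm X + opnorm Y.
Proof.
apply: opnorm_le => [|v]; first by rewrite addr_ge0 ?opnorm_ge0.
by rewrite mulmxDl (le_trans (l2normD _ _))// mulrDl lerD ?opnorm_bound.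
Qed.

Lemma opnormN m n (X : 'M[R]_(m, n)) : opnorm (- X) = opnorm X.
Proof.
by apply/eqP; rewrite eq_le; apply/andP; split;
  apply: opnorm_le => [|v]; rewrite ?opnorm_ge0// -[leLHS]l2normN -mulNmx
  ?opprK opnorm_bound.
Qed.

Lemma opnorm_mul m n p (X : 'M[R]_(m, n)) (Y : 'M[R]_(n, p)) :
  opnorm (X *m Y) <= opnorm X * opnorm Y.
Proof.
apply: opnorm_le => [|v]; first by rewrite mulr_ge0 ?opnorm_ge0.
rewrite -mulmxA (le_trans (opnorm_bound _ _))// -mulrA.
by rewrite ler_wpM2l ?opnorm_ge0 ?opnorm_bound.
Qed.

Lemma opnorm_trmx_le m n (X : 'M[R]_(m, n)) : opnorm X^T <= opnorm X.
Proof.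
apply: opnorm_le => [|v]; first exact: opnorm_ge0.
have [->|Xv0] := eqVneq (X^T *m v) 0.
  by rewrite l2norm0 mulr_ge0 ?opnorm_ge0 ?l2norm_ge0.
have Xp : 0 < l2norm (X^T *m v) by rewrite lt_def l2norm_eq0 Xv0 l2norm_ge0.
rewrite -(ler_pM2r Xp) -expr2 sqr_l2norm /normsq -dotv_adj dotvC.
apply: le_trans (dotv_le _ _) _; rewrite [leRHS]mulrAC [leLHS]mulrC ler_wpM2r ?l2norm_ge0//.
exact: opnorm_bound.
Qed.

Lemma opnorm_trmx m n (X : 'M[R]_(m, n)) : opnorm X^T = opnorm X.
Proof.
apply/eqP; rewrite eq_le opnorm_trmx_le.
by have := opnorm_trmx_le X^T; rewrite trmxK.
Qed.

Lemma frobnorm_trmx m n (X : 'M[R]_(m, n)) : frobnorm X^T = frobnorm X.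
Proof.
rewrite /frobnorm exchange_big; congr Num.sqrt.
by apply: eq_bigr => i _; apply: eq_bigr => j _; rewrite mxE.
Qed.

Lemma normsq_isom m n (Q : 'M[R]_(m, n)) v : Q^T *m Q = 1%:M ->
  normsq (Q *m v) = normsq v.
Proof. by move=> QQ; rewrite /normsq dotv_adj mulmxA QQ mul1mx. Qed.

Lemma l2norm_isom m n (Q : 'M[R]_(m, n)) v : Q^T *m Q = 1%:M ->
  l2norm (Q *m v) = l2norm v.
Proof. by move=> QQ; rewrite !l2normE normsq_isom. Qed.

End Euclidean.

(** * Singular value decompositions *)

Section SingularValues.
Context {R : realType}.
Implicit Types (m n p : nat).

Lemma exists_kernel_vector p n (B : 'M[R]_(p, n)) : (p < n)%N ->
  exists2 v : 'cV[R]_n, v != 0 & B *m v = 0.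
Proof.
move=> pn; exists (nz_row (kermx B^T))^T.
  rewrite trmx_eq0 nz_row_eq0 -mxrank_eq0 mxrank_ker subn_eq0 -ltnNge.
  by rewrite mxrank_tr (leq_ltn_trans (rank_leq_row _)).
apply: trmx_inj; rewrite trmx_mul trmxK trmx0; apply/sub_kermxP.
exact: nz_row_sub.
Qed.

Lemma continuous_normsq_mul m n (X : 'M[R]_(m, n)) :
  continuous (fun v : 'rV[R]_n => normsq (X *m v^T)).
Proof.
have csum k (F : 'I_k -> 'rV[R]_n -> R) :
    (forall i, continuous (F i)) -> continuous (fun v => \sum_i F i v).
  by move=> Fc; apply: continuous_big => [|i _]; [exact: add_continuous|].
rewrite (_ : (fun _ => _) =
  fun v : 'rV[R]_n => \sum_i (\sum_j X i j * v 0 j) * (\sum_j X i j * v 0 j)).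
  have clin i : continuous (fun v : 'rV[R]_n => \sum_j X i j * v 0 j).
    apply: (@csum _ _) => j v.
    have cf : {for v, continuous (fun=> X i j : R)} by exact: cst_continuous.
    have cg : {for v, continuous (fun w : 'rV[R]_n => w 0 j)}.
      exact: coord_continuous.
    exact: continuousM cf cg.
  by apply: (@csum _ _) => i v; apply: continuousM; exact: clin.
apply/funext => w; apply: eq_bigr => i _; rewrite mxE.
by congr (_ * _); apply: eq_bigr => j _; rewrite mxE.
Qed.

(** A continuous function on the unit sphere of the kernel of B, which is compact, and nonempty as B
    has fewer rows than columns. With B the transpose of the right singular vectors already found, v
    is the next one. *)
Lemma exists_max_stretch m n p (X : 'M[R]_(m, n)) (B : 'M[R]_(p, n)) :
  (p < n)%N ->
  exists v : 'cV[R]_n, [/\ normsq v = 1, B *m v = 0 &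
    forall w, B *m w = 0 -> normsq (X *m w) <= normsq (X *m v) * normsq w].
Proof.
move=> pn; have [v0 v0n Bv0] := exists_kernel_vector B pn.
pose S := [set v : 'rV[R]_n | normsq (1%:M *m v^T) = 1 /\
                              normsq (B *m v^T) = 0].
have normalize (v : 'cV[R]_n) : v != 0 -> normsq ((l2norm v)^-1 *: v) = 1.
  move=> vn; rewrite normsqZ -sqr_l2norm -exprMn mulVf ?expr1n//.
  by rewrite l2norm_eq0.
have S0 : S !=set0.
  exists ((l2norm v0)^-1 *: v0)^T; rewrite /S/= mul1mx trmxK normalize//.
  by rewrite -scalemxAr Bv0 scaler0 normsq0.
have Sc : compact S.
  apply: bounded_closed_compact.
    exists 1; split; first exact: num_real.
    move=> M M1 v [v1 _]; rewrite /= [leLHS]/Num.norm /= mx_normrE.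
    apply/bigmax_leP; split; first by rewrite (le_trans ler01)// ltW.
    move=> [i j] _ /=; rewrite ord1; apply: le_trans (ltW M1).
    rewrite -(ler_pXn2r (n := 2)) ?nnegrE//.
    rewrite real_normK ?num_real// expr1n -v1 mul1mx normsqE.
    by rewrite (bigD1 j)//= mxE lerDl sumr_ge0// => k _; rewrite sqr_ge0.
  have -> : S = ((fun v : 'rV[R]_n => normsq (1%:M *m v^T)) @^-1` [set 1]) `&`
                ((fun v : 'rV[R]_n => normsq (B *m v^T)) @^-1` [set 0]) by [].
  apply: closedI; apply: (preimage_closed _ (@closed_eq _ _)) => v ? //;
  exact: continuous_normsq_mul.
have [v vS vmax] := compact_EVT_max S0 Sc
  (continuous_subspaceT (@continuous_normsq_mul _ _ X)).
move: vS; rewrite inE => -[]; rewrite mul1mx => v1 /eqP.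
rewrite normsq_eq0 => /eqP Bv; exists v^T; split=> // w Bw.
have [->|wn] := eqVneq w 0; first by rewrite mulmx0 !normsq0 mulr0.
have wp : 0 < normsq w by rewrite normsq_gt0.
have := vmax ((l2norm w)^-1 *: w)^T; rewrite inE /S/= trmxK mul1mx normalize//.
rewrite -!scalemxAr Bw scaler0 normsq0 normsqZ exprVn sqr_l2norm.
by rewrite ler_pdivrMl// mulrC; apply.
Qed.

(** Invariant of the construction by induction on j. The last clause, a bound on the orthogonal
    complement of V by every value found so far, is what makes the next value smaller. *)
Definition partial_svd m n (X : 'M[R]_(m, n)) j (U : 'M[R]_(m, j))
    (s : 'rV[R]_j) (V : 'M[R]_(n, j)) : Prop :=
  [/\ U^T *m U = 1%:M, V^T *m V = 1%:M, X *m V = U *m diag_mx s,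
      X^T *m U = V *m diag_mx s
    & [/\ forall i, 0 <= s 0 i,
      forall i k : 'I_j, (i <= k)%N -> s 0 k <= s 0 i
    & forall v, V^T *m v = 0 -> forall i, l2norm (X *m v) <= s 0 i * l2norm v]].

Lemma isom_row_mx n j (U : 'M[R]_(n, j)) (u : 'cV[R]_n) :
  U^T *m U = 1%:M -> U^T *m u = 0 -> normsq u = 1 ->
  (row_mx U u)^T *m row_mx U u = 1%:M.
Proof.
move=> UU Uu u1; rewrite tr_row_mx mul_col_row UU Uu.
have -> : u^T *m U = 0 by rewrite -[LHS]trmxK trmx_mul trmxK Uu trmx0.
have -> : u^T *m u = 1%:M.
  by apply/matrixP => i k; rewrite !ord1 -dotvE -/(normsq u) u1 mxE.
by rewrite -scalar_mx_block.
Qed.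

Lemma partial_svdS m n j (X : 'M[R]_(m, n)) (U : 'M[R]_(m, j)) (s : 'rV[R]_j)
    (V : 'M[R]_(n, j)) : (j < m)%N -> (j < n)%N ->
  partial_svd X U s V ->
  exists U' s' V', @partial_svd m n X (j + 1) U' s' V'.
Proof.
move=> jm jn [UU VV XV XU [s0 sdec sbd]].
have [v [v1 Vv vmax]] := exists_max_stretch X V^T jn.
(* First order condition at the maximizer v: a move along w, orthogonal to v and to V, cannot raise
   the quotient |X v|^2 / |v|^2. The step d / (c + 1) turns the maximality inequality into t^2 (c +
   2) <= 0. *)
have ortho w : V^T *m w = 0 -> dotv v w = 0 -> dotv (X *m w) (X *m v) = 0.
  move=> Vw vw; set d := dotv _ _; set c := normsq (X *m v) * normsq w.
  have c0 : 0 <= c by rewrite mulr_ge0 ?normsq_ge0.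
  have := vmax (v + (d / (c + 1)) *: w).
  rewrite mulmxDr -scalemxAr Vv Vw scaler0 addr0 => /(_ erefl).
  rewrite mulmxDr -scalemxAr !normsqD !dotvZr !normsqZ vw mulr0 mulr0 addr0 v1.
  rewrite (dotvC (X *m v)) -/d mulrDr mulr1 -addrA lerD2l mulrCA -/c.
  have := normsq_ge0 (X *m w); set e := normsq _ => e0.
  set t := d / (c + 1) => h.
  have td : d = t * (c + 1) by rewrite divfK// gt_eqF// ltr_wpDl.
  have : t ^+ 2 * (c + 2) <= 0.
    have : 0 <= t ^+ 2 * e by rewrite mulr_ge0 ?sqr_ge0.
    by move: h; rewrite [normsq _ * _]mulrCA -/c td; nra.
  rewrite pmulr_lle0 ?ltr_wpDl// => t0.
  have /eqP t00 : t == 0 by rewrite -sqrf_eq0 eq_le t0 sqr_ge0.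
  by rewrite td t00 mul0r.
set sg := l2norm (X *m v).
(* The residual y is orthogonal to V and to v, so that [ortho] applies to y itself and gives |y|^2 =
   0. *)
have XXv : X^T *m (X *m v) = sg ^+ 2 *: v.
  apply/eqP; rewrite -subr_eq0 -normsq_eq0; set y := _ - _.
  have Vy : V^T *m y = 0.
    rewrite mulmxBr -scalemxAr Vv scaler0 subr0 !mulmxA -trmx_mul XV.
    rewrite trmx_mul tr_diag_mx -(mulmxA _ U^T) -[U^T *m X]trmxK trmx_mul trmxK.
    by rewrite XU trmx_mul tr_diag_mx -!mulmxA Vv !mulmx0.
  have vy : dotv v y = 0.
    rewrite dotvBr dotv_adjr trmxK dotvZr -/(normsq v) v1 mulr1.
    by rewrite -/(normsq _) -sqr_l2norm subrr.
  rewrite /normsq {2}/y dotvBr dotvZr dotvC (dotvC y) vy mulr0 subr0.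
  by rewrite dotv_adj trmxK dotvC ortho.
have [u [u1 Uu Xv Xu]] : exists u : 'cV[R]_m,
    [/\ normsq u = 1, U^T *m u = 0, X *m v = sg *: u & X^T *m u = sg *: v].
  (* If [sg] is 0, X vanishes on the complement of V, and any unit vector orthogonal to U serves as
     u; otherwise u is X v normalized. *)
  have [sg0|sgn] := eqVneq sg 0.
    have Xv0 : X *m v = 0 by apply/eqP; rewrite -l2norm_eq0 -/sg sg0.
    have [u [u1 Uu _]] := exists_max_stretch X^T U^T jm.
    exists u; split => //; rewrite sg0 scale0r//.
    apply/eqP; rewrite -normsq_eq0; set z := _ *m u.
    have Vz : V^T *m z = 0.
      by rewrite mulmxA -trmx_mul XV trmx_mul tr_diag_mx -mulmxA Uu mulmx0.
    have Xz : X *m z = 0.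
      apply/eqP; rewrite -normsq_eq0 eq_le normsq_ge0 andbT.
      by rewrite (le_trans (vmax _ Vz))// Xv0 normsq0 mul0r.
    by rewrite /normsq {2}/z dotv_adjr trmxK Xz dotv0l.
  exists (sg^-1 *: (X *m v)); split.
  - by rewrite normsqZ -sqr_l2norm -exprMn mulVf ?expr1n.
  - rewrite -scalemxAr mulmxA -[U^T *m X]trmxK trmx_mul trmxK XU trmx_mul.
    by rewrite tr_diag_mx -mulmxA Vv mulmx0 scaler0.
  - by rewrite scalerA divff ?scale1r.
  - by rewrite -scalemxAr XXv scalerA expr2 mulKf.
have diag1 : diag_mx (sg%:M : 'rV[R]_1) = sg%:M :> 'M[R]_1.
  by apply/matrixP => a b; rewrite !ord1 !mxE.
exists (row_mx U u), (row_mx s sg%:M), (row_mx V v); split.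
- exact: isom_row_mx.
- exact: isom_row_mx.
- rewrite diag_mx_row mul_mx_row mul_row_block XV Xv !mulmx0 addr0 add0r diag1.
  by rewrite mul_mx_scalar.
- rewrite diag_mx_row mul_mx_row mul_row_block XU Xu !mulmx0 addr0 add0r diag1.
  by rewrite mul_mx_scalar.
have sE (i : 'I_j) : row_mx s sg%:M 0 (lshift 1 i) = s 0 i by rewrite row_mxEl.
have sgE (i : 'I_1) : row_mx s sg%:M 0 (rshift j i) = sg.
  by rewrite row_mxEr ord1 mxE.
split.
- by move=> i; case: (split_ordP i) => k ->; rewrite ?sE ?sgE ?l2norm_ge0.
- move=> i k; case: (split_ordP i) => a ->; case: (split_ordP k) => b ->;
    rewrite ?sE ?sgE//=; first exact: sdec.
    by move=> _; have := sbd v Vv a; rewrite [l2norm v]l2normE v1 sqrtr1 mulr1.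
  by move=> h; have := leq_trans (leq_addr _ _) h; rewrite leqNgt ltn_ord.
- move=> w; rewrite tr_row_mx mul_col_mx => /eqP.
  rewrite col_mx_eq0 => /andP[/eqP Vw _] i.
  case: (split_ordP i) => a ->; rewrite ?sE ?sgE; first exact: sbd.
  by rewrite l2norm_le ?l2norm_ge0// sqr_l2norm vmax.
Qed.

Lemma isom_square n p (Q : 'M[R]_(n, p)) : p = n ->
  Q^T *m Q = 1%:M -> Q *m Q^T = 1%:M.
Proof. by move=> pn; move: Q; rewrite pn => Q /mulmx1C. Qed.

(** After min(m, n) steps U or V is square, hence orthogonal, and can be cancelled from X^T U = V D
    or from X V = U D. *)
Lemma exists_thin_svd m n (X : 'M[R]_(m, n)) :
  exists U s V, thin_svd X U s V.
Proof.
have part j : (j <= m)%N -> (j <= n)%N -> exists U s V, @partial_svd _ _ X j U s V.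
  elim: j => [|j ih] jm jn.
    exists 0, 0, 0; split; rewrite ?mulmx0 ?mul0mx//.
    - by apply/matrixP => -[].
    - by apply/matrixP => -[].
    - by split=> [[]|[]|v _ []].
  have [U [s [V h]]] := ih (ltnW jm) (ltnW jn).
  by rewrite -addn1; exact: partial_svdS h.
have [U [s [V [UU VV XV XU [s0 sdec _]]]]] := part _ (geq_minl m n) (geq_minr m n).
exists U, s, V; split => //; case/orP: (leq_total m n) => [mn|nm].
  have UU1 := isom_square (minn_idPl mn) UU.
  apply: trmx_inj; rewrite !trmx_mul trmxK tr_diag_mx mulmxA -XU -mulmxA UU1.
  by rewrite mulmx1.
have VV1 := isom_square (minn_idPr nm) VV.
by rewrite -XV -mulmxA VV1 mulmx1.
Qed.

End SingularValues.

(** * Min-max bounds, Weyl's inequality and the Davis-Kahan theorem *)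

Section Perturbation.
Context {R : realType}.
Implicit Types (m n p k : nat).

(* As thin_svd, with the number p of columns left free, which makes the notion
   stable under transposition. *)
Definition svd m n p (X : 'M[R]_(m, n)) (U : 'M[R]_(m, p)) (s : 'rV[R]_p)
    (V : 'M[R]_(n, p)) : Prop :=
  [/\ U^T *m U = 1%:M, V^T *m V = 1%:M,
      forall i, 0 <= s 0 i,
      forall i j : 'I_p, (i <= j)%N -> s 0 j <= s 0 i
    & X = U *m diag_mx s *m V^T].

Lemma svd_trmx m n p (X : 'M[R]_(m, n)) (U : 'M[R]_(m, p)) s V :
  svd X U s V -> svd X^T V s U.
Proof.
by move=> [UU VV s0 sd ->]; split=> //; rewrite !trmx_mul trmxK tr_diag_mx mulmxA.
Qed.

(** Numbered from 1 and 0 beyond p, as [sigma] is, so that k = p is no special case. *)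
Definition sval_nth p (s : 'rV[R]_p) (i : nat) : R :=
  if insub i.-1 is Some j then s 0 j else 0.

Lemma sval_nthE p (s : 'rV[R]_p) (i : 'I_p) : sval_nth s i.+1 = s 0 i.
Proof. by rewrite /sval_nth /= valK. Qed.

Lemma sval_nth0 p (s : 'rV[R]_p) i : (p <= i)%N -> sval_nth s i.+1 = 0.
Proof. by move=> pi; rewrite /sval_nth /= insubF// ltnNge pi. Qed.

Lemma sval_nth_ge0 p (s : 'rV[R]_p) i : (forall j, 0 <= s 0 j) ->
  0 <= sval_nth s i.
Proof. by move=> s0; rewrite /sval_nth; case: insub. Qed.

Lemma sval_nth_dec p (s : 'rV[R]_p) i j : (forall l, 0 <= s 0 l) ->
  (forall a b : 'I_p, (a <= b)%N -> s 0 b <= s 0 a) ->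
  (i <= j)%N -> sval_nth s j.+1 <= sval_nth s i.+1.
Proof.
move=> s0 sd ij; have [jp|pj] := ltnP j p; last first.
  by rewrite sval_nth0// sval_nth_ge0.
have ip := leq_ltn_trans ij jp.
by rewrite (sval_nthE s (Ordinal jp)) (sval_nthE s (Ordinal ip)) sd.
Qed.

(** Right multiplication by this 0-1 matrix is [cols a q] ([colsE]), which turns the selection of
    columns into matrix algebra. *)
Definition coln a q p : 'M[R]_(p, q) := cols a q 1%:M.

Lemma colsE m p a q (U : 'M[R]_(m, p)) : cols a q U = U *m coln a q p.
Proof.
apply/matrixP => i j; rewrite !mxE.
case: insubP => [l _ l_eq|].
  rewrite (bigD1 l)//= big1 ?addr0.
    by rewrite !mxE -l_eq valK mxE eqxx mulr1.
  by move=> r rl; rewrite !mxE -l_eq valK mxE (negbTE rl) mulr0.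
by move=> h; rewrite big1// => r _; rewrite mxE insubN// mulr0.
Qed.

Lemma colnE a q p (i : 'I_p) (j : 'I_q) :
  coln a q p i j = (i == a + j :> nat)%N%:R.
Proof.
rewrite mxE; case: insubP => [l _ l_eq|].
  by rewrite mxE -val_eqE/= l_eq.
by rewrite -leqNgt => h; rewrite (ltn_eqF (leq_trans (ltn_ord i) h)).
Qed.

Lemma coln_gram k p : (k <= p)%N -> (coln 0 k p)^T *m coln 0 k p = 1%:M.
Proof.
move=> kp; apply/matrixP => i j; rewrite !mxE.
have jp : (j < p)%N by rewrite (leq_trans (ltn_ord j)).
rewrite (bigD1 (Ordinal jp))//= big1 => [|r rj]; last first.
  by rewrite mxE !colnE -val_eqE/= add0n in rj *; rewrite (negbTE rj) mulr0.
by rewrite [_^T _ _]mxE !colnE !add0n eqxx mulr1 addr0 -val_eqE/= eq_sym.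
Qed.

Lemma coln_complement k p :
  coln 0 k p *m (coln 0 k p)^T + coln k (p - k) p *m (coln k (p - k) p)^T
  = 1%:M.
Proof.
apply/matrixP => i j; rewrite !mxE.
have [ik|ki] := ltnP i k.
  rewrite (bigD1 (Ordinal ik))//= big1 => [|r rk]; last first.
    by rewrite colnE mxE add0n -val_eqE eq_sym/= in rk *; rewrite (negbTE rk) mul0r.
  rewrite big1 => [|r _]; last first.
    by rewrite colnE ltn_eqF ?mul0r// (leq_trans ik)// leq_addr.
  by rewrite [_^T _ _]mxE !colnE !add0n eqxx mul1r !addr0 -val_eqE/= eq_sym.
have ikp : (i - k < p - k)%N by rewrite ltn_sub2r// (leq_ltn_trans ki).
rewrite big1 ?add0r => [|r _]; last first.
  by rewrite colnE gtn_eqF ?mul0r// add0n (leq_trans _ ki).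
rewrite (bigD1 (Ordinal ikp))//= big1 => [|r rk]; last first.
  rewrite colnE mxE; case: eqP => [ir|]; last by rewrite mul0r.
  by case/negP: rk; rewrite -val_eqE/= ir addKn.
by rewrite [_^T _ _]mxE !colnE/= subnKC// eqxx mul1r addr0 -val_eqE/= eq_sym.
Qed.

Lemma diag_coln k p (s : 'rV[R]_p) :
  diag_mx s *m coln 0 k p
  = coln 0 k p *m diag_mx (\row_(i < k) sval_nth s i.+1).
Proof.
apply/matrixP => i j; rewrite mul_diag_mx mul_mx_diag !mxE add0n.
case: insubP => [l _ l_eq|]; last by rewrite mulr0 mul0r.
rewrite -l_eq sval_nthE !mxE; have [->|] := eqVneq i l; first by rewrite mulrC.
by rewrite mulr0 mul0r.
Qed.

Lemma normsq_diag p (s : 'rV[R]_p) (c : 'cV[R]_p) :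
  normsq (diag_mx s *m c) = \sum_i s 0 i ^+ 2 * c i 0 ^+ 2.
Proof. by rewrite normsqE; apply: eq_bigr => i _; rewrite mul_diag_mx mxE exprMn. Qed.

Section OneMatrix.
Variables (m n p : nat) (X : 'M[R]_(m, n)).
Variables (U : 'M[R]_(m, p)) (s : 'rV[R]_p) (V : 'M[R]_(n, p)).
Hypothesis svdX : svd X U s V.

Local Notation sv := (sval_nth s).
Local Notation Dk k := (diag_mx (\row_(i < k) sv i.+1)).

Lemma first_cols_isom k : (k <= p)%N ->
  (first_cols k U)^T *m first_cols k U = 1%:M.
Proof.
case: svdX => UU _ _ _ _ kp; rewrite /first_cols colsE trmx_mul mulmxA.
by rewrite -(mulmxA _ U^T) UU mulmx1 coln_gram.
Qed.

Lemma svd_mul_first_cols k :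
  X^T *m first_cols k U = first_cols k V *m Dk k.
Proof.
case: svdX => UU VV s0 sd ->; rewrite /first_cols !colsE !trmx_mul trmxK.
by rewrite tr_diag_mx mulmxA -!mulmxA (mulmxA U^T) UU mul1mx diag_coln !mulmxA.
Qed.

Lemma bessel v : normsq (U^T *m v) <= normsq v.
Proof.
case: svdX => UU _ _ _ _; have := normsq_ge0 (v - U *m (U^T *m v)).
rewrite normsqB dotv_adjr normsq_isom// -/(normsq _); lra.
Qed.

Lemma bessel_first k v : (k <= p)%N -> normsq ((first_cols k U)^T *m v) <= normsq v.
Proof.
move=> kp; have := normsq_ge0 (v - first_cols k U *m ((first_cols k U)^T *m v)).
rewrite normsqB dotv_adjr normsq_isom ?first_cols_isom// -/(normsq _); lra.
Qed.

Lemma sval_ge0 i : 0 <= sv i.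
Proof. by case: svdX => _ _ s0 _ _; exact: sval_nth_ge0. Qed.

Lemma sval_dec i j : (i <= j)%N -> sv j.+1 <= sv i.+1.
Proof. by case: svdX => _ _ s0 sd _; exact: sval_nth_dec. Qed.

(** The coordinates of v along the first k columns vanish and the others are multiplied by at most
    the value number k + 1. Together with [svd_top] this is the min-max principle. *)
Lemma svd_bottom k v : (first_cols k U)^T *m v = 0 ->
  l2norm (X^T *m v) <= sv k.+1 * l2norm v.
Proof.
case: svdX => UU VV s0 sd XE Uv; rewrite l2norm_le ?sval_ge0//.
have -> : X^T *m v = V *m (diag_mx s *m (U^T *m v)).
  by rewrite XE !trmx_mul trmxK tr_diag_mx !mulmxA.
rewrite normsq_isom// normsq_diag.
apply: (@le_trans _ _ (sv k.+1 ^+ 2 * normsq (U^T *m v))); last first.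
  by rewrite ler_wpM2l ?sqr_ge0 ?bessel.
rewrite normsqE mulr_sumr; apply: ler_sum => i _.
have [ik|ki] := ltnP i k.
  have : ((first_cols k U)^T *m v) (Ordinal ik) 0 = 0 by rewrite Uv mxE.
  rewrite /first_cols colsE trmx_mul -mulmxA mxE (bigD1 i)//= big1.
    rewrite addr0 !mxE valK mxE eqxx mul1r => ->.
    by rewrite expr0n !mulr0.
  by move=> r ri; rewrite !mxE /= add0n valK mxE eq_sym in ri *; rewrite (negbTE ri) mul0r.
rewrite ler_wpM2r ?sqr_ge0// ler_sqr ?nnegrE ?sval_ge0// -(sval_nthE s i).
exact: sval_dec.
Qed.

Lemma svd_top k c : (k < p)%N ->
  sv k.+1 * l2norm c <= l2norm (X^T *m (first_cols k.+1 U *m c)).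
Proof.
move=> kp; rewrite mulmxA svd_mul_first_cols -mulmxA.
case: (svdX) => UU VV s0 sd _.
have -> : l2norm (first_cols k.+1 V *m (Dk k.+1 *m c)) = l2norm (Dk k.+1 *m c).
  apply: l2norm_isom; rewrite /first_cols colsE trmx_mul mulmxA.
  by rewrite -(mulmxA _ V^T) VV mulmx1 coln_gram.
rewrite -(ler_pXn2r (n := 2)) ?nnegrE ?mulr_ge0 ?l2norm_ge0 ?sval_ge0//.
rewrite exprMn !sqr_l2norm normsq_diag normsqE mulr_sumr.
apply: ler_sum => i _; rewrite mxE ler_wpM2r ?sqr_ge0//.
by rewrite ler_sqr ?nnegrE ?sval_ge0// sval_dec// -ltnS.
Qed.

Lemma svd_opnorm : opnorm X = sv 1.
Proof.
apply/eqP; rewrite eq_le -opnorm_trmx; apply/andP; split.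
  apply: opnorm_le => [|v]; first exact: sval_ge0.
  by apply: svd_bottom; apply/matrixP => -[].
have [p0|p0] := posnP p; first by rewrite sval_nth0 ?opnorm_ge0// p0.
have := opnorm_bound X^T (first_cols 1 U *m const_mx 1).
have := svd_top (const_mx 1) p0.
rewrite (l2norm_isom _ (first_cols_isom p0)) l2normE normsqE.
rewrite big_ord_recl big_ord0 mxE expr1n addr0 sqrtr1 !mulr1.
exact: le_trans.
Qed.

End OneMatrix.

Lemma opnorm_gram_dotv m n n' (X : 'M[R]_(m, n)) (Y : 'M[R]_(m, n')) e v :
  opnorm (X *m X^T - Y *m Y^T) <= e ->
  normsq (X^T *m v) <= normsq (Y^T *m v) + e * normsq v.
Proof.
move=> he; rewrite -lerBlDl.
have -> : normsq (X^T *m v) - normsq (Y^T *m v)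
    = dotv ((X *m X^T - Y *m Y^T) *m v) v.
  rewrite mulmxBl dotvBl -!mulmxA; congr (_ - _);
    by rewrite [RHS]dotv_adj.
apply: le_trans (dotv_le _ _) _.
apply: le_trans (ler_wpM2r (l2norm_ge0 _) (opnorm_bound _ _)) _.
by rewrite -mulrA -expr2 sqr_l2norm ler_wpM2r ?normsq_ge0.
Qed.

(** By dimension, some nonzero combination of i + 1 left singular vectors of X is orthogonal to the
    first i of Y. On it X^T is large by [svd_top] and Y^T small by [svd_bottom]. *)
Lemma weyl m n n' p p' (X : 'M[R]_(m, n)) (Y : 'M[R]_(m, n'))
    (U : 'M[R]_(m, p)) s V (U' : 'M[R]_(m, p')) s' V' e i :
  svd X U s V -> svd Y U' s' V' -> opnorm (X *m X^T - Y *m Y^T) <= e ->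
  sval_nth s i.+1 ^+ 2 <= sval_nth s' i.+1 ^+ 2 + e.
Proof.
move=> sX sY he.
have e0 : 0 <= e := le_trans (opnorm_ge0 _) he.
have [ip|pi] := ltnP i p; last first.
  by rewrite sval_nth0// expr0n addr_ge0// sqr_ge0.
have [c cn Uc] := exists_kernel_vector
  ((first_cols i U')^T *m first_cols i.+1 U) (ltnSn i).
have cp : 0 < normsq c by rewrite normsq_gt0.
rewrite -(ler_pM2r cp).
have top := svd_top sX c ip.
have bot := svd_bottom sY (etrans (mulmxA _ _ _) Uc).
rewrite -(ler_pXn2r (n := 2)) ?nnegrE ?mulr_ge0 ?l2norm_ge0 ?(sval_ge0 sX)// in top.
rewrite -(ler_pXn2r (n := 2)) ?nnegrE ?mulr_ge0 ?l2norm_ge0 ?(sval_ge0 sY)// in bot.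
rewrite !exprMn !sqr_l2norm in top bot.
rewrite (normsq_isom _ (first_cols_isom sX ip)) in bot.
apply: le_trans top _; apply: le_trans (opnorm_gram_dotv _ he) _.
by rewrite mulrDl (normsq_isom _ (first_cols_isom sX ip)) lerD2r.
Qed.

(** Weyl's inequality both ways with perturbation 0; it links [singvals], which is a choice, to any
    given decomposition. *)
Lemma svd_unique m n p p' (X : 'M[R]_(m, n)) (U : 'M[R]_(m, p)) s V
    (U' : 'M[R]_(m, p')) s' V' i :
  svd X U s V -> svd X U' s' V' -> sval_nth s i.+1 = sval_nth s' i.+1.
Proof.
move=> sX sX'; have h : opnorm (X *m X^T - X *m X^T) <= 0.
  by rewrite subrr; apply: opnorm_le => // v; rewrite mul0mx l2norm0 mul0r.
apply/eqP; rewrite eq_le; apply/andP; split;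
  rewrite -ler_sqr ?nnegrE ?(sval_ge0 sX) ?(sval_ge0 sX')//.
  by have := weyl i sX sX' h; rewrite addr0.
by have := weyl i sX' sX h; rewrite addr0.
Qed.

Lemma thin_svd_svd m n (X : 'M[R]_(m, n)) (U : 'M[R]_(m, minn m n)) s V :
  thin_svd X U s V -> svd X U s V.
Proof. by []. Qed.

Lemma exists_singvals m n (X : 'M[R]_(m, n)) :
  exists U V, svd X U (singvals X) V.
Proof.
have [U [s [V h]]] := exists_thin_svd X.
rewrite /singvals; have [U' [V' h']] :=
  xgetPex 0 (ex_intro [set s | exists U V, thin_svd X U s V] s
    (ex_intro _ U (ex_intro _ V h))).
by exists U', V'.
Qed.

Lemma sigmaE m n p (X : 'M[R]_(m, n)) (U : 'M[R]_(m, p)) s V i :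
  svd X U s V -> sigma X i.+1 = sval_nth s i.+1.
Proof.
by have [U' [V' h']] := exists_singvals X => h; rewrite -(svd_unique i h' h).
Qed.

Lemma sigma_ge0 m n (X : 'M[R]_(m, n)) i : 0 <= sigma X i.
Proof. by have [U [V h]] := exists_singvals X; exact: (sval_ge0 h). Qed.

Lemma sigma_dec m n (X : 'M[R]_(m, n)) i j :
  (i <= j)%N -> sigma X j.+1 <= sigma X i.+1.
Proof. by have [U [V h]] := exists_singvals X; exact: (sval_dec h). Qed.

Lemma sigma1 m n (X : 'M[R]_(m, n)) : sigma X 1 = opnorm X.
Proof. by have [U [V h]] := exists_singvals X; rewrite (svd_opnorm h). Qed.

Lemma sigma_weyl m n n' (X : 'M[R]_(m, n)) (Y : 'M[R]_(m, n')) i :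
  sigma X i.+1 ^+ 2 <= sigma Y i.+1 ^+ 2 + opnorm (X *m X^T - Y *m Y^T).
Proof.
have [U [V h]] := exists_singvals X; have [U' [V' h']] := exists_singvals Y.
exact: weyl h h' (lexx _).
Qed.

Definition proj_first m p k (U : 'M[R]_(m, p)) : 'M[R]_m :=
  first_cols k U *m (first_cols k U)^T.

Lemma svd_proj_comm m n p k (X : 'M[R]_(m, n)) (U : 'M[R]_(m, p)) s V :
  svd X U s V -> X^T *m proj_first k U = proj_first k V *m X^T.
Proof.
move=> sX; have sXT := svd_trmx sX.
rewrite /proj_first mulmxA (svd_mul_first_cols sX).
have := svd_mul_first_cols sXT k; rewrite trmxK => h.
by rewrite -!mulmxA -trmx_mul h trmx_mul tr_diag_mx.
Qed.

Lemma proj_firstT m p k (U : 'M[R]_(m, p)) : (proj_first k U)^T = proj_first k U.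
Proof. by rewrite /proj_first trmx_mul trmxK. Qed.

Lemma cprojT m p k (U : 'M[R]_(m, p)) :
  (1%:M - proj_first k U)^T = 1%:M - proj_first k U.
Proof. by rewrite linearB/= trmx1 proj_firstT. Qed.

Lemma cproj_first m p k (U : 'M[R]_(m, p)) :
  (first_cols k U)^T *m first_cols k U = 1%:M ->
  (first_cols k U)^T *m (1%:M - proj_first k U) = 0.
Proof. by move=> h; rewrite mulmxBr mulmx1 mulmxA h mul1mx subrr. Qed.

Lemma cproj_idem m p k (U : 'M[R]_(m, p)) :
  (first_cols k U)^T *m first_cols k U = 1%:M ->
  (1%:M - proj_first k U) *m (1%:M - proj_first k U) = 1%:M - proj_first k U.
Proof.
by move=> h; rewrite {1}mulmxBl mul1mx -mulmxA cproj_first// mulmx0 subr0.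
Qed.

(** With L the diagonal of the first singular values of X, X X^T Q = Q L^2, while P commutes with Y
    Y^T; so P (X X^T - Y Y^T) Q = Z L^2 - P Y Y^T P Z. Here L is at least a and Y^T P at most b,
    whence a^2 z <= e + b^2 z. *)
Lemma davis_kahan m n n' p p' k (X : 'M[R]_(m, n)) (Y : 'M[R]_(m, n'))
    (U : 'M[R]_(m, p)) s V (U' : 'M[R]_(m, p')) s' V' :
  svd X U s V -> svd Y U' s' V' -> (k < p)%N -> (k < p')%N ->
  sval_nth s' k.+2 < sval_nth s k.+1 ->
  opnorm ((1%:M - proj_first k.+1 U') *m first_cols k.+1 U)
  <= opnorm (X *m X^T - Y *m Y^T)
     / (sval_nth s k.+1 ^+ 2 - sval_nth s' k.+2 ^+ 2).
Proof.
move=> sX sY kp kp' ss.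
set Q := first_cols k.+1 U; set P := 1%:M - _; set Z := P *m Q.
set D := X *m X^T - Y *m Y^T; set e := opnorm D.
set a := sval_nth s k.+1; set b := sval_nth s' k.+2.
have b0 : 0 <= b := sval_ge0 sY _.
have a0 : 0 < a := le_lt_trans b0 ss.
have ab : 0 < a ^+ 2 - b ^+ 2 by rewrite subr_gt0 ltr_sqr// nnegrE ltW.
have UU' := first_cols_isom sY kp'.
have Psym : P^T = P := cprojT _ _.
have UP := cproj_first UU'; have PP : P *m P = P := cproj_idem UU'.
have Pn v : l2norm (P *m v) <= l2norm v.
  rewrite -[leRHS]mul1r l2norm_le// expr1n mul1r.
  have := normsq_ge0 (v - P *m v); rewrite normsqB.
  have -> : dotv v (P *m v) = normsq (P *m v).
    by rewrite /normsq [RHS]dotv_adj Psym mulmxA PP.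
  lra.
have YP : opnorm (Y^T *m P) <= b.
  apply: opnorm_le => // v; rewrite -mulmxA.
  apply: le_trans (@svd_bottom _ _ _ _ _ _ _ sY k.+1 _ _) _.
    by rewrite mulmxA UP mul0mx.
  by rewrite ler_wpM2l.
have PYYP v : l2norm (P *m (Y *m (Y^T *m (P *m v)))) <= b ^+ 2 * l2norm v.
  rewrite (mulmxA P) (mulmxA Y^T); have -> : P *m Y = (Y^T *m P)^T.
    by rewrite trmx_mul trmxK Psym.
  apply: le_trans (opnorm_bound _ _) _; rewrite opnorm_trmx expr2 -mulrA.
  apply: ler_pM; rewrite ?opnorm_ge0 ?l2norm_ge0//.
  apply: le_trans (opnorm_bound _ _) _; by rewrite ler_wpM2r ?l2norm_ge0.
(* P is built from the left singular vectors of Y, so Y^T P equals the corresponding projection on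
   the right times Y^T, and P can be inserted once more. *)
have PYY : P *m Y *m Y^T = P *m Y *m Y^T *m P.
  have PY : P *m Y = (Y^T *m P)^T by rewrite trmx_mul trmxK Psym.
  have YPc : Y^T *m P = (1%:M - proj_first k.+1 V') *m Y^T.
    by rewrite mulmxBr mulmx1 (svd_proj_comm _ sY) mulmxBl mul1mx.
  rewrite -(mulmxA _ Y^T) YPc mulmxA PY YPc trmx_mul trmxK.
  by rewrite cprojT -[in RHS](mulmxA Y) (cproj_idem (first_cols_isom (svd_trmx sY) kp')).
set z := opnorm Z; have z0 : 0 <= z := opnorm_ge0 _.
have e0 : 0 <= e := opnorm_ge0 _.
have Zbound w : l2norm (Z *m w) <= (e + b ^+ 2 * z) / a ^+ 2 * l2norm w.
  pose lam := \row_(i < k.+1) sval_nth s i.+1.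
  have lam_ge (i : 'I_k.+1) : a <= lam 0 i.
    by rewrite mxE (sval_dec sX)// -ltnS.
  (* c solves L^2 c = w, so that Z w is Z L^2 c and the norm of c is at most that of w divided by
     a^2. *)
  pose c := \col_i (w i 0 / lam 0 i ^+ 2).
  have lam_gt (i : 'I_k.+1) : 0 < lam 0 i ^+ 2.
    by rewrite exprn_gt0// (lt_le_trans a0).
  have wc : w = diag_mx lam *m (diag_mx lam *m c).
    apply/matrixP => i j; rewrite ord1 mul_diag_mx mxE mul_diag_mx mxE.
    by rewrite [c _ _]mxE mulrA -expr2 mulrC divfK// gt_eqF.
  have cw : l2norm c <= (a ^+ 2)^-1 * l2norm w.
    rewrite l2norm_le ?invr_ge0 ?sqr_ge0// !normsqE mulr_sumr.
    apply: ler_sum => i _; rewrite mxE exprMn mulrC ler_wpM2r ?sqr_ge0//.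
    rewrite ler_sqr ?nnegrE ?invr_ge0 ?sqr_ge0// lef_pV2 ?posrE ?lam_gt ?exprn_gt0//.
    by rewrite ler_sqr ?nnegrE ?(ltW a0)// (le_trans (ltW a0) (lam_ge i)).
  have -> : Z *m w = P *m (D *m (Q *m c)) + P *m (Y *m (Y^T *m (P *m (Z *m c)))).
    have -> : Z *m w = P *m (X *m (X^T *m (Q *m c))).
      rewrite wc /Z -mulmxA; congr (_ *m _); rewrite (mulmxA X^T).
      rewrite (svd_mul_first_cols sX) -!mulmxA (mulmxA X).
      have := svd_mul_first_cols (svd_trmx sX) k.+1; rewrite trmxK => ->.
      by rewrite -mulmxA.
    have -> : P *m (Y *m (Y^T *m (P *m (Z *m c)))) = P *m (Y *m (Y^T *m (Q *m c))).
      rewrite /Z -(mulmxA P Q) (mulmxA P P) PP !mulmxA.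
      by rewrite -PYY.
    rewrite -mulmxDr; congr (_ *m _); rewrite /D mulmxBl -!mulmxA.
    by rewrite subrK.
  have cE : l2norm (Q *m c) = l2norm c := l2norm_isom _ (first_cols_isom sX kp).
  apply: le_trans (l2normD _ _) _.
  apply: (@le_trans _ _ ((e + b ^+ 2 * z) * l2norm c)); last first.
    rewrite -mulrA ler_wpM2l// addr_ge0// mulr_ge0// sqr_ge0//.
  rewrite mulrDl lerD//.
    by apply: le_trans (Pn _) _; apply: le_trans (opnorm_bound _ _) _; rewrite cE.
  apply: le_trans (PYYP _) _; rewrite -mulrA ler_wpM2l ?sqr_ge0//.
  exact: opnorm_bound.
(* The bound on each Z w involves z, the norm of Z, and closes up into an inequality for z alone. *)
have zle : z <= (e + b ^+ 2 * z) / a ^+ 2.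
  by apply: opnorm_le => //; rewrite divr_ge0 ?sqr_ge0// addr_ge0// mulr_ge0// sqr_ge0.
rewrite ler_pdivlMr// mulrBr.
rewrite ler_pdivlMr ?exprn_gt0// in zle.
by rewrite lerBlDr (mulrC z (b ^+ 2)).
Qed.

End Perturbation.

(** * Perturbation of singular subspaces *)

Section Projections.
Context {R : realType}.
Implicit Types (m n p k : nat).

Lemma l2norm_sqr_le m n (u : 'cV[R]_m) (v : 'cV[R]_n) :
  (l2norm u <= l2norm v) = (normsq u <= normsq v).
Proof. by rewrite -[X in _ <= X]mul1r l2norm_le// expr1n mul1r. Qed.

Lemma dotv_proj n (P : 'M[R]_n) u v : P^T = P -> P *m P = P ->
  dotv (P *m u) ((1%:M - P) *m v) = 0.
Proof.
by move=> PT PP; rewrite dotv_adj PT mulmxA mulmxBr mulmx1 PP subrr mul0mx dotv0r.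
Qed.

Lemma normsq_proj n (P : 'M[R]_n) v : P^T = P -> P *m P = P ->
  normsq v = normsq (P *m v) + normsq ((1%:M - P) *m v).
Proof.
move=> PT PP; rewrite {1}(_ : v = P *m v + (1%:M - P) *m v); last first.
  by rewrite mulmxBl mul1mx addrC subrK.
by rewrite normsqD dotv_proj// mulr0 addr0.
Qed.

(** (P - P') v is the difference of P (1 - P') v and (1 - P) P' v, which are orthogonal, and they
    act on the two orthogonal parts of v. Pythagoras thus gives the larger of the two bounds instead
    of their sum. *)
Lemma opnorm_proj_sub n (P P' : 'M[R]_n) t :
  P^T = P -> P *m P = P -> P'^T = P' -> P' *m P' = P' ->
  opnorm ((1%:M - P') *m P) <= t -> opnorm ((1%:M - P) *m P') <= t ->
  opnorm (P - P') <= t.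
Proof.
move=> PT PP PT' PP' h1 h2; have t0 := le_trans (opnorm_ge0 _) h1.
have cT (Q : 'M[R]_n) : Q^T = Q -> (1%:M - Q)^T = 1%:M - Q.
  by move=> QT; rewrite linearB/= trmx1 QT.
have cI (Q : 'M[R]_n) : Q *m Q = Q -> (1%:M - Q) *m (1%:M - Q) = 1%:M - Q.
  by move=> QQ; rewrite mulmxBl mul1mx mulmxBr mulmx1 QQ subrr subr0.
have normle (M : 'M[R]_n) v : opnorm M <= t ->
    normsq (M *m v) <= t ^+ 2 * normsq v.
  move=> Mt; rewrite -l2norm_le//.
  by rewrite (le_trans (opnorm_bound _ _))// ler_wpM2r ?l2norm_ge0.
apply: opnorm_le => // v; rewrite l2norm_le//.
have -> : (P - P') *m v
    = P *m ((1%:M - P') *m v) - (1%:M - P) *m (P' *m v).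
  by rewrite !mulmxBl !mul1mx mulmxBr opprB addrA subrK.
rewrite normsqB dotv_proj// mulr0 subr0 (normsq_proj v PT' PP') mulrDr addrC.
have -> : P *m ((1%:M - P') *m v) = P *m (1%:M - P') *m ((1%:M - P') *m v).
  by rewrite -mulmxA (mulmxA (1%:M - P')) cI.
have -> : (1%:M - P) *m (P' *m v) = (1%:M - P) *m P' *m (P' *m v).
  by rewrite -mulmxA (mulmxA P') PP'.
apply: lerD; apply: normle => //.
by rewrite -opnorm_trmx trmx_mul cT// PT.
Qed.

Lemma inj_mx_unit k (B : 'M[R]_k) :
  (forall c : 'cV[R]_k, B *m c = 0 -> c = 0) -> B \in unitmx.
Proof.
move=> inj; rewrite -unitmx_tr -row_free_unit -kermx_eq0.
apply/eqP/row_matrixP => i; rewrite row0; apply: trmx_inj; rewrite trmx0.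
apply: inj; apply: trmx_inj; rewrite trmx_mul trmxK trmx0.
by rewrite -row_mul mulmx_ker row0.
Qed.

Lemma isom_idem n k (Q : 'M[R]_(n, k)) : Q^T *m Q = 1%:M ->
  Q *m Q^T *m (Q *m Q^T) = Q *m Q^T.
Proof. by move=> QQ; rewrite mulmxA -(mulmxA _ _ Q) QQ mulmx1. Qed.

Lemma opnorm_isomT m n (Q : 'M[R]_(m, n)) : Q^T *m Q = 1%:M -> opnorm Q^T <= 1.
Proof.
move=> QQ; rewrite opnorm_trmx; apply: opnorm_le => // v.
by rewrite mul1r l2norm_isom.
Qed.

Lemma sval_gt0_lt p (s : 'rV[R]_p) i : 0 < sval_nth s i.+1 -> (i < p)%N.
Proof. by rewrite ltnNge; apply: contraTN => pi; rewrite sval_nth0// ltxx. Qed.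

Section SketchedRange.
Variables (m n p k : nat) (X : 'M[R]_(m, n)).
Variables (U : 'M[R]_(m, p)) (s : 'rV[R]_p) (V : 'M[R]_(n, p)).
Variables (W : 'M[R]_(n, k.+1)) (sn tn : R).
Hypothesis svdX : svd X U s V.
Hypothesis sk_gt0 : 0 < sval_nth s k.+1.
Hypothesis WW : W^T *m W = 1%:M.
Hypothesis W_sin : opnorm ((1%:M - proj_first k.+1 V) *m W) <= sn.
Hypothesis sn1 : sn ^+ 2 < 1.
Hypothesis tn0 : 0 <= tn.
Hypothesis tnE : tn ^+ 2 * (1 - sn ^+ 2) = sn ^+ 2.

Local Notation sk := (sval_nth s k.+1).
Local Notation Vk := (first_cols k.+1 V).
Local Notation Uk := (first_cols k.+1 U).
Local Notation PU := (proj_first k.+1 U).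
Local Notation PV := (proj_first k.+1 V).

Let kp : (k < p)%N := sval_gt0_lt sk_gt0.
Let VV : Vk^T *m Vk = 1%:M := first_cols_isom (svd_trmx svdX) kp.
Let UU : Uk^T *m Uk = 1%:M := first_cols_isom svdX kp.

(** [sn] bounds the sine of the angle between the range of W and that of V_k, and [tn] is by [tnE]
    the tangent of the angle with sine [sn]. The sine bound is solved for the part outside V_k by
    Pythagoras. *)
Let tan_bound c :
  normsq ((1%:M - PV) *m (W *m c)) <= tn ^+ 2 * normsq (Vk^T *m (W *m c)).
Proof.
set q := normsq _; set r := normsq _.
have cqr : normsq c = r + q.
  rewrite -(normsq_isom c WW) (@normsq_proj _ PV) ?proj_firstT ?isom_idem//.
  by rewrite /proj_first -mulmxA normsq_isom.
have sn0 : 0 <= sn := le_trans (opnorm_ge0 _) W_sin.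
have : q <= sn ^+ 2 * normsq c.
  rewrite -l2norm_le// mulmxA (le_trans (opnorm_bound _ _))//.
  by rewrite ler_wpM2r ?l2norm_ge0.
rewrite cqr => h; have d0 : 0 < 1 - sn ^+ 2 by rewrite subr_gt0.
rewrite -(ler_pM2r d0) mulrAC tnE; lra.
Qed.

Let upper_mul c : sk * l2norm (Vk^T *m (W *m c)) <= l2norm (Uk^T *m (X *m (W *m c))).
Proof.
have := svd_mul_first_cols svdX k.+1 => XU.
have -> : Uk^T *m (X *m (W *m c)) = diag_mx (\row_(i < k.+1) sval_nth s i.+1) *m
    (Vk^T *m (W *m c)).
  rewrite [in LHS]mulmxA -[Uk^T *m X]trmxK trmx_mul trmxK XU trmx_mul tr_diag_mx.
  by rewrite -mulmxA.
rewrite -(ler_pXn2r (n := 2)) ?nnegrE ?mulr_ge0 ?l2norm_ge0 ?(ltW sk_gt0)//.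
rewrite exprMn !sqr_l2norm normsq_diag normsqE mulr_sumr.
apply: ler_sum => i _; rewrite mxE ler_wpM2r ?sqr_ge0//.
by rewrite ler_sqr ?nnegrE ?(sval_ge0 svdX)// (sval_dec svdX)// -ltnS.
Qed.

(** X carries the complement of V_k into that of U_k with norm at most sigma_{k+1}, which does not
    exceed the sigma_k of [upper_mul]: the tangent does not grow under X. *)
Let lower_mul c :
  l2norm ((1%:M - PU) *m (X *m (W *m c))) <= sk * tn * l2norm (Vk^T *m (W *m c)).
Proof.
have svdXT := svd_trmx svdX.
have -> : (1%:M - PU) *m (X *m (W *m c)) = X *m ((1%:M - PV) *m (W *m c)).
  have := svd_proj_comm k.+1 svdXT; rewrite trmxK => XP.
  by rewrite !mulmxA mulmxBl mul1mx -XP mulmxBr mulmx1 !mulmxBl !mulmxA.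
have := @svd_bottom _ _ _ _ _ _ _ _ svdXT k.+1 ((1%:M - PV) *m (W *m c)).
rewrite trmxK mulmxA cproj_first// mul0mx => /(_ erefl) h.
apply: le_trans h _; rewrite -mulrA; apply: ler_pM.
- exact: sval_ge0 svdX _.
- exact: l2norm_ge0.
- exact: (sval_dec svdX).
- by rewrite l2norm_le// tan_bound.
Qed.

Lemma sketched_tan c :
  l2norm ((1%:M - PU) *m (X *m (W *m c))) <= tn * l2norm (X *m (W *m c)).
Proof.
apply: le_trans (lower_mul c) _; rewrite mulrAC mulrC ler_wpM2l//.
apply: le_trans (upper_mul c) _; rewrite l2norm_sqr_le.
exact: (bessel_first svdX).
Qed.

(** If X W c = 0, then W c has no component along V_k by [upper_mul], hence none outside by
    [tan_bound]. *)
Lemma sketched_inj (c : 'cV[R]_k.+1) : X *m (W *m c) = 0 -> c = 0.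
Proof.
move=> XW0; have := upper_mul c; rewrite XW0 mulmx0 l2norm0 pmulr_rle0// => h.
have /eqP : l2norm (Vk^T *m (W *m c)) == 0 by rewrite eq_le h l2norm_ge0.
move/eqP; rewrite l2norm_eq0 => /eqP VW0; have := tan_bound c.
rewrite VW0 normsq0 mulr0 => q0; apply/eqP; rewrite -normsq_eq0.
rewrite -(normsq_isom c WW) (@normsq_proj _ PV) ?proj_firstT ?isom_idem//.
rewrite /proj_first -mulmxA VW0 mulmx0 normsq0 add0r.
by rewrite eq_le normsq_ge0 andbT -/(proj_first _ _).
Qed.

(** The converse direction rests on equal dimensions: U_k^T X W is square and injective, hence
    invertible, and c is chosen with U_k^T X W c = y, which leaves only the component outside U_k to
    bound. *)
Lemma sketched_cover y : exists c,
  l2norm (Uk *m y - X *m (W *m c)) <= tn * l2norm y.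
Proof.
have inj (c : 'cV[R]_k.+1) : (Uk^T *m (X *m W)) *m c = 0 -> c = 0.
  move=> h; apply: sketched_inj; have := upper_mul c.
  rewrite !mulmxA -(mulmxA _ X) h l2norm0 pmulr_rle0// => h'.
  have := lower_mul c; rewrite (_ : l2norm (Vk^T *m _) = 0); last first.
    by apply/eqP; rewrite eq_le l2norm_ge0 andbT !mulmxA.
  rewrite mulr0 mulmxBl mul1mx /proj_first -!mulmxA.
  rewrite (mulmxA X) (mulmxA _ _ c) h mulmx0 subr0 => h''.
  by apply/eqP; rewrite -l2norm_eq0 eq_le h'' l2norm_ge0.
have unit : Uk^T *m (X *m W) \in unitmx := inj_mx_unit inj.
exists (invmx (Uk^T *m (X *m W)) *m y); set c := invmx _ *m y.
have Uc : Uk^T *m (X *m (W *m c)) = y.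
  by rewrite (mulmxA X) (mulmxA Uk^T) mulKVmx.
have -> : Uk *m y - X *m (W *m c) = - ((1%:M - PU) *m (X *m (W *m c))).
  by rewrite mulmxBl mul1mx /proj_first -mulmxA Uc opprB.
rewrite l2normN (le_trans (lower_mul c))// mulrAC mulrC ler_wpM2l//.
by rewrite (le_trans (upper_mul c))// Uc.
Qed.

(** P is only characterized as the orthogonal projection on the range of X W, so that it can later
    be M M^+ for a matrix M with that range. *)
Lemma sketched_proj_close (P : 'M[R]_m) : P^T = P -> P *m P = P ->
  P *m (X *m W) = X *m W ->
  (forall v : 'cV[R]_m, exists c : 'cV[R]_k.+1, P *m v = X *m W *m c) ->
  opnorm (P - PU) <= tn.
Proof.
move=> PT PP PXW Pim; apply: opnorm_proj_sub => //.
- exact: proj_firstT.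
- exact: isom_idem UU.
- apply: opnorm_le => // v; rewrite -mulmxA; have [c Pv] := Pim v.
  rewrite Pv -mulmxA (le_trans (sketched_tan c))// ler_wpM2l// mulmxA -Pv.
  by rewrite l2norm_sqr_le (normsq_proj v PT PP) lerDl normsq_ge0.
- apply: opnorm_le => // v; rewrite -mulmxA.
  rewrite {1}/proj_first -mulmxA; set y := Uk^T *m v.
  have [c hc] := sketched_cover y.
  have -> : (1%:M - P) *m (Uk *m y) = (1%:M - P) *m (Uk *m y - X *m (W *m c)).
    rewrite mulmxBr (mulmxA X) [X in _ = _ - X]mulmxA.
    by rewrite (mulmxBl _ _ (X *m W)) mul1mx PXW subrr mul0mx subr0.
  apply: (@le_trans _ _ (l2norm (Uk *m y - X *m (W *m c)))).
    by rewrite l2norm_sqr_le [leRHS](normsq_proj _ PT PP) lerDr normsq_ge0.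
  apply: le_trans hc _; rewrite ler_wpM2l// l2norm_sqr_le.
  exact: (bessel_first svdX).
Qed.

End SketchedRange.

(** e is a perturbation, [del] a gap and D the gap that is left. The hypothesis e (1 + h) <= h del
    is e / (del - e) <= h without division; it is the origin of h / (1 + h) in [eps_right] and
    [eps_left]. *)
Lemma gap_quotient (e h del D : R) : 0 <= e -> 0 <= h -> 0 < del ->
  e * (1 + h) <= h * del -> del - e <= D -> 0 < D /\ e / D <= h.
Proof.
move=> e0 h0 d0 eh De; have D0 : 0 < D by nra.
by split => //; rewrite ler_pdivrMr//; nra.
Qed.

Lemma two_sided_projection n d r q p p' k (A : 'M[R]_(n, d)) (X : 'M[R]_(n, r))
    (Y : 'M[R]_(q, r)) (U : 'M[R]_(n, p)) s V (UY : 'M[R]_(q, p')) sY VY nu tau :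
  svd A U s V -> svd Y UY sY VY -> 0 < nu < 1 -> 0 < tau < 1 ->
  (nu / 2) ^+ 2 * (1 - tau ^+ 2) = tau ^+ 2 ->
  sigma A k.+2 < sigma A k.+1 ->
  opnorm (X *m X^T - A *m A^T) * (1 + nu / 2)
    <= nu / 2 * (sigma A k.+1 ^+ 2 - sigma A k.+2 ^+ 2) ->
  opnorm (Y^T *m Y - X^T *m X) * (1 + tau)
    <= tau * (sigma X k.+1 ^+ 2 - sigma X k.+2 ^+ 2) ->
  let W := first_cols k.+1 VY in
  (forall c : 'cV[R]_k.+1, X *m W *m c = 0 -> c = 0) /\
  forall P : 'M[R]_n, P^T = P -> P *m P = P ->
    P *m (X *m W) = X *m W ->
    (forall v : 'cV[R]_n, exists c : 'cV[R]_k.+1, P *m v = X *m W *m c) ->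
    opnorm (P - proj_first k.+1 U) <= nu.
Proof.
move=> sA sYY /andP[nu0 nu1] /andP[tau0 tau1] tauE gapA hG hS W.
have [UX [VX sX]] := exists_singvals X; set sx := singvals X in sX.
rewrite !(sigmaE _ sA) in gapA hG; rewrite !(sigmaE _ sX) in hS.
have h0 : 0 <= nu / 2 by rewrite divr_ge0// ltW.
set e2 := opnorm (X *m X^T - A *m A^T) in hG.
have e20 : 0 <= e2 := opnorm_ge0 _.
have e2E : opnorm (A *m A^T - X *m X^T) = e2 by rewrite -opnormN opprB.
have dA : 0 < sval_nth s k.+1 ^+ 2 - sval_nth s k.+2 ^+ 2.
  by rewrite subr_gt0 ltr_sqr// nnegrE (sval_ge0 sA).
have kp : (k < p)%N.
  by apply: (@sval_gt0_lt _ s); apply: le_lt_trans gapA; exact: sval_ge0 sA _.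
have wAX i : sval_nth s i.+1 ^+ 2 <= sval_nth sx i.+1 ^+ 2 + e2.
  by apply: weyl sA sX _; rewrite e2E.
have wXA i : sval_nth sx i.+1 ^+ 2 <= sval_nth s i.+1 ^+ 2 + e2.
  exact: weyl sX sA _.
(* Davis-Kahan is applied both ways between A and X, which takes the two mixed gaps. Weyl moves one
   end of each, so [e2] is lost once and not twice. *)
have d1 : sval_nth s k.+1 ^+ 2 - sval_nth s k.+2 ^+ 2 - e2
    <= sval_nth sx k.+1 ^+ 2 - sval_nth s k.+2 ^+ 2 by have := wAX k; lra.
have [D1 q1] := gap_quotient e20 h0 dA hG d1.
have d2 : sval_nth s k.+1 ^+ 2 - sval_nth s k.+2 ^+ 2 - e2
    <= sval_nth s k.+1 ^+ 2 - sval_nth sx k.+2 ^+ 2 by have := wXA k.+1; lra.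
have [D2 q2] := gap_quotient e20 h0 dA hG d2.
have {}D1 : sval_nth s k.+2 < sval_nth sx k.+1.
  by rewrite -ltr_sqr ?nnegrE ?(sval_ge0 sA) ?(sval_ge0 sX)// -subr_gt0.
have {}D2 : sval_nth sx k.+2 < sval_nth s k.+1.
  by rewrite -ltr_sqr ?nnegrE ?(sval_ge0 sA) ?(sval_ge0 sX)// -subr_gt0.
have sxk0 : 0 < sval_nth sx k.+1 := le_lt_trans (sval_ge0 sA _) D1.
have kpx := sval_gt0_lt sxk0.
have UUx := first_cols_isom sX kpx; have UUa := first_cols_isom sA kp.
have close : opnorm (proj_first k.+1 UX - proj_first k.+1 U) <= nu / 2.
  have half m' (M : 'M[R]_(m', k.+1)) (Q : 'M[R]_(n, k.+1)) :
      opnorm M <= nu / 2 -> Q^T *m Q = 1%:M -> opnorm (M *m Q^T) <= nu / 2.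
    move=> Mnu QQ; apply: le_trans (opnorm_mul _ _) _; rewrite -[leRHS]mulr1.
    by apply: ler_pM (opnorm_ge0 _) (opnorm_ge0 _) Mnu (opnorm_isomT QQ).
  apply: (opnorm_proj_sub (proj_firstT _ _) (isom_idem UUx)
    (proj_firstT _ _) (isom_idem UUa)); rewrite mulmxA; apply: half => //.
  - apply: le_trans (davis_kahan sX sA kpx kp D1) _.
    exact: q1.
  - apply: le_trans (davis_kahan sA sX kp kpx D2) _; rewrite e2E.
    exact: q2.
set e1 := opnorm (Y^T *m Y - X^T *m X) in hS.
have e10 : 0 <= e1 := opnorm_ge0 _.
(* In the gap of X itself both ends move, but nu < 1 keeps 2 [e2] below the gap of A. *)
have dX : 0 < sval_nth sx k.+1 ^+ 2 - sval_nth sx k.+2 ^+ 2.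
  have := wAX k; have := wXA k.+1.
  have : e2 * 2 < sval_nth s k.+1 ^+ 2 - sval_nth s k.+2 ^+ 2 by nra.
  lra.
have wXY : sval_nth sx k.+1 ^+ 2 <= sval_nth sY k.+1 ^+ 2 + e1.
  by apply: weyl (svd_trmx sX) (svd_trmx sYY) _; rewrite !trmxK -opnormN opprB.
have d3 : sval_nth sx k.+1 ^+ 2 - sval_nth sx k.+2 ^+ 2 - e1
    <= sval_nth sY k.+1 ^+ 2 - sval_nth sx k.+2 ^+ 2 by lra.
have [D3 q3] := gap_quotient e10 (ltW tau0) dX hS d3.
have {}D3 : sval_nth sx k.+2 < sval_nth sY k.+1.
  by rewrite -ltr_sqr ?nnegrE ?(sval_ge0 sYY) ?(sval_ge0 sX)// -subr_gt0.
have kpY := sval_gt0_lt (le_lt_trans (sval_ge0 sX _) D3).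
have WW : W^T *m W = 1%:M := first_cols_isom (svd_trmx sYY) kpY.
(* Davis-Kahan for the transposes: W consists of right singular vectors of Y, compared with those of
   X. *)
have sinW : opnorm ((1%:M - proj_first k.+1 VX) *m W) <= tau.
  apply: le_trans (davis_kahan (svd_trmx sYY) (svd_trmx sX) kpY kpx D3) _.
  by rewrite !trmxK; exact: q3.
have tau21 : tau ^+ 2 < 1 by rewrite expr_lt1// ltW.
split=> [c|P PT PP PXW Pim].
  rewrite -mulmxA; exact: sketched_inj sX sxk0 WW sinW tau21 tauE _.
have := sketched_proj_close sX sxk0 WW sinW tau21 h0 tauE PT PP PXW Pim => cl.
have -> : P - proj_first k.+1 U = (P - proj_first k.+1 UX) +
    (proj_first k.+1 UX - proj_first k.+1 U) by rewrite addrA subrK.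
by rewrite (le_trans (opnormD _ _))// (splitr nu); apply: lerD cl close.
Qed.

End Projections.

(** * Principal component and least squares estimators *)

Section Estimators.
Context {R : realType}.
Implicit Types (m n p k : nat).

(** (M^T M)^-1 M^T shows that a Moore-Penrose inverse exists, so the chosen one satisfies the four
    equations; cancelling M^T M in M^T M Y M = M^T M makes it a left inverse. *)
Lemma pinv_inj n k (M : 'M[R]_(n, k)) :
  (forall c : 'cV[R]_k, M *m c = 0 -> c = 0) ->
  moore_penrose M (Defs.pinv M) /\ Defs.pinv M *m M = 1%:M.
Proof.
move=> inj; have unit : M^T *m M \in unitmx.
  apply: inj_mx_unit => c Mc; apply: inj; apply/eqP; rewrite -normsq_eq0.
  by rewrite /normsq dotv_adj mulmxA Mc dotv0r.
have mp : moore_penrose M (invmx (M^T *m M) *m M^T).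
  split.
  - by rewrite -!mulmxA mulVmx// mulmx1.
  - by rewrite -(mulmxA (invmx _)) mulVmx// mul1mx.
  - by rewrite mulmxA !trmx_mul trmxK trmx_inv trmx_mul trmxK mulmxA.
  - by rewrite -mulmxA mulVmx// trmx1.
have mp' : moore_penrose M (Defs.pinv M).
  exact: (xgetPex 0 (ex_intro [set Y | moore_penrose M Y] _ mp)).
split=> //; case: mp' => MYM _ _ _.
have : M^T *m (M *m (Defs.pinv M *m M)) = M^T *m (M *m 1%:M).
  by rewrite mulmx1 (mulmxA M) MYM.
by rewrite !(mulmxA M^T) => /(can_inj (mulKmx unit)).
Qed.

(** For a symmetric idempotent the squared Frobenius norm is the trace, and tr (M Y) = tr (Y M) = k.
    This is the variance of a projection estimator up to the noise level. *)
Lemma frobnorm_proj n k (M : 'M[R]_(n, k)) (Y : 'M[R]_(k, n)) :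
  Y *m M = 1%:M -> (M *m Y)^T = M *m Y -> frobnorm (M *m Y) ^+ 2 = k%:R.
Proof.
move=> YM PT; rewrite -[RHS](mxtrace1 R k) -YM mxtrace_mulC.
transitivity (\tr ((M *m Y)^T *m (M *m Y))).
  rewrite sqr_frobnorm exchange_big /mxtrace; apply: eq_bigr => i _.
  by rewrite mxE; apply: eq_bigr => j _; rewrite [_^T _ _]mxE expr2.
by rewrite PT mulmxA -(mulmxA M) YM mulmx1.
Qed.

Lemma last_first_cols n p k (U : 'M[R]_(n, p)) : U^T *m U = 1%:M ->
  (last_cols k U)^T *m first_cols k U = 0.
Proof.
move=> UU; rewrite /last_cols /first_cols !colsE trmx_mul mulmxA.
rewrite -(mulmxA _ U^T) UU mulmx1; apply/matrixP => i j; rewrite !mxE.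
rewrite big1// => r _; rewrite [_^T _ _]mxE !colnE.
case: eqP => [->|_]; last by rewrite mul0r.
by rewrite add0n gtn_eqF ?mulr0// (leq_trans (ltn_ord j))// leq_addr.
Qed.

Lemma last_cols_bound m n p k (X : 'M[R]_(m, n)) (U : 'M[R]_(m, p)) s V v :
  svd X U s V -> l2norm ((last_cols k U)^T *m v) <= l2norm v.
Proof.
move=> sX; rewrite l2norm_sqr_le; apply: le_trans (bessel sX v).
rewrite /last_cols colsE trmx_mul -mulmxA; move: (U^T *m v) => w.
have -> : normsq w = normsq ((coln 0 k p)^T *m w) +
    normsq ((coln k (p - k) p)^T *m w).
  rewrite /normsq !dotv_adj !trmxK -dotvDr !mulmxA -mulmxDl coln_complement.
  by rewrite mul1mx.
by rewrite lerDr normsq_ge0.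
Qed.

Section PrincipalComponents.
Variables (n d p k : nat) (A : 'M[R]_(n, d)).
Variables (U : 'M[R]_(n, p)) (s : 'rV[R]_p) (V : 'M[R]_(d, p)).
Hypothesis svdA : svd A U s V.
Hypothesis sk_gt0 : 0 < sval_nth s k.+1.

Local Notation Dk := (diag_mx (\row_(i < k.+1) sval_nth s i.+1)).
Local Notation PU := (proj_first k.+1 U).
Local Notation Uk := (first_cols k.+1 U).
Local Notation Vk := (first_cols k.+1 V).

Let kp : (k < p)%N := sval_gt0_lt sk_gt0.
Let UU : Uk^T *m Uk = 1%:M := first_cols_isom svdA kp.

Lemma proj_first_idem : PU *m PU = PU.
Proof. exact: isom_idem UU. Qed.

Lemma mul_first_cols : A *m Vk = Uk *m Dk.
Proof. by have := svd_mul_first_cols (svd_trmx svdA) k.+1; rewrite trmxK. Qed.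

Lemma first_cols_range : Uk = A *m (Vk *m invmx Dk).
Proof.
have unit : Dk \in unitmx.
  rewrite unitmxE det_diag unitfE; apply/prodf_neq0 => i _; rewrite mxE.
  by rewrite gt_eqF// (lt_le_trans sk_gt0)// (sval_dec svdA)// -ltnS.
by rewrite mulmxA mul_first_cols -mulmxA mulmxV// mulmx1.
Qed.

(** As sigma_k > 0, A V_k and U_k have the same range. Then V_k D^-1 U_k^T b attains the minimum,
    and by Pythagoras all minimizers have the same image under A, so the choice made in [pcr_sol] is
    immaterial. *)
Lemma pcr_solE b : A *m pcr_sol A V k.+1 b = PU *m b.
Proof.
pose x0 := Vk *m (invmx Dk *m (Uk^T *m b)).
have Ax0 : A *m x0 = PU *m b.
  rewrite /proj_first -mulmxA [X in _ = X *m _]first_cols_range.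
  by rewrite /x0 !mulmxA.
have PAV (y : 'cV[R]_k.+1) : PU *m (A *m (Vk *m y)) = A *m (Vk *m y).
  have PUk : PU *m Uk = Uk by rewrite /proj_first -mulmxA UU mulmx1.
  by rewrite (mulmxA A) mul_first_cols -(mulmxA Uk) (mulmxA PU) PUk.
have split y : normsq (A *m (Vk *m y) - b)
    = normsq (A *m (Vk *m y) - PU *m b) + normsq (b - PU *m b).
  have -> : A *m (Vk *m y) - b = PU *m (A *m (Vk *m y) - b)
      - (1%:M - PU) *m b.
    by rewrite mulmxBr PAV mulmxBl mul1mx opprB addrA subrK.
  rewrite normsqB dotv_proj ?proj_firstT ?proj_first_idem// mulr0 subr0.
  by rewrite mulmxBl mul1mx mulmxBr PAV.
have : minimizers [set x | exists y, x = Vk *m y]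
    (fun x => l2norm (A *m x - b)) (pcr_sol A V k.+1 b).
  apply: (xgetPex 0); exists x0; split=> [|_ [y ->]]; first by eexists.
  rewrite l2norm_sqr_le !split -[A *m (Vk *m (invmx _ *m _))]/(A *m x0) Ax0.
  by rewrite subrr normsq0 add0r lerDr normsq_ge0.
move=> [[y ->]] /(_ x0) /(_ (ex_intro _ _ erefl)).
rewrite l2norm_sqr_le !split -[A *m (Vk *m (invmx _ *m _))]/(A *m x0) Ax0.
rewrite subrr normsq0 add0r gerDr => h.
by apply/eqP; rewrite -subr_eq0 -normsq_eq0 eq_le h normsq_ge0.
Qed.

(** Here A z is the projection of f on the range of A. This range contains that of U_k, so the bias
    is -(1 - PU) A z, no longer than A z and hence than f. *)
Lemma proj_first_bias f z : A^T *m (f - A *m z) = 0 ->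
  l2norm (PU *m f - A *m z) <= l2norm f.
Proof.
move=> Aorth; rewrite l2norm_sqr_le.
have -> : normsq f = normsq (A *m z) + normsq (f - A *m z).
  rewrite -{1}(subrK (A *m z) f) addrC normsqD dotv_adj Aorth dotv0r.
  by rewrite mulr0 addr0.
have -> : PU *m f - A *m z = - ((1%:M - PU) *m (A *m z)).
  have -> : PU *m f = PU *m (A *m z).
    apply/eqP; rewrite -subr_eq0 -mulmxBr /proj_first -mulmxA.
    by rewrite {2}first_cols_range trmx_mul -(mulmxA _ A^T) Aorth !mulmx0.
  by rewrite mulmxBl mul1mx opprB.
rewrite /normsq dotvNl dotvNr opprK -/(normsq _).
apply: ler_wpDr; first exact: normsq_ge0.
by rewrite [leRHS](normsq_proj _ (proj_firstT k.+1 U) proj_first_idem)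
  lerDr normsq_ge0.
Qed.

(** Both clauses see only (P - PU) b: the first by the reverse triangle inequality, the second
    because U_{k+}^T kills the range of U_k. *)
Lemma proj_first_approx_pcp (P : 'M[R]_n) nu b : opnorm (P - PU) <= nu ->
  approx_pcp A U V k.+1 nu nu b (P *m b).
Proof.
move=> Pnu; have bd : l2norm ((P - PU) *m b) <= nu * l2norm b.
  by rewrite (le_trans (opnorm_bound _ _))// ler_wpM2r ?l2norm_ge0.
split.
  rewrite pcr_solE; apply: le_trans (l2normB_ge _ _) _.
  by rewrite opprB addrA subrK -mulmxBl.
have -> : (last_cols k.+1 U)^T *m (P *m b)
    = (last_cols k.+1 U)^T *m ((P - PU) *m b).
  case: svdA => UU' _ _ _ _.
  rewrite mulmxBl mulmxBr /proj_first !mulmxA last_first_cols//.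
  by rewrite !mul0mx subr0.
by rewrite (le_trans (last_cols_bound _ _ svdA)).
Qed.

End PrincipalComponents.

(** The solution of the normal equations is sought in the range of A^T, that is orthogonal to the
    kernel of A, which makes it the shortest one. *)
Lemma exists_least_squares n d (A : 'M[R]_(n, d)) (f : 'cV[R]_n) :
  exists w, A^T *m (f - A *m (A^T *m w)) = 0.
Proof.
have [U [V [UU VV _ _ AE]]] := exists_singvals A; set s := singvals A in AE.
(* The inverse of 0 being 0, this is the pseudo-inverse of D^2, and zero singular values do no
   harm. *)
pose t := \row_i (s 0 i ^- 2).
exists (U *m (diag_mx t *m (U^T *m f))).
have ATm (y : 'cV[R]_n) : A^T *m y = V *m (diag_mx s *m (U^T *m y)).
  by rewrite AE !trmx_mul trmxK tr_diag_mx !mulmxA.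
have Am (y : 'cV[R]_d) : A *m y = U *m (diag_mx s *m (V^T *m y)).
  by rewrite AE !mulmxA.
rewrite mulmxBr !ATm Am.
rewrite (mulmxA U^T U) UU mul1mx (mulmxA V^T V) VV mul1mx (mulmxA U^T U) UU mul1mx.
rewrite -mulmxBr; apply/eqP; rewrite -[X in _ == X](mulmx0 _ V); apply/eqP.
congr (V *m _); apply/eqP; rewrite subr_eq0; apply/eqP/matrixP => i j.
rewrite !mul_diag_mx !mxE; have [->|s0] := eqVneq (s 0 i) 0.
  by rewrite !mul0r.
by congr (_ * _); field.
Qed.

(** The objective is |A x - f|^2 / n up to a constant, so its minimizers are the x with A x = A x0.
    Among them x0, in the range of A^T, is shortest; this gives existence, and hence the property of
    the chosen minimizer. *)
Lemma min_norm_minimizerE disp (Om : measurableType disp) (P : probability Om R)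
    n d (A : 'M[R]_(n, d)) (b : Om -> 'cV[R]_n) (f : 'cV[R]_n) (c : R) :
  (0 < n)%N ->
  (forall x, 'E_P[fun w => (l2norm (A *m x - b w) ^+ 2 / n%:R)%R]
    = ((normsq (A *m x - f) + c) / n%:R)%:E)%E ->
  A^T *m (f - A *m min_norm_minimizer P A b) = 0.
Proof.
move=> n0 bE; have [w Aw] := exists_least_squares A f; set x0 := A^T *m w in Aw.
have split x : normsq (A *m x - f) = normsq (A *m x - A *m x0) +
    normsq (A *m x0 - f).
  rewrite -[A *m x - f](subrKA (A *m x0)) normsqD.
  rewrite -mulmxBr dotv_adj -[A *m x0 - f]opprB mulmxN Aw oppr0 dotv0r.
  by rewrite mulr0 addr0.
have ninv : 0 < n%:R^-1 :> R by rewrite invr_gt0 ltr0n.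
have minP x : minimizers setT (fun x => 'E_P[fun w => (l2norm (A *m x - b w) ^+ 2
    / n%:R)%R])%E x <-> A *m x = A *m x0.
  split=> [[_ /(_ x0 I)]|h].
    rewrite !bE lee_fin ler_pM2r// lerD2r split gerDr => h.
    by apply/eqP; rewrite -subr_eq0 -normsq_eq0 eq_le h normsq_ge0.
  split=> // y _; rewrite !bE lee_fin ler_pM2r// lerD2r (split x) (split y).
  by rewrite h subrr normsq0 add0r lerDr normsq_ge0.
suff /minP -> : minimizers setT (fun x => 'E_P[fun w => (l2norm (A *m x - b w)
    ^+ 2 / n%:R)%R])%E (min_norm_minimizer P A b) by [].
suff [] : minimizers (minimizers setT (fun x => 'E_P[fun w => (l2norm
    (A *m x - b w) ^+ 2 / n%:R)%R])%E) (@l2norm R d) (min_norm_minimizer P A b).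
  by [].
apply: (xgetPex 0); exists x0; split=> [|y /minP h]; first exact/minP.
have -> : l2norm y = l2norm (y - x0 + x0) by rewrite subrK.
rewrite l2norm_sqr_le normsqD.
rewrite dotvC dotv_adj trmxK; move: (congr1 (fun z => z - A *m x0) h).
rewrite subrr -mulmxBr => ->; rewrite dotv0r mulr0 addr0.
by rewrite lerDr normsq_ge0.
Qed.

End Estimators.

(** * Moments and independence *)

Section Moments.
Local Open Scope ereal_scope.
Context d (T : measurableType d) (R : realType) (P : probability T R).

Import HBNNSimple.

Lemma measurable_indic_comp d' (T' : measurableType d') (X : T -> T') A :
  measurable_fun setT X -> measurable A ->
  measurable_fun setT (fun x => \1_A (X x) : R).
Proof.
move=> mX mA.
have mi : measurable_fun setT (\1_A : T' -> R) by exact: measurable_indic.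
exact: (measurableT_comp mi mX).
Qed.

(** From indicators to simple functions by linearity, then to nonnegative f by monotone convergence.
    The product formula for independent variables uses it twice, once for each factor. *)
Lemma ge0_integral_factor d' (T' : measurableType d') (X : T -> T')
    (g : T -> R) (c : \bar R) (f : T' -> R) :
  measurable_fun setT X -> measurable_fun setT g -> (forall x, 0 <= g x)%R ->
  c \is a fin_num -> 0 <= c ->
  (forall A, measurable A ->
     \int[P]_x (\1_A (X x) * g x)%:E = P (X @^-1` A) * c) ->
  measurable_fun setT f -> (forall y, 0 <= f y)%R ->
  \int[P]_x (f (X x) * g x)%:E = \int[P]_x (f (X x))%:E * c.
Proof.
move=> mX mg g0 cfin c0 hA mf f0.
have mEf : measurable_fun setT (EFin \o f) by exact/measurable_EFinP.
pose f_ := nnsfun_approx measurableT mEf.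
have fcvg x : (f_ n (X x))%:E @[n --> \oo] --> (f (X x))%:E.
  by apply: (cvg_nnsfun_approx measurableT mEf) => // y _; rewrite lee_fin.
have mfX n : measurable_fun setT (fun x => f_ n (X x)).
  exact: measurableT_comp.
have ndf x : {homo (fun n => (f_ n (X x))%:E) : m n / (m <= n)%N >-> m <= n}.
  by move=> m n mn; rewrite lee_fin; exact/lefP/nd_nnsfun_approx.
have simple n :
    \int[P]_x (f_ n (X x) * g x)%:E = \int[P]_x (f_ n (X x))%:E * c.
  have mA r : measurable (f_ n @^-1` [set r]) by exact: measurable_funPTI.
  have mind r : measurable_fun setT (fun x => \1_(f_ n @^-1` [set r]) (X x) : R).
    exact: measurable_indic_comp.
  have ind0 r x : (0 <= r * \1_(f_ n @^-1` [set r]) (X x))%R.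
    exact: nnfun_muleindic_ge0.
  have sumE x : (f_ n (X x))%:E
      = \sum_(r \in range (f_ n)) (r * \1_(f_ n @^-1` [set r]) (X x))%:E.
    by rewrite fimfunE -fsumEFin.
  transitivity (\int[P]_x \sum_(r \in range (f_ n))
      ((r * \1_(f_ n @^-1` [set r]) (X x))%:E * (g x)%:E)).
    apply: eq_integral => x _; rewrite EFinM sumE ge0_mule_fsuml// => r.
    by rewrite lee_fin.
  under [in RHS]eq_integral do rewrite sumE.
  rewrite !ge0_integral_fsum//; last 4 first.
  - by move=> r; apply/measurable_EFinP; exact: measurable_funM.
  - by move=> r x _; rewrite lee_fin.
  - move=> r; apply: emeasurable_funM; apply/measurable_EFinP => //.
    exact: measurable_funM.
  - by move=> r x _; rewrite -EFinM lee_fin mulr_ge0.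
  rewrite ge0_mule_fsuml; last first.
    by move=> r; apply: integral_ge0 => x _; rewrite lee_fin.
  apply: eq_fsbigr => r; rewrite inE => -[y _ ry].
  have rge0 : (0 <= r)%R by rewrite -ry.
  under eq_integral do rewrite -EFinM -mulrA EFinM.
  rewrite ge0_integralZl//; last 2 first.
  - by apply/measurable_EFinP; exact: measurable_funM.
  - by move=> x _; rewrite lee_fin mulr_ge0.
  rewrite hA//; under [in RHS]eq_integral do rewrite EFinM.
  rewrite ge0_integralZl//; last first.
    exact/measurable_EFinP.
  rewrite -muleA; congr (_ * (_ * _)).
  have mXA : measurable (X @^-1` (f_ n @^-1` [set r])).
    by rewrite -[_ @^-1` _]setTI; exact: mX.
  by rewrite -[LHS](congr1 P (setIT _)) -integral_indic.
transitivity (limn (fun n => \int[P]_x (f_ n (X x) * g x)%:E)).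
  rewrite -monotone_convergence//.
  - apply: eq_integral => x _; apply/esym/cvg_lim => //.
    under eq_fun do rewrite EFinM.
    by rewrite EFinM; apply: cvgeZr.
  - by move=> n; apply/measurable_EFinP; exact: measurable_funM.
  - by move=> n x _; rewrite lee_fin mulr_ge0.
  - move=> x _ m n mn; rewrite lee_fin ler_wpM2r//.
    by have := ndf x _ _ mn; rewrite lee_fin.
under eq_fun do rewrite simple.
apply/cvg_lim => //; apply: cvgeZr => //.
have -> : \int[P]_x (f (X x))%:E = \int[P]_x limn (fun n => (f_ n (X x))%:E).
  by apply: eq_integral => x _; apply/esym/cvg_lim => //; exact: fcvg.
apply: cvg_monotone_convergence => //.
- by move=> n; exact/measurable_EFinP.
- by move=> n x _; rewrite lee_fin.
Qed.

Lemma integral_preimage_indic d' (T' : measurableType d') (X : T -> T') A :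
  measurable_fun setT X -> measurable A ->
  \int[P]_x (\1_A (X x) : R)%:E = P (X @^-1` A).
Proof.
move=> mX mA; have mXA : measurable (X @^-1` A).
  by rewrite -[_ @^-1` _]setTI; exact: mX.
by rewrite -[RHS](congr1 P (setIT _)) -integral_indic.
Qed.

Lemma integral_preimage_indic_fin d' (T' : measurableType d') (X : T -> T') A :
  measurable_fun setT X -> measurable A -> P (X @^-1` A) \is a fin_num.
Proof.
move=> mX mA; rewrite fin_num_measure//.
by rewrite -[_ @^-1` _]setTI; exact: mX.
Qed.

Lemma ge0_integral_indep2 d1 d2 (T1 : measurableType d1) (T2 : measurableType d2)
    (X : T -> T1) (Y : T -> T2) (f : T1 -> R) (g : T2 -> R) :
  measurable_fun setT X -> measurable_fun setT Y ->
  (forall A B, measurable A -> measurable B ->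
     P (X @^-1` A `&` Y @^-1` B) = P (X @^-1` A) * P (Y @^-1` B)) ->
  measurable_fun setT f -> (forall y, 0 <= f y)%R ->
  measurable_fun setT g -> (forall y, 0 <= g y)%R ->
  \int[P]_x (g (Y x))%:E \is a fin_num ->
  \int[P]_x (f (X x) * g (Y x))%:E
  = \int[P]_x (f (X x))%:E * \int[P]_x (g (Y x))%:E.
Proof.
move=> mX mY XY mf f0 mg g0 gfin.
apply: (ge0_integral_factor mX) => //.
- exact: measurableT_comp.
- by apply: integral_ge0 => x _; rewrite lee_fin.
move=> A mA; rewrite muleC; under eq_integral do rewrite mulrC.
apply: (ge0_integral_factor mY (g := fun x => \1_A (X x))) => //.
- exact: measurable_indic_comp.
- exact: integral_preimage_indic_fin.
move=> B mB; rewrite muleC -XY//.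
rewrite -[RHS](congr1 P (setIT _)) -integral_indic//.
  by apply: eq_integral => x _; rewrite indicI/= mulrC.
apply: measurableI; rewrite -[_ @^-1` _]setTI; [exact: mX|exact: mY].
Qed.

(** Integrability together with the value as a real number, so that expectations are computed
    without infinite values. *)
Definition has_mean (f : T -> R) (m : R) : Prop :=
  P.-integrable setT (EFin \o f) /\ \int[P]_x (f x)%:E = m%:E.

Lemma has_mean_measurable f m : has_mean f m -> measurable_fun setT f.
Proof. by move=> [/measurable_int/measurable_EFinP]. Qed.

Lemma has_mean_cst c : has_mean (fun=> c) c.
Proof.
split; last by rewrite integral_cst//= probability_setT mule1.
exact: finite_measure_integrable_cst.
Qed.

Lemma has_meanD f g a b :
  has_mean f a -> has_mean g b -> has_mean (fun x => f x + g x)%R (a + b).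
Proof.
move=> [fi fa] [gi gb]; split.
  exact: (integrableD measurableT fi gi).
by under eq_integral do rewrite EFinD; rewrite integralD//= fa gb.
Qed.

Lemma has_meanZ f a c : has_mean f a -> has_mean (fun x => c * f x)%R (c * a).
Proof.
move=> [fi fa]; split.
  exact: (integrableZl measurableT c fi).
by under eq_integral do rewrite EFinM; rewrite integralZl//= fa.
Qed.

Lemma has_meanB f g a b :
  has_mean f a -> has_mean g b -> has_mean (fun x => f x - g x)%R (a - b).
Proof.
move=> fa /(has_meanZ (-1)) gb; rewrite -mulN1r.
rewrite (_ : (fun x => _) = (fun x => f x + -1 * g x)%R); first exact: has_meanD.
by apply/funext => x; rewrite mulN1r.
Qed.

Lemma has_mean_sum (I : Type) (r : seq I) (f : I -> T -> R) (m : I -> R) :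
  (forall i, has_mean (f i) (m i)) ->
  has_mean (fun x => \sum_(i <- r) f i x)%R (\sum_(i <- r) m i)%R.
Proof.
move=> fm; elim: r => [|i r ih].
  rewrite big_nil (_ : (fun x => _) = cst 0%R); first exact: has_mean_cst.
  by apply/funext => x; rewrite big_nil.
rewrite big_cons (_ : (fun x => _) =
  (fun x => f i x + \sum_(i <- r) f i x)%R); first exact: has_meanD.
by apply/funext => x; rewrite big_cons.
Qed.

Lemma has_mean_uniq f a b : has_mean f a -> has_mean f b -> a = b.
Proof. by move=> [_ fa] [_]; rewrite fa => -[]. Qed.

Lemma has_mean_ge0 (f : T -> R) : measurable_fun setT f -> (forall x, 0 <= f x)%R ->
  \int[P]_x (f x)%:E < +oo -> has_mean f (fine (\int[P]_x (f x)%:E)).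
Proof.
move=> mf f0 foo; split; last first.
  by rewrite fineK// ge0_fin_numE// integral_ge0// => x _; rewrite lee_fin.
apply/integrableP; split; first exact/measurable_EFinP.
by under eq_integral do rewrite abse_EFin ger0_norm//.
Qed.

Lemma has_mean_le (f g : T -> R) a : measurable_fun setT f ->
  (forall x, `|f x| <= g x)%R -> has_mean g a -> exists b, has_mean f b.
Proof.
move=> mf fg [gi _]; have fi : P.-integrable setT (EFin \o f).
  apply: (le_integrable measurableT _ _ gi); first exact/measurable_EFinP.
  by move=> x _; rewrite !abse_EFin lee_fin (le_trans (fg x))// ler_norm.
exists (fine (\int[P]_x (f x)%:E)); split => //.
by rewrite fineK// integrable_fin_num.
Qed.

Lemma has_mean_indic d' (T' : measurableType d') (X : T -> T') A :
  measurable_fun setT X -> measurable A ->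
  has_mean (fun x => \1_A (X x)) (fine (P (X @^-1` A))).
Proof.
move=> mX mA; have PA := integral_preimage_indic_fin mX mA.
rewrite -integral_preimage_indic//; apply: has_mean_ge0 => //.
  exact: measurable_indic_comp.
by rewrite integral_preimage_indic// ltey_eq PA.
Qed.

(** Positive and negative parts give four products of nonnegative functions, to which the
    nonnegative formula applies. *)
Lemma has_mean_mul_indep (X Y : T -> R) a b :
  (forall A B : set (measurableTypeR R), measurable A -> measurable B ->
     P (X @^-1` A `&` Y @^-1` B) = P (X @^-1` A) * P (Y @^-1` B)) ->
  has_mean X a -> has_mean Y b -> has_mean (fun x => X x * Y x)%R (a * b).
Proof.
move=> XY Xa Yb.
have mX := has_mean_measurable Xa; have mY := has_mean_measurable Yb.
pose pos (x : R) := Num.max x 0%R; pose neg (x : R) := Num.max (- x)%R 0%R.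
have mpos : measurable_fun setT pos by exact: measurable_maxr.
have mneg : measurable_fun setT neg.
  by apply: measurable_maxr => //; exact: measurable_funN.
have pos0 x : (0 <= pos x)%R by rewrite le_max lexx orbT.
have neg0 x : (0 <= neg x)%R by rewrite le_max lexx orbT.
have pn x : (x = pos x - neg x)%R.
  rewrite /pos /neg; have [x0|x0] := leP 0%R x.
    by rewrite max_r ?subr0// oppr_le0.
  by rewrite max_l ?sub0r ?opprK// oppr_ge0 ltW.
have posn x : (`|pos x| <= `|x|)%R.
  by rewrite ger0_norm// ge_max ler_norm normr_ge0.
have negn x : (`|neg x| <= `|x|)%R.
  by rewrite ger0_norm// ge_max normr_ge0 -normrN ler_norm.
have part (Z : T -> R) m (h : R -> R) : has_mean Z m -> measurable_fun setT h ->
    (forall x, `|h x| <= `|x|)%R -> exists m', has_mean (h \o Z) m'.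
  move=> Zm mh hn; have mZ := has_mean_measurable Zm.
  have nZ : has_mean (fun x => `|Z x|)%R (fine (\int[P]_x (`|Z x|)%:E)).
    apply: has_mean_ge0 => //; first exact: measurableT_comp.
    by case: Zm => /integrableP[_].
  apply: has_mean_le nZ; first exact: measurableT_comp.
  by move=> x /=; exact: hn.
have prod (h1 h2 : R -> R) m1 m2 : measurable_fun setT h1 ->
    measurable_fun setT h2 -> (forall x, 0 <= h1 x)%R -> (forall x, 0 <= h2 x)%R ->
    has_mean (h1 \o X) m1 -> has_mean (h2 \o Y) m2 ->
    has_mean (fun x => h1 (X x) * h2 (Y x))%R (m1 * m2).
  move=> mh1 mh2 h10 h20 [_ e1] [_ e2].
  have e : \int[P]_x (h1 (X x) * h2 (Y x))%:E = (m1 * m2)%:E.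
    rewrite (@ge0_integral_indep2 _ _ (measurableTypeR R) (measurableTypeR R) X Y)//.
      by rewrite e1 e2.
    by rewrite e2.
  rewrite -[(m1 * m2)%R]/(fine (m1 * m2)%:E) -e; apply: has_mean_ge0.
  - by apply: measurable_funM; exact: measurableT_comp.
  - by move=> x; rewrite mulr_ge0.
  - by rewrite e ltry.
have [xp Xp] := part _ _ _ Xa mpos posn; have [xn Xn] := part _ _ _ Xa mneg negn.
have [yp Yp] := part _ _ _ Yb mpos posn; have [yn Yn] := part _ _ _ Yb mneg negn.
have aE : a = (xp - xn)%R.
  apply: has_mean_uniq Xa _; rewrite (_ : X = fun x => pos (X x) - neg (X x))%R.
    exact: has_meanB.
  by apply/funext => x; rewrite -pn.
have bE : b = (yp - yn)%R.
  apply: has_mean_uniq Yb _; rewrite (_ : Y = fun x => pos (Y x) - neg (Y x))%R.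
    exact: has_meanB.
  by apply/funext => x; rewrite -pn.
rewrite (_ : (fun x => _) = (fun x =>
  (pos (X x) * pos (Y x) - pos (X x) * neg (Y x)) -
  (neg (X x) * pos (Y x) - neg (X x) * neg (Y x)))%R); last first.
  by apply/funext => x; rewrite {1}(pn (X x)) {1}(pn (Y x)); ring.
have -> : (a * b = (xp * yp - xp * yn) - (xn * yp - xn * yn))%R.
  by rewrite aE bE; ring.
by apply: has_meanB; apply: has_meanB; exact: prod.
Qed.

End Moments.

(** * Bias and variance of linear estimators in the fixed design model *)

Section WhiteNoise.
Context {R : realType} {disp : measure_display} {Om : measurableType disp}.
Variables (P : probability Om R) (n : nat) (s : R) (xi : 'I_n -> {RV P >-> R}).
Hypothesis noise : white_noise s xi.

Lemma has_mean_expectation (f : Om -> R) m : has_mean P f m -> 'E_P[f]%E = m%:E.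
Proof. by rewrite unlock => -[]. Qed.

Lemma mutually_independent2 (I : finType) (X : I -> Om -> R) i j
    (A B : set (measurableTypeR R)) :
  mutually_independent P X -> i != j -> measurable A -> measurable B ->
  P (X i @^-1` A `&` X j @^-1` B) = (P (X i @^-1` A) * P (X j @^-1` B))%E.
Proof.
move=> indX ij mA mB.
have := indX [set i; j]%SET (fun k => if k == i then A else B).
rewrite big_setU1 ?inE// big_set1 eqxx eq_sym (negbTE ij) => <-; last first.
  by move=> k; case: ifP.
congr (P _); apply/seteqP; split=> [w [Aw Bw] k|w h].
  by rewrite !inE => /orP[] /eqP ->; rewrite ?eqxx// eq_sym (negbTE ij).
split; first by have := h i; rewrite !inE eqxx; apply.
by have := h j; rewrite !inE eqxx orbT eq_sym (negbTE ij); apply.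
Qed.

Lemma noise_square i : has_mean P (fun w => xi i w * xi i w) (s ^+ 2).
Proof.
have [_ /(_ i) mean0 /(_ i)] := noise.
rewrite /variance unlock /covariance mean0 /= => var.
have e : (\int[P]_w (xi i w * xi i w)%:E = (s ^+ 2)%:E)%E.
  rewrite -var [in RHS]unlock; apply: eq_integral => w _.
  by transitivity (((xi i w - 0) * (xi i w - 0))%:E); first by rewrite !subr0.
rewrite -[s ^+ 2]/(fine (s ^+ 2)%:E) -e; apply: has_mean_ge0.
- exact: measurable_funM.
- by move=> w; rewrite -expr2 sqr_ge0.
- by rewrite e ltry.
Qed.

(** Integrability is drawn from |x| <= 1 + x^2 and the finite second moment; the value is then the
    given expectation. *)
Lemma noise_mean i : has_mean P (xi i) 0.
Proof.
have [_ /(_ i) mean0 _] := noise.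
have [b mb] : exists b, has_mean P (xi i) b.
  apply: has_mean_le (has_meanD (has_mean_cst P 1) (noise_square i)) => // w.
  have : 0 <= (`|xi i w| - 1) ^+ 2 by exact: sqr_ge0.
  have : 0 <= `|xi i w| by [].
  rewrite -[xi i w * xi i w]expr2 -[xi i w ^+ 2]real_normK ?num_real//; nra.
by move: (mb); rewrite (_ : b = 0)//; have := mean0;
  rewrite (has_mean_expectation mb) => -[].
Qed.

Lemma noise_mean2 i j :
  has_mean P (fun w => xi i w * xi j w) (s ^+ 2 * (i == j)%:R).
Proof.
have [<-|ij] := eqVneq i j; first by rewrite mulr1; exact: noise_square.
rewrite mulr0 -[0](mulr0 0); apply: has_mean_mul_indep; try exact: noise_mean.
move=> A B mA mB; have [ind _ _] := noise.
exact: (mutually_independent2 ind ij).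
Qed.

(** Bias-variance decomposition: in the expansion the linear term has mean 0, and uncorrelated noise
    keeps only j = l in the quadratic one. *)
Lemma noise_quadratic m (L : 'M[R]_(m, n)) (u : 'cV[R]_m) :
  has_mean P (fun w => normsq (u + L *m \col_i xi i w))
    (normsq u + s ^+ 2 * frobnorm L ^+ 2).
Proof.
rewrite (_ : (fun w => _) = fun w => normsq u + 2 * (\sum_(j < n)
    (L^T *m u) j 0 * xi j w) +
    \sum_(i < m) \sum_(j < n) \sum_(l < n) (L i j * L i l) * (xi j w * xi l w)).
  rewrite (_ : _ + _ = normsq u + 2 * (\sum_(j < n) (L^T *m u) j 0 * 0) +
    \sum_(i < m) \sum_(j < n) \sum_(l < n)
      (L i j * L i l) * (s ^+ 2 * (j == l)%:R)).
    apply: has_meanD.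
      apply: has_meanD; first exact: has_mean_cst.
      apply: has_meanZ; apply: has_mean_sum => j; apply: has_meanZ.
      exact: noise_mean.
    apply: has_mean_sum => i; apply: has_mean_sum => j; apply: has_mean_sum => l.
    by apply: has_meanZ; exact: noise_mean2.
  rewrite [X in _ + 2 * X]big1 => [|j _]; last by rewrite mulr0.
  rewrite mulr0 addr0 sqr_frobnorm mulr_sumr; congr (_ + _).
  apply: eq_bigr => i _; rewrite mulr_sumr; apply: eq_bigr => j _.
  rewrite (bigD1 j)//= big1 => [|l lj]; last first.
    by rewrite eq_sym (negbTE lj) !mulr0.
  by rewrite eqxx addr0 mulr1; ring.
apply/funext => w; rewrite normsqD dotvC dotv_adj dotvC; congr (_ + _ + _).
  by congr (2 * _); apply: eq_bigr => j _; rewrite [X in _ * X]mxE.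
rewrite normsqE; apply: eq_bigr => i _; rewrite mxE expr2 mulr_suml.
apply: eq_bigr => j _; rewrite mulr_sumr; apply: eq_bigr => l _.
by rewrite !mxE; ring.
Qed.

(** Used with L = 1 for the objective defining the best parameter, and with L an estimator for its
    excess risk. *)
Lemma expectation_residual m (L : 'M[R]_(m, n)) (f : 'cV[R]_n) (c : 'cV[R]_m) (g : Om -> R) :
  (forall w, g w = l2norm (L *m response f xi w - c) ^+ 2 / n%:R) ->
  'E_P[g]%E = ((normsq (L *m f - c) + s ^+ 2 * frobnorm L ^+ 2) / n%:R)%:E.
Proof.
move=> gE; apply: has_mean_expectation.
rewrite (_ : g = fun w => n%:R^-1 * normsq (L *m f - c + L *m \col_i xi i w)).
  by rewrite mulrC; apply: has_meanZ; exact: noise_quadratic.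
apply/funext => w; rewrite gE sqr_l2norm mulrC; congr (_ * normsq _).
by rewrite /response mulmxDr addrAC.
Qed.

Lemma least_squares_residual d (A : 'M[R]_(n, d)) (f : 'cV[R]_n) : (0 < n)%N ->
  A^T *m (f - A *m min_norm_minimizer P A (response f xi)) = 0.
Proof.
move=> n0; apply: (min_norm_minimizerE (c := s ^+ 2 * frobnorm (1%:M : 'M[R]_n) ^+ 2) n0).
move=> x; rewrite (@expectation_residual _ 1%:M f (A *m x)) => [|w].
  by rewrite mul1mx -[f - _]opprB /normsq dotvNl dotvNr opprK.
by rewrite mul1mx -[in RHS]l2normN opprB.
Qed.

Lemma excess_risk_linear d (A : 'M[R]_(n, d)) (f : 'cV[R]_n) theta (L : 'M[R]_n) :
  (forall y, A *m theta y = L *m y) ->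
  excess_risk P A (response f xi) theta
  = ((normsq (L *m f - A *m min_norm_minimizer P A (response f xi))
      + s ^+ 2 * frobnorm L ^+ 2) / n%:R)%:E.
Proof. by move=> AL; apply: expectation_residual => w; rewrite AL. Qed.

End WhiteNoise.

Section PerturbedEstimator.
Context {R : realType} {disp : measure_display} {Om : measurableType disp}.

Lemma excess_risk_perturbed (P : probability Om R) n d p p' q k
    (A : 'M[R]_(n, d)) (U : 'M[R]_(n, p)) sA (V : 'M[R]_(d, p)) (f : 'cV[R]_n)
    (xi : 'I_n -> {RV P >-> R}) s (Rm : 'M[R]_(d, q)) (V' : 'M[R]_(q, p')) nu :
  white_noise s xi -> svd A U sA V -> 0 < sval_nth sA k.+1 -> 0 <= nu ->
  (forall c : 'cV[R]_k.+1, A *m Rm *m first_cols k.+1 V' *m c = 0 -> c = 0) ->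
  opnorm (A *m Rm *m first_cols k.+1 V' *m
     Defs.pinv (A *m Rm *m first_cols k.+1 V') - proj_first k.+1 U) <= nu ->
  let xR := sketched_sol A Rm V' k.+1 in
  let b := response f xi in
  (forall w, approx_pcp A U V k.+1 nu nu (b w) (A *m xR (b w))) /\
  (excess_risk P A b xR <= excess_risk P A b (pcr_sol A V k.+1)
             + ((2 * nu + nu ^+ 2) * l2norm f ^+ 2 / n%:R)%:E)%E.
Proof.
move=> noise sA_ sk nu0 inj close xR b.
set M := _ *m first_cols k.+1 V' in inj close; set L := _ *m Defs.pinv M in close.
have AxR y : A *m xR y = L *m y by rewrite /xR /sketched_sol /L /M !mulmxA.
(* An injective map from a nonzero space has a nonzero target; n > 0 is needed for the division by
   n. *)
have n0 : (0 < n)%N.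
  have [c cn _] := exists_kernel_vector (0 : 'M[R]_(0, k.+1)) isT.
  case: (posnP n) => // n0; have /inj/eqP : M *m c = 0.
    apply/matrixP => i; exfalso; have := leq_ltn_trans (leq0n i) (ltn_ord i).
    by rewrite n0.
  by rewrite (negbTE cn).
split=> [w|]; first by rewrite AxR; exact: (proj_first_approx_pcp sA_ sk).
have kp := sval_gt0_lt sk; have UU := first_cols_isom sA_ kp.
have [[_ _ LT _] YM] := pinv_inj inj.
rewrite (excess_risk_linear noise _ AxR) (excess_risk_linear noise _ (pcr_solE sA_ sk)).
set z := min_norm_minimizer _ _ _.
have Az : A^T *m (f - A *m z) = 0 := least_squares_residual noise A f n0.
rewrite -EFinD lee_fin -mulrDl ler_pM2r ?invr_gt0 ?ltr0n//.
(* Both projections have trace k + 1, so the variances cancel. *)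
rewrite (frobnorm_proj YM LT) (frobnorm_proj UU (proj_firstT _ _)) addrAC lerD2r.
have bias := proj_first_bias sA_ sk Az.
have : l2norm (L *m f - A *m z) <= l2norm (proj_first k.+1 U *m f - A *m z)
    + nu * l2norm f.
  have -> : L *m f - A *m z = (proj_first k.+1 U *m f - A *m z)
      + (L - proj_first k.+1 U) *m f.
    by rewrite mulmxBl [RHS]addrC addrA subrK.
  apply: le_trans (l2normD _ _) _; rewrite lerD2l.
  by rewrite (le_trans (opnorm_bound _ _))// ler_wpM2r ?l2norm_ge0.
rewrite -!sqr_l2norm; set x := l2norm (L *m f - _); set y := l2norm (_ - _) in bias *.
have : 0 <= x by exact: l2norm_ge0.
have : 0 <= y by exact: l2norm_ge0.
have : 0 <= l2norm f by exact: l2norm_ge0.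
move: (l2norm f) bias => F yF F0 y0 x0 xyF.
have : x ^+ 2 <= (y + nu * F) ^+ 2.
  by rewrite ler_sqr ?nnegrE// addr_ge0// mulr_ge0.
(* Bounds the cross term of (y + nu F)^2 by means of y <= F, the bias being at most |f|; the
   remainder is (2 nu + nu^2) F^2. *)
have : nu * (y * F) <= nu * (F * F) by rewrite ler_wpM2l// ler_wpM2r.
nra.
Qed.

End PerturbedEstimator.

(** * Measurability of matrix functions *)

Section MeasurableMatrices.
Context {R : realType}.

Lemma opnorm_le_sum m n (X : 'M[R]_(m, n)) : opnorm X <= \sum_i \sum_j `|X i j|.
Proof.
have S0 : 0 <= \sum_i \sum_j `|X i j|.
  by rewrite sumr_ge0 // => i _; rewrite sumr_ge0.
apply: (le_trans (opnorm_le_frob X)).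
rewrite -(ler_pXn2r (n := 2)) ?nnegrE ?frobnorm_ge0// sqr_frobnorm.
rewrite expr2 mulr_suml; apply: ler_sum => i _; rewrite mulr_suml.
apply: ler_sum => j _; rewrite -[X i j ^+ 2]real_normK ?num_real//.
rewrite expr2 ler_wpM2l// (bigD1 i)//= (bigD1 j)//= -addrA lerDl.
by rewrite addr_ge0// sumr_ge0// => k _; rewrite ?sumr_ge0.
Qed.

(** The dimension count of [weyl], applied to the matrices themselves instead of their Gram
    matrices. *)
Lemma sigma_lipschitz m n (X Y : 'M[R]_(m, n)) i :
  sigma X i.+1 <= sigma Y i.+1 + opnorm (X - Y).
Proof.
have [U [V sX]] := exists_singvals X; have [U' [V' sY]] := exists_singvals Y.
rewrite (sigmaE _ sX) (sigmaE _ sY); set s := singvals X in sX *.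
have [ip|pi] := ltnP i (minn m n); last first.
  by rewrite sval_nth0// addr_ge0 ?opnorm_ge0 ?(sval_ge0 sY).
have [c cn Uc] := exists_kernel_vector
  ((first_cols i U')^T *m first_cols i.+1 U) (ltnSn i).
have cp : 0 < l2norm c by rewrite lt_def l2norm_eq0 cn l2norm_ge0.
rewrite -(ler_pM2r cp) (le_trans (svd_top sX c ip))//.
have cE := l2norm_isom c (first_cols_isom sX ip); set v := _ *m c in cE Uc *.
have bot := svd_bottom sY (etrans (mulmxA _ _ _) Uc).
rewrite -(subrK Y X) addrC linearD/= mulmxDl mulrDl.
apply: le_trans (l2normD _ _) _; rewrite -cE lerD//.
by rewrite -(opnorm_trmx (Y + (X - Y) - Y)) addrAC subrr add0r opnorm_bound.
Qed.

Section Entrywise.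
Context d (T : measurableType d).

Definition measurable_mx m n (g : T -> 'M[R]_(m, n)) : Prop :=
  forall i j, measurable_fun setT (fun t => g t i j).

Lemma measurable_mx_cst m n (A : 'M[R]_(m, n)) : measurable_mx (fun=> A).
Proof. by move=> i j; exact: measurable_cst. Qed.

Lemma measurable_mx_tr m n (g : T -> 'M[R]_(m, n)) :
  measurable_mx g -> measurable_mx (fun t => (g t)^T).
Proof.
move=> mg i j; rewrite (_ : (fun t => _) = fun t => g t j i)//.
by apply/funext => t; rewrite mxE.
Qed.

Lemma measurable_mx_mul m n p (g : T -> 'M[R]_(m, n)) (h : T -> 'M[R]_(n, p)) :
  measurable_mx g -> measurable_mx h -> measurable_mx (fun t => g t *m h t).
Proof.
move=> mg mh i j.
rewrite (_ : (fun t => _) = fun t => \sum_k g t i k * h t k j).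
  by apply: measurable_sum => k; exact: measurable_funM.
by apply/funext => t; rewrite mxE.
Qed.

Lemma measurable_mxB m n (g h : T -> 'M[R]_(m, n)) :
  measurable_mx g -> measurable_mx h -> measurable_mx (fun t => g t - h t).
Proof.
move=> mg mh i j; rewrite (_ : (fun t => _) = fun t => g t i j - h t i j).
  exact: measurable_funB.
by apply/funext => t; rewrite !mxE.
Qed.

(** A Lipschitz F is the supremum of F(Q) - dist(., Q) over rational matrices Q, so that {F > c} is
    a countable union of sets given by inequalities between measurable functions of the entries. *)
Lemma measurable_lipschitz m n (g : T -> 'M[R]_(m, n)) (F : 'M[R]_(m, n) -> R) :
  measurable_mx g -> (forall X Y, F X <= F Y + opnorm (X - Y)) ->
  measurable_fun setT (F \o g).
Proof.
move=> mg lipF.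
pose dist (X Y : 'M[R]_(m, n)) := \sum_i \sum_j `|X i j - Y i j|.
have lipD X Y : F X <= F Y + dist X Y.
  apply: le_trans (lipF X Y) _; rewrite lerD2l (le_trans (opnorm_le_sum _))//.
  by apply: ler_sum => i _; apply: ler_sum => j _; rewrite !mxE.
have distC X Y : dist X Y = dist Y X.
  by apply: eq_bigr => i _; apply: eq_bigr => j _; rewrite distrC.
pose Qr (Q : 'M[rat]_(m, n)) : 'M[R]_(m, n) := map_mx ratr Q.
have dense X e : 0 < e -> exists Q, dist X (Qr Q) < e.
  move=> e0; pose N := (m * n).+1%:R : R.
  have N0 : 0 < N by rewrite ltr0n.
  have /choice[q hq] (ij : 'I_m * 'I_n) :
      exists q : rat, `|X ij.1 ij.2 - ratr q| < e / N.
    have h : X ij.1 ij.2 - e / N < X ij.1 ij.2 + e / N.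
      by rewrite ltrBlDr -addrA ltrDl addr_gt0// divr_gt0.
    have [q] := rat_in_itvoo h; rewrite in_itv/= => /andP[h1 h2].
    by exists q; rewrite distrC ltr_distl h1 h2.
  exists (\matrix_(i, j) q (i, j)).
  apply: (@le_lt_trans _ _ (\sum_(i < m) \sum_(j < n) e / N)).
    apply: ler_sum => i _; apply: ler_sum => j _; rewrite !mxE;
      exact: ltW (hq (i, j)).
  rewrite !sumr_const !card_ord -mulrnA -mulr_natl mulrCA gtr_pMr//.
  by rewrite ltr_pdivrMr// mul1r ltr_nat ltnS mulnC.
have lt_measurable (f1 f2 : T -> R) : measurable_fun setT f1 ->
    measurable_fun setT f2 -> measurable [set t | f1 t < f2 t].
  move=> mf1 mf2; have := measurable_fun_ltr mf1 mf2 measurableT (Y := [set true]).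
  by rewrite setTI; apply.
move=> mD; apply: (measurability _ (RGenOInfty.measurableE R)) => //.
move=> _ [_ [c ->] <-].
rewrite setTI (_ : _ @^-1` _ = \bigcup_(Q in [set: 'M[rat]_(m, n)])
  [set t | c + dist (g t) (Qr Q) < F (Qr Q)]).
  apply: countable_bigcupT_measurable => [|Q]; first exact: countableP.
  apply: lt_measurable => //.
  apply: measurable_funD => //; apply: measurable_sum => i.
  apply: measurable_sum => j; apply: measurableT_comp => //.
  exact: measurable_funB.
apply/seteqP; split=> [t|t [Q _]] /=; rewrite in_itv/= andbT.
  move=> cF; have e0 : 0 < (F (g t) - c) / 2 by rewrite divr_gt0// subr_gt0.
  have [Q hQ] := dense (g t) _ e0; exists Q => //=.
  have := lipD (g t) (Qr Q); lra.
have := lipD (Qr Q) (g t); rewrite distC; lra.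
Qed.

Lemma measurable_opnorm m n (g : T -> 'M[R]_(m, n)) :
  measurable_mx g -> measurable_fun setT (fun t => opnorm (g t)).
Proof.
move=> mg; apply: (measurable_lipschitz mg) => X Y.
by rewrite -{1}(subrK Y X) addrC opnormD.
Qed.

Lemma measurable_sigma m n (g : T -> 'M[R]_(m, n)) i :
  measurable_mx g -> measurable_fun setT (fun t => sigma (g t) i.+1).
Proof.
move=> mg; apply: (measurable_lipschitz (F := fun X => sigma X i.+1) mg) => X Y.
exact: sigma_lipschitz.
Qed.

End Entrywise.

Section Columns.
Variable n : nat.

(* The junk value 0 is taken on matrices with a number of rows other than r. *)
Definition mx_at r (S : mxcols R n) : 'M[R]_(r, n) :=
  if projT1 S =P r is ReflectT e then castmx (e, erefl) (mx_of S) else 0.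

Lemma mx_atE r (M : 'M[R]_(r, n)) : mx_at r (existT _ r M) = M.
Proof.
by rewrite /mx_at /=; case: eqP => // e; rewrite (eq_axiomK e) castmx_id.
Qed.

Definition fiber r : set (rmx R n) := [set S | projT1 (S : mxcols R n) = r].

Lemma measurable_mxbox r (B : 'I_r -> 'I_n -> set (measurableTypeR R)) :
  (forall i j, measurable (B i j)) -> measurable (mxbox B : set (rmx R n)).
Proof. by move=> mB; apply: sub_sigma_algebra; exists r, B. Qed.

Lemma measurable_fiber r : measurable (fiber r).
Proof.
rewrite (_ : fiber r = @mxbox R n r (fun _ _ => setT)).
  exact: measurable_mxbox.
apply/seteqP; split=> [[r' M] /= rr'|_ [M _ <-]//].
by rewrite /fiber/= in rr'; case: r / rr'; exists M.
Qed.

Lemma measurable_mx_at r : measurable_mx (mx_at r : rmx R n -> _).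
Proof.
move=> i j _ B mB; rewrite setTI.
rewrite (_ : _ @^-1` B = mxbox (fun i' j' =>
    if (i' == i) && (j' == j) then B else setT) `|`
    (~` fiber r `&` [set _ | B 0])).
  apply: measurableU; first by apply: measurable_mxbox => i' j'; case: ifP.
  apply: measurableI; first by apply: measurableC; exact: measurable_fiber.
  have [B0|B0] := pselect (B 0).
    by have -> : [set _ : rmx R n | B 0] = setT by apply/seteqP; split.
  by have -> : [set _ : rmx R n | B 0] = set0 by apply/seteqP; split.
apply/seteqP; split=> [[r' M] /=|S [[M hM <-]|]].
- have [rr'|rr'] := eqVneq r' r.
    move: M; rewrite rr' => M; rewrite mx_atE => BM; left; exists M => // i' j'.
    by case: ifP => // /andP[/eqP -> /eqP ->].
  rewrite /mx_at /=; case: eqP rr' => // rr' _; rewrite mxE => B0; right.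
  by split.
- by rewrite /= mx_atE; have := hM i j; rewrite !eqxx.
case: S => r' M [] /= rr' B0; rewrite /mx_at /=; case: eqP => // _.
by rewrite mxE.
Qed.

Lemma mx_atK r (S : mxcols R n) : projT1 S = r -> S = existT _ r (mx_at r S).
Proof. by case: S => r' M /= rr'; move: M; rewrite rr' => M; rewrite mx_atE. Qed.

End Columns.

(** Glued from the countably many fibers; on the fiber of r the matrix is [mx_at r], whose entries
    are measurable. *)
Lemma measurable_gram_deviation m n (X : 'M[R]_(m, n)) :
  measurable_fun setT (fun S : rmx R m =>
    opnorm (X^T *m (mx_of S)^T *m mx_of S *m X - X^T *m X)).
Proof.
move=> _ B mB; rewrite setTI.
pose F r (M : 'M[R]_(r, m)) := opnorm (X^T *m M^T *m M *m X - X^T *m X).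
rewrite (_ : _ @^-1` B = \bigcup_r (fiber r `&` ((@F r \o mx_at r) @^-1` B))).
  apply: bigcupT_measurable => r; apply: measurableI; first exact: measurable_fiber.
  rewrite -[X in measurable X]setTI.
  have mF : measurable_fun setT (@F r \o (mx_at r : rmx R m -> _)).
    apply: measurable_opnorm; apply: measurable_mxB; last exact: measurable_mx_cst.
    have mS := @measurable_mx_at m r.
    apply: measurable_mx_mul; last exact: measurable_mx_cst.
    apply: measurable_mx_mul; last exact: mS.
    apply: measurable_mx_mul; first exact: measurable_mx_cst.
    exact: measurable_mx_tr.
  exact: mF.
apply/seteqP; split=> [[r M] /= BM|S [r _ [/= rS]]].
  by exists r => //; split => //=; rewrite mx_atE.
by rewrite (mx_atK rS) mx_atE.
Qed.

Lemma measurable_gram_event m n (X : 'M[R]_(m, n)) K :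
  measurable ([set S | K <=
    opnorm (X^T *m (mx_of S)^T *m mx_of S *m X - X^T *m X)] : set (rmx R m)).
Proof.
have := measurable_fun_ler (measurable_cst K) (measurable_gram_deviation X)
  measurableT (Y := [set true]).
by rewrite setTI; apply.
Qed.

End MeasurableMatrices.

(** The sine of the angle with tangent nu/2; [eps_left] is tau / (1 + tau) times the gap. *)
Definition tau_of {R : realType} (nu : R) : R := nu * (Num.sqrt (1 + nu ^+ 2 / 4))^-1 / 2.

Lemma tau_ofE {R : realType} (nu : R) : 0 < nu < 1 ->
  0 < tau_of nu < 1 /\ (nu / 2) ^+ 2 * (1 - tau_of nu ^+ 2) = tau_of nu ^+ 2.
Proof.
move=> /andP[nu0 nu1]; have q0 : 0 < 1 + nu ^+ 2 / 4 by nra.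
have tauE : tau_of nu ^+ 2 = (nu / 2) ^+ 2 / (1 + nu ^+ 2 / 4).
  rewrite /tau_of !exprMn exprVn sqr_sqrtr ?(ltW q0)//.
  by field; rewrite gt_eqF//; nra.
have sq1 : 1 <= Num.sqrt (1 + nu ^+ 2 / 4).
  by rewrite -{1}sqrtr1 ler_sqrt//; nra.
split; last by rewrite tauE; field; nra.
rewrite /tau_of; apply/andP; split.
  by rewrite !divr_gt0 ?(lt_le_trans ltr01 sq1).
have : (Num.sqrt (1 + nu ^+ 2 / 4))^-1 <= 1 by rewrite invf_le1 ?(lt_le_trans ltr01).
have : 0 < (Num.sqrt (1 + nu ^+ 2 / 4))^-1 by rewrite invr_gt0 (lt_le_trans ltr01).
nra.
Qed.

(** * The good event for the pair of sketches *)

Section TwoSidedEvent.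
Context {R : realType}.
Variables (n d k : nat) (A : 'M[R]_(n, d)).

Local Notation sk X := (sigma X k.+1 ^+ 2 - sigma X k.+2 ^+ 2).

Definition left_event (e : R) : set (rmx R d) :=
  [set G | opnorm (A *m (mx_of G)^T *m mx_of G *m A^T - A *m A^T) < e].

(** The normalization sigma_1(X)^2 of the gap cancels against |X|^2 in the Gram matrix property
    ([eps_left_opnorm]), which leaves a threshold free of quotients. As it depends on G, the event
    is one of pairs. *)
Definition right_event (c : R) : set (rmx R d * rmx R n) :=
  [set GS | let X := A *m (mx_of GS.1)^T in
     opnorm (X^T *m (mx_of GS.2)^T *m mx_of GS.2 *m X - X^T *m X) < c * sk X].

Lemma measurable_left_event e : measurable (left_event e).
Proof.
have := measurable_fun_ltr (measurable_gram_deviation A^T) (measurable_cst e)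
  measurableT (Y := [set true]).
by rewrite setTI trmxK; apply.
Qed.

Lemma measurable_right_event c : measurable (right_event c).
Proof.
pose F r q (G : 'M[R]_(r, d)) (S : 'M[R]_(q, n)) :=
  let X := A *m G^T in opnorm (X^T *m S^T *m S *m X - X^T *m X).
pose H r (G : 'M[R]_(r, d)) := c * sk (A *m G^T).
rewrite (_ : right_event c = \bigcup_r \bigcup_q
  ((fiber r `*` fiber q) `&`
   [set GS | F r q (mx_at r GS.1) (mx_at q GS.2) < H r (mx_at r GS.1)])).
  apply: bigcupT_measurable => r; apply: bigcupT_measurable => q.
  apply: measurableI; first by apply: measurableX; exact: measurable_fiber.
  have mG : measurable_mx (fun GS : rmx R d * rmx R n => mx_at r GS.1).
    by move=> i j; apply: measurableT_comp (measurable_mx_at i j) measurable_fst.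
  have mS : measurable_mx (fun GS : rmx R d * rmx R n => mx_at q GS.2).
    by move=> i j; apply: measurableT_comp (measurable_mx_at i j) measurable_snd.
  have mX : measurable_mx (fun GS : rmx R d * rmx R n => A *m (mx_at r GS.1)^T).
    apply: measurable_mx_mul (measurable_mx_cst _) _; exact: measurable_mx_tr.
  have mF : measurable_fun setT (fun GS : rmx R d * rmx R n =>
      F r q (mx_at r GS.1) (mx_at q GS.2)).
    apply: measurable_opnorm; apply: measurable_mxB.
      apply: measurable_mx_mul => //; apply: measurable_mx_mul => //.
      by apply: measurable_mx_mul; exact: measurable_mx_tr.
    by apply: measurable_mx_mul => //; exact: measurable_mx_tr.
  have mH : measurable_fun setT (fun GS : rmx R d * rmx R n =>
      H r (mx_at r GS.1)).
    apply: measurable_funM => //; apply: measurable_funB;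
      by apply: measurable_funX; exact: measurable_sigma.
  have := measurable_fun_ltr mF mH measurableT (Y := [set true]).
  by rewrite setTI; apply.
apply/seteqP; split=> [[[r G] [q S]] /= h|[G S] [r _ [q _ [[/= Gr Sq]]]]].
  by exists r => //; exists q => //; split=> //=; rewrite !mx_atE.
by rewrite /= (mx_atK Gr) (mx_atK Sq) !mx_atE.
Qed.

Lemma eps_right_opnorm nu : 0 < nu -> 0 < opnorm A ->
  eps_right nu (gap A k.+1) * opnorm A^T ^+ 2
  = nu / 2 / (1 + nu / 2) * sk A.
Proof.
move=> nu0 A0; rewrite /eps_right /gap sigma1 opnorm_trmx.
field; rewrite (gt_eqF A0)/=; apply/andP; split; lra.
Qed.

Lemma eps_left_opnorm m (X : 'M[R]_(n, m)) nu : 0 < opnorm X ->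
  eps_left nu (gap X k.+1) * opnorm X ^+ 2
  = tau_of nu / (1 + tau_of nu) * sk X.
Proof.
move=> X0; rewrite /eps_left -/(tau_of nu) /gap sigma1 -mulrA; congr (_ * _).
by rewrite divfK// expf_neq0// gt_eqF.
Qed.

(** Weyl at both ends costs less than twice half of the gap of A. The gap of X is thus positive, as
    is needed to invoke the assumption on S given G. *)
Lemma left_event_gap nu G : 0 < nu < 1 -> 0 < sk A ->
  left_event (nu / 2 / (1 + nu / 2) * sk A) G ->
  0 < sk (A *m (mx_of G)^T).
Proof.
move=> /andP[nu0 nu1] A0; rewrite /left_event /=; set X := A *m _.
rewrite -[A *m (mx_of G)^T *m _ *m _]mulmxA.
have -> : mx_of G *m A^T = X^T by rewrite trmx_mul trmxK.
move=> h; have := sigma_weyl X A k.+1.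
have := sigma_weyl A X k; rewrite -[opnorm (_ - X *m X^T)]opnormN opprB.
have : nu / 2 / (1 + nu / 2) <= 1 / 2.
  by rewrite ler_pdivrMr; lra.
nra.
Qed.

End TwoSidedEvent.

Section JointLaw.
Context {R : realType} (n d : nat).
Variables (DG : probability (rmx R d) R) (DS : R.-pker (rmx R d) ~> (rmx R n)).

(** The conditional bound q is only known on E1; it is integrated over E1, and the rest of the
    integral is nonnegative. *)
Lemma joint_law_ge (E1 : set (rmx R d)) (E2 : set (rmx R d * rmx R n)) (p q : R) :
  measurable E1 -> measurable E2 -> 0 <= q ->
  (p%:E <= DG E1)%E ->
  {ae DG, forall G, E1 G -> (q%:E <= DS G (xsection E2 G))%E} ->
  ((p * q)%:E <= joint_law DG DS ((E1 `*` setT) `&` E2))%E.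
Proof.
move=> mE1 mE2 q0 pE1 qE2; rewrite /joint_law.
set E := _ `&` _; have mE : measurable E.
  by apply: measurableI => //; exact: measurableX.
have mK : measurable_fun setT (fun G => DS G (xsection E G)).
  by apply: measurable_fun_xsection_finite_kernel; rewrite inE.
apply: (@le_trans _ _ (\int[DG]_(G in E1) q%:E)%E).
  by rewrite integral_cst// muleC EFinM lee_wpmul2r// lee_fin.
apply: (@le_trans _ _ (\int[DG]_(G in E1) DS G (xsection E G))%E); last first.
  by apply: ge0_subset_integral.
apply: ae_ge0_le_integral => //.
- exact: measurable_funTS.
apply: filterS qE2 => G h E1G; apply: le_trans (h E1G) _.
apply: le_measure; rewrite ?inE; try exact: measurable_xsection.
by move=> S; rewrite !xsectionE /E /= => ?.
Qed.

End JointLaw.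

Lemma approx_gram_good {R : realType} m n (D : {measure set (rmx R m) -> \bar R})
    (X : 'M[R]_(m, n)) eps delta : D setT = 1%E -> approx_gram D X eps delta ->
  ((1 - delta)%:E <= D [set S | (opnorm (X^T *m (mx_of S)^T *m mx_of S *m X
     - X^T *m X) < eps * opnorm X ^+ 2)%R])%E.
Proof.
pose bad : set (rmx R m) := [set S | eps * opnorm X ^+ 2 <=
  opnorm (X^T *m (mx_of S)^T *m mx_of S *m X - X^T *m X)].
rewrite /approx_gram -/bad => DT h.
have mbad : measurable bad by exact: measurable_gram_event.
rewrite (_ : [set S | _] = ~` bad).
  rewrite EFinB leeBlDl// -DT -(setUv bad) measureU ?setICr//.
    by rewrite leeD2r.
  exact: measurableC.
by apply/seteqP; split=> S /=; rewrite /bad/= ltNge => /negP.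
Qed.

(** * CountSketch *)

Section CountSketchMoments.
Context {R : realType}.
Variables (n r : nat).
Hypothesis r0 : (0 < r)%N.

Local Notation eps z a := ((-1) ^+ (z : {ffun 'I_n -> bool}) a : R).

(** Flipping the sign number e is an involution that pairs opposite terms. *)
Lemma sum_sign_flip (F : {ffun 'I_n -> bool} -> R) (e : 'I_n) :
  (forall z z' : {ffun 'I_n -> bool}, z' e = ~~ z e ->
     (forall j, j != e -> z' j = z j) -> F z' = - F z) ->
  \sum_z F z = 0.
Proof.
move=> Fflip; pose flip (z : {ffun 'I_n -> bool}) :=
  [ffun j => if j == e then ~~ z j else z j].
have flipK : involutive flip.
  by move=> z; apply/ffunP => j; rewrite !ffunE; case: eqP => //; rewrite negbK.
have : \sum_z F z = - \sum_z F z.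
  rewrite {1}(reindex_inj (inv_inj flipK)) -sumrN; apply: eq_bigr => z _.
  by apply: Fflip => [|j je]; rewrite ffunE ?eqxx// (negbTE je).
lra.
Qed.

Lemma signN (b : bool) : (-1) ^+ (~~ b) = - (-1) ^+ b :> R.
Proof. by case: b; rewrite ?expr0 ?expr1 ?opprK. Qed.

(** A product of signs sums to 0 unless every index occurs an even number of times; as a != b and c
    != e, only the two pairings of {a, b} with {c, e} remain. *)
Lemma sum_sign4 (a b c e : 'I_n) : a != b -> c != e ->
  \sum_(z : {ffun 'I_n -> bool}) eps z a * eps z b * (eps z c * eps z e)
  = (2 ^ n)%:R * (((c == a) && (e == b))%:R + ((c == b) && (e == a))%:R).
Proof.
move=> ab ce.
have sq (z : {ffun 'I_n -> bool}) x : eps z x * eps z x = 1.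
  by rewrite -expr2 sqrr_sign.
have all1 (F : {ffun 'I_n -> bool} -> R) : (forall z, F z = 1) ->
    \sum_z F z = (2 ^ n)%:R.
  move=> F1; rewrite (eq_bigr (fun=> 1)) // sumr_const.
  by rewrite card_ffun card_bool card_ord.
have [ca|ca] := eqVneq c a.
  rewrite ca in ce *; rewrite (negbTE ab) addr0 /=.
  have [eb|eb] := eqVneq e b.
    rewrite mulr1; apply: all1 => z.
    by rewrite eb mulrACA !sq mulr1.
  rewrite mulr0; apply: (@sum_sign_flip _ b) => z z' zb zo.
  rewrite zb (zo a)// (zo e)// signN; ring.
have [cb|cb] /= := eqVneq c b.
  rewrite cb in ce *; rewrite add0r.
  have [ea|ea] := eqVneq e a.
    rewrite mulr1; apply: all1 => z; rewrite ea.
    by rewrite -mulrA [X in _ * X]mulrA sq mul1r sq.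
  rewrite mulr0; apply: (@sum_sign_flip _ a) => z z' za zo.
  rewrite za (zo b) 1?eq_sym// (zo e)// signN; ring.
rewrite addr0 mulr0; apply: (@sum_sign_flip _ c) => z z' zc zo.
rewrite zc (zo a) 1?eq_sym// (zo b) 1?eq_sym// (zo e) 1?eq_sym// signN; ring.
Qed.

Lemma sum_pick2 (G : 'I_n -> 'I_n -> R) (a b : 'I_n) : a != b ->
  \sum_c \sum_(e | c != e) G c e * ((c == a) && (e == b))%:R = G a b.
Proof.
move=> ab; rewrite (bigD1 a)//= (bigD1 b)//= !eqxx mulr1.
rewrite big1 ?addr0 => [|e /andP[_ eb]]; last by rewrite (negbTE eb) mulr0.
rewrite big1 ?addr0// => c ca; rewrite big1// => e _.
by rewrite (negbTE ca) mulr0.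
Qed.

Lemma rademacher_chaos (q : 'I_n -> 'I_n -> R) :
  \sum_(z : {ffun 'I_n -> bool})
     (\sum_a \sum_(b | a != b) q a b * (eps z a * eps z b)) ^+ 2
  <= (2 ^ n)%:R * (2 * \sum_a \sum_(b | a != b) q a b ^+ 2).
Proof.
have -> : \sum_(z : {ffun 'I_n -> bool})
     (\sum_a \sum_(b | a != b) q a b * (eps z a * eps z b)) ^+ 2
  = \sum_a \sum_(b | a != b) \sum_c \sum_(e | c != e) q a b * q c e *
    \sum_(z : {ffun 'I_n -> bool}) eps z a * eps z b * (eps z c * eps z e).
  under eq_bigr do rewrite expr2 mulr_suml.
  rewrite exchange_big; apply: eq_bigr => a _.
  under eq_bigr do rewrite mulr_suml.
  rewrite exchange_big; apply: eq_bigr => b ab.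
  under eq_bigr do rewrite mulr_sumr.
  rewrite exchange_big; apply: eq_bigr => c _.
  under eq_bigr do rewrite mulr_sumr.
  rewrite exchange_big; apply: eq_bigr => e ce.
  rewrite mulr_sumr; apply: eq_bigr => z _; ring.
have -> : \sum_a \sum_(b | a != b) \sum_c \sum_(e | c != e) q a b * q c e *
    (\sum_(z : {ffun 'I_n -> bool}) eps z a * eps z b * (eps z c * eps z e))
  = (2 ^ n)%:R * \sum_a \sum_(b | a != b) (q a b * q a b + q a b * q b a).
  rewrite mulr_sumr; apply: eq_bigr => a _; rewrite mulr_sumr.
  apply: eq_bigr => b ab.
  have ba : b != a by rewrite eq_sym.
  rewrite -(sum_pick2 q ab) -(sum_pick2 q ba) !mulr_sumr -big_split mulr_sumr.
  apply: eq_bigr => c _; rewrite !mulr_sumr -big_split mulr_sumr.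
  by apply: eq_bigr => e ce; rewrite sum_sign4//=; ring.
rewrite ler_wpM2l ?ler0n//.
have sym : \sum_a \sum_(b | a != b) q b a ^+ 2 = \sum_a \sum_(b | a != b) q a b ^+ 2.
  rewrite (exchange_big_dep xpredT)//=; apply: eq_bigr => a _; apply: eq_bigl => b.
  by rewrite eq_sym.
(* q_ab q_ba is at most half the sum of the two squares; exchanging a and b then brings the
   coefficient 3/2 + 1/2 = 2. *)
apply: (@le_trans _ _ (\sum_a \sum_(b | a != b)
   (3 / 2 * q a b ^+ 2 + 1 / 2 * q b a ^+ 2))).
  apply: ler_sum => a _; apply: ler_sum => b _.
  have := sqr_ge0 (q a b - q b a); nra.
under eq_bigr do rewrite big_split/= -!mulr_sumr.
by rewrite big_split/= -!mulr_sumr sym; lra.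
Qed.

(** Two indices collide with probability 1/r. The collision is a sum, over the common bucket i, of
    products over the coordinates of h, so the sum over h factorizes. *)
Lemma sum_collide (a b : 'I_n) : a != b ->
  \sum_(h : {ffun 'I_n -> 'I_r}) (h a == h b)%:R * r%:R = (r ^ n)%:R :> R.
Proof.
move=> ab; have ba : b != a by rewrite eq_sym.
pose F (i : 'I_r) (j : 'I_n) (x : 'I_r) : R :=
  if (j == a) || (j == b) then (x == i)%:R else 1.
have hE (h : {ffun 'I_n -> 'I_r}) :
    (h a == h b)%:R = \sum_i \prod_j F i j (h j) :> R.
  have pE i : \prod_j F i j (h j) = (h a == i)%:R * (h b == i)%:R.
    rewrite (bigD1 a)//= (bigD1 b)//= big1 => [|j /andP[ja jb]].
      by rewrite /F !eqxx orbT mulr1.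
    by rewrite /F (negbTE ja) (negbTE jb).
  under eq_bigr do rewrite pE.
  rewrite (bigD1 (h a))//= big1 => [|i ia]; last first.
    by rewrite eq_sym (negbTE ia) mul0r.
  by rewrite eqxx mul1r addr0 eq_sym.
under eq_bigr do rewrite hE.
rewrite -mulr_suml exchange_big/=.
under eq_bigr do rewrite -(bigA_distr_bigA (fun j x => F _ j x)).
have sE i : (\prod_j \sum_x F i j x) * r%:R ^+ 2 = (r ^ n)%:R :> R.
  rewrite natrX -[in RHS](card_ord n) -prodr_const.
  rewrite [RHS](bigD1 a)//= [X in _ * X = _]expr2 (bigD1 a)//=.
  rewrite [in RHS](bigD1 b)//= (bigD1 b)//=.
  have s1 j : (j == a) || (j == b) -> \sum_x F i j x = 1.
    move=> jab; rewrite (bigD1 i)//= big1 => [|x xi]; rewrite /F jab.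
      by rewrite eqxx addr0.
    by rewrite (negbTE xi).
  rewrite !s1 ?eqxx ?orbT// !mul1r mulrC -mulrA; congr (_ * (_ * _)).
  apply: eq_bigr => j /andP[ja jb]; rewrite /F (negbTE ja) (negbTE jb).
  by rewrite sumr_const card_ord.
have r0R : r%:R != 0 :> R by rewrite pnatr_eq0 -lt0n.
apply: (mulIf (expf_neq0 2 r0R)); rewrite mulrAC mulr_suml.
under eq_bigr do rewrite sE.
by rewrite sumr_const card_ord -mulr_natr; ring.
Qed.

(** The columns of a CountSketch matrix are unit vectors, so the diagonal of S^T S - 1 vanishes and
    only collisions of distinct indices remain. *)
Lemma countsketch_deviation m (X : 'M[R]_(n, m)) (h : {ffun 'I_n -> 'I_r})
    (z : {ffun 'I_n -> bool}) i j :
  (X^T *m (countsketch_mx h z)^T *m countsketch_mx h z *m X - X^T *m X) i j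
  = \sum_a \sum_(b | a != b) X a i * X b j * (h a == h b)%:R *
      (eps z a * eps z b).
Proof.
have SS a b : ((countsketch_mx h z)^T *m countsketch_mx h z : 'M[R]_n) a b
    = (h a == h b)%:R * (eps z a * eps z b).
  rewrite mxE (bigD1 (h a))//= big1 => [|l la].
    rewrite !mxE eqxx addr0; case: eqP => _; first by rewrite mul1r.
    by rewrite mulr0 mul0r.
  by rewrite !mxE (negbTE la) mul0r.
rewrite -(mulmxA X^T) mxE [X in _ + X]mxE -mulmxA mxE.
rewrite [X in _ - X]mxE -sumrB; apply: eq_bigr => a _.
rewrite [in LHS]mxE mxE mulr_sumr (bigD1 a)//= SS eqxx.
rewrite -expr2 sqrr_sign mul1r mul1r addrAC subrr add0r.
rewrite (eq_bigl (fun b => a != b)) => [|b]; last by rewrite eq_sym.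
by apply: eq_bigr => b _; rewrite SS; ring.
Qed.

Lemma countsketch_second_moment m (X : 'M[R]_(n, m)) :
  \sum_(h : {ffun 'I_n -> 'I_r}) \sum_(z : {ffun 'I_n -> bool})
    frobnorm (X^T *m (countsketch_mx h z)^T *m countsketch_mx h z *m X
      - X^T *m X) ^+ 2 * r%:R
  <= (r ^ n * 2 ^ n)%:R * (2 * frobnorm X ^+ 4).
Proof.
have bound_z (h : {ffun 'I_n -> 'I_r}) : \sum_(z : {ffun 'I_n -> bool})
    frobnorm (X^T *m (countsketch_mx h z)^T *m countsketch_mx h z *m X
      - X^T *m X) ^+ 2 <=
    \sum_i \sum_j (2 ^ n)%:R * (2 * \sum_a \sum_(b | a != b)
       (X a i ^+ 2 * X b j ^+ 2) * (h a == h b)%:R).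
  under eq_bigr do rewrite sqr_frobnorm.
  rewrite exchange_big; apply: ler_sum => i _.
  rewrite exchange_big; apply: ler_sum => j _.
  under eq_bigr do rewrite countsketch_deviation.
  apply: le_trans (rademacher_chaos (fun a b => X a i * X b j * (h a == h b)%:R)) _.
  rewrite ler_wpM2l ?ler0n// ler_wpM2l//; apply: ler_sum => a _.
  apply: ler_sum => b _; rewrite !exprMn.
  by case: eqP => _; rewrite ?expr1n ?expr0n.
under eq_bigr do rewrite -mulr_suml.
apply: (@le_trans _ _ (\sum_(h : {ffun 'I_n -> 'I_r})
  \sum_i \sum_j (2 ^ n)%:R * (2 * \sum_a \sum_(b | a != b)
       (X a i ^+ 2 * X b j ^+ 2) * (h a == h b)%:R) * r%:R)).
  apply: ler_sum => h _; apply: le_trans (ler_wpM2r (ler0n _ _) (bound_z h)) _.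
  by rewrite mulr_suml; apply: ler_sum => i _; rewrite mulr_suml.
rewrite exchange_big/=.
under eq_bigr => i _ do rewrite exchange_big/=.
have inner i j : \sum_(h : {ffun 'I_n -> 'I_r}) (2 ^ n)%:R * (2 * \sum_a
    \sum_(b | a != b) (X a i ^+ 2 * X b j ^+ 2) * (h a == h b)%:R) * r%:R
  = (r ^ n * 2 ^ n)%:R * 2 *
      \sum_a \sum_(b | a != b) (X a i ^+ 2 * X b j ^+ 2).
  transitivity ((2 ^ n)%:R * (2 * \sum_a \sum_(b | a != b)
      (X a i ^+ 2 * X b j ^+ 2) * (r ^ n)%:R)); last first.
    have -> : \sum_a \sum_(b | a != b) (X a i ^+ 2 * X b j ^+ 2) * (r ^ n)%:R
        = (\sum_a \sum_(b | a != b) (X a i ^+ 2 * X b j ^+ 2)) * (r ^ n)%:R.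
      by rewrite mulr_suml; apply: eq_bigr => a _; rewrite mulr_suml.
    by rewrite natrM; ring.
  under eq_bigr do rewrite -2!mulrA.
  rewrite -!mulr_sumr; congr (_ * (_ * _)).
  under eq_bigr do rewrite mulr_suml.
  rewrite exchange_big; apply: eq_bigr => a _.
  under eq_bigr do rewrite mulr_suml.
  rewrite exchange_big; apply: eq_bigr => b ab.
  under eq_bigr do rewrite -mulrA.
  by rewrite -mulr_sumr sum_collide.
under eq_bigr do under eq_bigr do rewrite inner.
(* The bound is completed by the nonnegative diagonal terms a = b, which makes the sum factorize. *)
have -> : frobnorm X ^+ 4 = \sum_i \sum_j \sum_a \sum_b X a i ^+ 2 * X b j ^+ 2.
  rewrite (exprM _ 2 2) sqr_frobnorm exchange_big expr2 mulr_suml.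
  apply: eq_bigr => i _; rewrite mulr_sumr; apply: eq_bigr => j _.
  by rewrite mulr_suml; apply: eq_bigr => a _; rewrite mulr_sumr.
rewrite mulrA mulr_sumr; apply: ler_sum => i _.
rewrite mulr_sumr; apply: ler_sum => j _.
rewrite ler_wpM2l ?mulr_ge0 ?ler0n//; apply: ler_sum => a _.
rewrite [leRHS](bigID (fun b => a != b))/= lerDl sumr_ge0// => b _.
by rewrite mulr_ge0 ?sqr_ge0.
Qed.

End CountSketchMoments.

(** * From the second moment to the Gram matrix property *)

Section CountSketchLaw.
Context {R : realType}.
Variables (n r : nat) (D : probability (rmx R n) R).
Hypothesis csD : countsketch r D.

Let r0 : (0 < r)%N. Proof. by case: csD. Qed.

Local Notation idx := ({ffun 'I_n -> 'I_r} * {ffun 'I_n -> bool})%type.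

Let pt (i : idx) : rmx R n := existT _ r (countsketch_mx i.1 i.2).

Let weight : R := ((r ^ n * 2 ^ n)%:R)^-1.

Lemma measurable_mx_point (S : rmx R n) : measurable [set S].
Proof.
case: S => q M; rewrite (_ : [set _] = @mxbox R n q (fun i j => [set M i j])).
  apply: measurable_mxbox => i j; exact: measurable_set1.
apply/seteqP; split=> [_ ->|_ [M' h <-]] /=; first by exists M.
by congr (existT _ q _); apply/matrixP => i j; exact: h.
Qed.

(** The only nonzero entry of column j reveals h j and z j. Distinct indices therefore give distinct
    atoms, whose masses add up. *)
Lemma countsketch_mx_inj : injective pt.
Proof.
move=> [h z] [h' z'] /= /eqP; rewrite eq_Tagged /= => /eqP e.
have E i j := congr1 (fun M : 'M[R]_(r, n) => M i j) e.
have hh : h = h'.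
  apply/ffunP => j; have := E (h j) j; rewrite !mxE eqxx.
  by case: eqP => // _ /eqP; rewrite signr_eq0.
congr (_, _) => //; apply/ffunP => j; have := E (h j) j.
rewrite !mxE -hh eqxx; case: (z j) (z' j) => -[] //; rewrite ?expr0 ?expr1; lra.
Qed.

Lemma countsketch_weight i : D [set pt i] = weight%:E.
Proof.
case: csD => _ /(_ i.1 i.2) ->; congr EFin.
rewrite prodr_const card_ord /weight natrM !natrX invfM exprMn.
by rewrite !exprVn.
Qed.

Lemma measure_points (s : seq (rmx R n)) : uniq s ->
  measurable [set` s] /\ D [set` s] = (\sum_(S <- s) D [set S])%E.
Proof.
elim: s => [_|S s ih /= /andP[Ss us]].
  by rewrite set_nil big_nil measure0.
have [ms Ds] := ih us.
have -> : [set` S :: s] = [set S] `|` [set` s].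
  apply/seteqP; split=> x /=; rewrite inE; first by case/orP => [/eqP|]; [left|right].
  by case=> [->|->]; rewrite ?eqxx ?orbT.
split; first by apply: measurableU => //; exact: measurable_mx_point.
rewrite big_cons -Ds; apply: measureU => //; first exact: measurable_mx_point.
by apply/seteqP; split=> // x [/= -> xs]; rewrite xs in Ss.
Qed.

(** D is known through its atoms only, while B may contain other points. The atoms of good index lie
    outside B, and their mass is 1 minus that of the bad ones. *)
Lemma countsketch_tail (bad : pred idx) (B : set (rmx R n)) : measurable B ->
  (forall i, B (pt i) -> bad i) ->
  (D B <= (\sum_(i | bad i) weight)%:E)%E.
Proof.
move=> mB hB; pose s := [seq pt i | i <- enum (predC bad)].
have us : uniq s.
  by rewrite map_inj_uniq ?enum_uniq//; exact: countsketch_mx_inj.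
have [ms Ds] := measure_points us.
have sB : [set` s] `<=` ~` B.
  by move=> S /= /mapP[i]; rewrite mem_enum inE => nbad -> /hB; rewrite (negbTE nbad).
have DsE : D [set` s] = (\sum_(i | ~~ bad i) weight)%:E.
  rewrite Ds big_map big_enum_cond/= -sumEFin; apply: eq_big => [i|i _].
    by rewrite inE andbT.
  exact: countsketch_weight.
have tot : \sum_(i | bad i) weight + \sum_(i | ~~ bad i) weight = 1.
  transitivity (\sum_(i : idx) weight); first by rewrite [RHS](bigID bad).
  rewrite sumr_const card_prod !card_ffun !card_ord card_bool.
  by rewrite -mulr_natr /weight mulVf// pnatr_eq0 -lt0n muln_gt0 !expn_gt0 r0.
have : (D [set` s] <= 1 - D B)%E.
  rewrite -probability_setC//; apply: le_measure; rewrite ?inE//.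
  exact: measurableC.
rewrite DsE -tot EFinD => h.
have DBfin : D B \is a fin_num by rewrite fin_num_measure.
rewrite -(fineK DBfin) -EFinD -EFinB !lee_fin in h *; lra.
Qed.

(** Markov's inequality for the squared Frobenius norm of the deviation, which dominates its
    operator norm. *)
Lemma countsketch_gram m (X : 'M[R]_(n, m)) e delta : 0 < e -> 0 < opnorm X ->
  2 * stable_rank X ^+ 2 <= r%:R * (e ^+ 2 * delta) ->
  approx_gram D X e delta.
Proof.
move=> e0 X0 hr.
pose dev (i : idx) := X^T *m (countsketch_mx i.1 i.2)^T *m countsketch_mx i.1 i.2
  *m X - X^T *m X.
pose bad : pred idx := fun i => e * opnorm X ^+ 2 <= opnorm (dev i).
pose B : set (rmx R n) := [set S | e * opnorm X ^+ 2 <=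
  opnorm (X^T *m (mx_of S)^T *m mx_of S *m X - X^T *m X)].
have mB : measurable B by exact: measurable_gram_event.
apply: le_trans (countsketch_tail (bad := bad) mB _) _; first by move=> i.
rewrite lee_fin.
set K := e * opnorm X ^+ 2 in bad *.
have K0 : 0 < K by rewrite mulr_gt0// exprn_gt0.
have r0R : 0 < r%:R :> R by rewrite ltr0n.
have w0 : 0 < weight by rewrite invr_gt0 ltr0n muln_gt0 !expn_gt0 r0.
have moment := countsketch_second_moment r0 X.
have markov : (\sum_(i | bad i) weight) * (K ^+ 2 * r%:R) <= 2 * frobnorm X ^+ 4.
  apply: (@le_trans _ _ (weight * \sum_i (frobnorm (dev i) ^+ 2 * r%:R))).
    rewrite mulr_suml mulr_sumr [leRHS](bigID bad)/=.
    apply: ler_wpDr; last apply: ler_sum => i badi.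
      apply: sumr_ge0 => i _; rewrite mulr_ge0 ?(ltW w0)//.
      by rewrite mulr_ge0 ?sqr_ge0 ?(ltW r0R).
    rewrite ler_wpM2l ?(ltW w0)// ler_wpM2r ?(ltW r0R)//.
    rewrite ler_sqr ?nnegrE ?(ltW K0) ?frobnorm_ge0//.
    exact: le_trans badi (opnorm_le_frob _).
  rewrite /weight mulrC ler_pdivrMr ?ltr0n ?muln_gt0 ?expn_gt0 ?r0// mulrC.
  by apply: le_trans moment; rewrite pair_bigA.
have KE : K ^+ 2 = e ^+ 2 * opnorm X ^+ 4.
  by rewrite /K exprMn -exprM.
have srE : stable_rank X ^+ 2 = frobnorm X ^+ 4 / opnorm X ^+ 4.
  by rewrite /stable_rank exprMn exprVn -!exprM.
have o4 : 0 < opnorm X ^+ 4 by rewrite exprn_gt0.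
rewrite srE mulrA ler_pdivrMr// in hr.
have : (\sum_(i | bad i) weight) * (K ^+ 2 * r%:R) <= delta * (K ^+ 2 * r%:R).
  by apply: le_trans markov _; apply: le_trans hr _; rewrite KE; lra.
by rewrite ler_pM2r// mulr_gt0// exprn_gt0.
Qed.

End CountSketchLaw.

(** t^2 = (nu/2)^2 (1 - t^2) with nu < 1 gives 2 t^2 >= (nu/2)^2, hence t >= nu/4; and 1 + t <=
    2. *)
Lemma eps_left_ge (R : realType) (nu g : R) : 0 < nu < 1 / 2 -> 0 <= g ->
  nu * g / 8 <= eps_left nu g.
Proof.
move=> /andP[nu0 nu1] g0; rewrite /eps_left -/(tau_of nu).
have nu01 : 0 < nu < 1 by rewrite nu0/=; lra.
have [/andP[t0 t1] tE] := tau_ofE nu01; set t := tau_of nu in t0 t1 tE *.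
have tge : nu / 4 <= t.
  have h : (nu / 2) ^+ 2 * t ^+ 2 <= t ^+ 2 by rewrite ler_piMl ?sqr_ge0//; nra.
  rewrite -ler_sqr ?nnegrE ?(ltW t0)//; last lra.
  have : 0 <= t ^+ 2 by exact: sqr_ge0.
  lra.
have : nu / 8 <= t / (1 + t) by rewrite ler_pdivlMr; nra.
nra.
Qed.

(** 256 = 2 * 2 * 8^2: the factor 2 of the second moment, the failure probability delta/2, and the
    accuracy, at least nu g / 8, squared. *)
Lemma countsketch_sketch (R : realType) (n k : nat) (delta nu : R)
    m (X : 'M[R]_(n, m)) (r : nat) (D : probability (rmx R n) R) :
  0 < nu < 1 / 2 -> 0 < delta -> 0 < gap X k.+1 ->
  256 * (stable_rank X ^+ 2 / (gap X k.+1 ^+ 2 * nu ^+ 2 * delta)) <= r%:R ->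
  countsketch r D -> approx_gram D X (eps_left nu (gap X k.+1)) (delta / 2).
Proof.
move=> nu01 d0 g0 hr csD; have /andP[nu0 _] := nu01.
have ege := eps_left_ge nu01 (ltW g0); set g := gap X k.+1 in g0 hr ege *.
set e := eps_left nu g in ege *.
have e1 : 0 < nu * g / 8 by rewrite divr_gt0// mulr_gt0.
have e0 : 0 < e := lt_le_trans e1 ege.
have X0 : 0 < opnorm X.
  rewrite lt_def opnorm_ge0 andbT; apply: contraTneq g0 => X0.
  by rewrite /g /gap sigma1 X0 expr0n invr0 mulr0 ltxx.
apply: (countsketch_gram csD e0 X0).
have den : 0 < g ^+ 2 * nu ^+ 2 * delta by apply: mulr_gt0 => //; apply: mulr_gt0; exact: exprn_gt0.
rewrite mulrA ler_pdivrMr// in hr.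
have : (nu * g / 8) ^+ 2 <= e ^+ 2 by rewrite ler_sqr ?nnegrE// ltW.
have : 0 <= r%:R * delta by rewrite mulr_ge0// ltW.
move: (r%:R) hr => rr hr rd he.
have : rr * delta * (nu * g / 8) ^+ 2 <= rr * delta * e ^+ 2.
  by rewrite ler_wpM2l.
lra.
Qed.

(** * Subgaussian moments *)

Section SubgaussianMoments.
Context {R : realType}.

(** The linear term is kept apart because a centred variable integrates it to 0. *)
Lemma expR_le_quadratic (x : R) : expR x <= 1 + x + x ^+ 2 * expR `|x|.
Proof.
have key (y : R) : expR y <= 1 + y * expR y.
  have := expR_ge1Dx (- y); rewrite expRN -(ler_pM2r (expR_gt0 y)) mulVf ?gt_eqF ?expR_gt0//.
  lra.
have [x0|x0] := leP 0 x.
  rewrite ger0_norm//; have := key x.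
  have : x * (expR x - 1) <= x * (x * expR x).
    by rewrite ler_wpM2l//; have := key x; lra.
  lra.
rewrite ltr0_norm//; have := key x.
have : - x * (1 - expR x) <= - x * (- x).
  by rewrite ler_wpM2l ?oppr_ge0 ?(ltW x0)//; have := expR_ge1Dx x; lra.
have : 0 <= x ^+ 2 * (expR (- x) - 1).
  by rewrite mulr_ge0 ?sqr_ge0// subr_ge0 -expR0 ler_expR oppr_ge0 ltW.
lra.
Qed.

Lemma sqr_le_expR (x : R) : 0 <= x -> x ^+ 2 <= 4 * expR x.
Proof.
move=> x0; have := expR_ge1Dx (x / 2).
have -> : expR x = expR (x / 2) ^+ 2.
  by rewrite -expRM_natl; congr expR; rewrite mulrC divfK.
have : 0 <= x / 2 by rewrite divr_ge0.
nra.
Qed.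

Context d (T : measurableType d) (P : probability T R).

Lemma has_mean_dominated (f g : T -> R) b : measurable_fun setT f ->
  (forall x, 0 <= f x) -> (forall x, f x <= g x) -> has_mean P g b ->
  exists a, has_mean P f a /\ 0 <= a <= b.
Proof.
move=> mf f0 fg gb; have [|a fa] := has_mean_le mf _ gb.
  by move=> x; rewrite ger0_norm.
exists a; split => //; have [fi fE] := fa; have [gi gE] := gb.
rewrite -!lee_fin -fE -gE integral_ge0/=; last by move=> x _; rewrite lee_fin.
by apply: le_integral => // x _; rewrite lee_fin.
Qed.

(** Two regimes in u = s c. For small u the quadratic bound on exp leaves 1 + (5/2) u^2 Q, with Q <=
    2. For |u| > 1/2 one has u y <= u^2/4 + y^2, and the factor Q <= 2 is absorbed by exp (4
    u^2). *)
Lemma subgaussian_mgf (W : T -> R) (c Q s : R) : 0 < c -> has_mean P W 0 ->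
  has_mean P (fun x => expR ((W x / c) ^+ 2)) Q -> Q <= 2 ->
  exists m, has_mean P (fun x => expR (s * W x)) m /\
    0 <= m <= expR (5 * c ^+ 2 * s ^+ 2).
Proof.
move=> c0 W0 hQ Q2; have mW := has_mean_measurable W0.
have mE : measurable_fun setT (fun x => expR (s * W x)).
  by apply: measurableT_comp => //; exact: measurable_funM.
pose u := s * c; pose y x := W x / c.
have sW x : s * W x = u * y x by rewrite /u /y; field; rewrite gt_eqF.
have -> : 5 * c ^+ 2 * s ^+ 2 = 5 * u ^+ 2 by rewrite /u; ring.
have [u12|u12] := leP `|u| (1 / 2).
  have ptw x : expR (s * W x)
      <= (1 + s * W x) + u ^+ 2 * (5 / 2) * expR ((W x / c) ^+ 2).
    rewrite sW -/(y x); apply: le_trans (expR_le_quadratic _) _; rewrite lerD2l.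
    rewrite (exprMn 2 u (y x)) -(mulrA (u ^+ 2) (y x ^+ 2)) -(mulrA (u ^+ 2) (5 / 2)).
    apply: ler_wpM2l; first exact: sqr_ge0.
    (* 5/2 is the product of this 2 and of 5/4 >= exp (1/8), the latter from |u y| <= 1/8 +
       y^2/2. *)
    have h1 : y x ^+ 2 <= 2 * expR (y x ^+ 2 / 2).
      have := expR_ge1Dx (y x ^+ 2 / 2); lra.
    have h2 : expR `|u * y x| <= expR (1 / 8) * expR (y x ^+ 2 / 2).
      rewrite -expRD ler_expR normrM.
      have : `|u| * `|y x| <= 1 / 2 * `|y x| by rewrite ler_wpM2r.
      have : 0 <= (`|y x| - 1 / 2) ^+ 2 by exact: sqr_ge0.
      rewrite -[y x ^+ 2]real_normK ?num_real//; nra.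
    have h3 : expR (1 / 8) <= 5 / 4 :> R.
      have := expR_ge1Dx (- (1 / 8) : R); rewrite expRN.
      have e0 : 0 < expR (1 / 8) :> R by exact: expR_gt0.
      rewrite -(ler_pM2r e0) mulVf ?gt_eqF//; lra.
    have e12 : expR (y x ^+ 2) = expR (y x ^+ 2 / 2) * expR (y x ^+ 2 / 2).
      by rewrite -expRD -splitr.
    rewrite e12; move: (expR_gt0 (y x ^+ 2 / 2)) h1 h2.
    move: (expR (y x ^+ 2 / 2)) => e e0 h1 h2.
    apply: (le_trans (ler_pM (sqr_ge0 _) (expR_ge0 _) h1 h2)).
    have : 0 <= e * e * (5 / 4 - expR (1 / 8)).
      by rewrite mulr_ge0 ?subr_ge0// mulr_ge0// ltW.
    lra.
  have hg := has_meanD (has_meanD (has_mean_cst P 1) (has_meanZ s W0))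
    (has_meanZ (u ^+ 2 * (5 / 2)) hQ).
  have [m [hm /andP[m0 mb]]] := has_mean_dominated mE (fun=> expR_ge0 _) ptw hg.
  exists m; split => //; rewrite m0/=; apply: le_trans mb _.
  apply: le_trans (expR_ge1Dx _); have : 0 <= u ^+ 2 * (2 - Q).
    by rewrite mulr_ge0 ?sqr_ge0// subr_ge0.
  lra.
have ptw x : expR (s * W x) <= expR (u ^+ 2 / 4) * expR ((W x / c) ^+ 2).
  rewrite sW -/(y x) -expRD ler_expR.
  have : 0 <= (u / 2 - y x) ^+ 2 by exact: sqr_ge0.
  lra.
have [m [hm /andP[m0 mb]]] :=
  has_mean_dominated mE (fun=> expR_ge0 _) ptw (has_meanZ _ hQ).
exists m; split => //; rewrite m0/=; apply: le_trans mb _.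
have e1 : 2 <= expR (4 * u ^+ 2).
  apply: le_trans (expR_ge1Dx _); rewrite -[u ^+ 2]real_normK ?num_real//.
  nra.
apply: (@le_trans _ _ (expR (u ^+ 2 / 4) * expR (4 * u ^+ 2))).
  by rewrite ler_wpM2l ?expR_ge0// (le_trans Q2).
by rewrite -expRD ler_expR; have := sqr_ge0 u; lra.
Qed.

(* [j y - j^2/(4 kappa)] is within [1/(4 kappa)] of its maximum [kappa y^2] at
   an integer [j] next to [2 kappa y]. *)
Lemma expR_sqr_le_linear (kappa y : R) : 0 < kappa -> exists j : nat,
  expR (kappa * y ^+ 2) <= expR (1 / (4 * kappa)) *
   (expR (- (j%:R ^+ 2 / (4 * kappa))) * (expR (j%:R * y) + expR (- j%:R * y))).
Proof.
move=> k0; exists (Num.truncn (2 * kappa * `|y|)).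
have h0 : 0 <= 2 * kappa * `|y| by rewrite !mulr_ge0// ltW.
have /andP[t1 t2] := truncn_itv h0.
move: (Num.truncn (2 * kappa * `|y|)) t1 t2 => j; rewrite -(natr1 j) => t1 t2.
move: j%:R t1 t2 => {}j t1 t2.
apply: (@le_trans _ _ (expR (1 / (4 * kappa)) *
   (expR (- (j ^+ 2 / (4 * kappa))) * expR (j * `|y|)))).
  rewrite -!expRD ler_expR -[y ^+ 2]real_normK ?num_real//.
  have -> : kappa * `|y| ^+ 2 = ((2 * kappa * `|y|) ^+ 2) / (4 * kappa).
    by field; rewrite gt_eqF.
  have -> : j * `|y| = 2 * j * (2 * kappa * `|y|) / (4 * kappa).
    by field; rewrite gt_eqF.
  rewrite -mulNr -!mulrDl ler_pM2r ?invr_gt0 ?mulr_gt0//; nra.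
rewrite ler_wpM2l ?expR_ge0// ler_wpM2l ?expR_ge0//.
case: (ler0P y) => _; first by rewrite mulrN mulNr lerDr expR_ge0.
by rewrite lerDl expR_ge0.
Qed.

(** The exponential of the square is dominated by a series of linear exponentials. With 1/(4 kappa)
    = L + 1 the term j has mean at most 2 exp (- j^2 (L + 1)) exp (L j^2) = 2 exp (- j^2) <= 2 /
    2^j, and these add up to 4. *)
Lemma subgaussian_square_mgf (Y : T -> R) (L : R) : 0 <= L ->
  measurable_fun setT Y ->
  (forall s, exists m, has_mean P (fun x => expR (s * Y x)) m /\
     0 <= m <= expR (L * s ^+ 2)) ->
  exists m, has_mean P (fun x => expR ((4 * (L + 1))^-1 * Y x ^+ 2)) m /\
    0 <= m <= 4 * expR (L + 1).
Proof.
move=> L0 mY mgf; set kappa := (4 * (L + 1))^-1.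
have k0 : 0 < kappa by rewrite invr_gt0 mulr_gt0// ltr_wpDl.
have kE : (4 * kappa)^-1 = L + 1.
  by rewrite /kappa; field; rewrite gt_eqF// ltr_wpDl.
pose f (j : nat) x := expR (- (j%:R ^+ 2 * (L + 1))) *
  (expR (j%:R * Y x) + expR (- j%:R * Y x)) : R.
have f0 j x : 0 <= f j x by rewrite mulr_ge0 ?addr_ge0 ?expR_ge0.
have hf (j : nat) : exists a, has_mean P (f j) a /\ 0 <= a <= 2 * 2^-1 ^+ j.
  have [m1 [h1 /andP[m10 m1b]]] := mgf j%:R.
  have [m2 [h2 /andP[m20 m2b]]] := mgf (- j%:R).
  exists (expR (- (j%:R ^+ 2 * (L + 1))) * (m1 + m2)); split.
    by apply: has_meanZ; exact: has_meanD.
  rewrite mulr_ge0 ?expR_ge0 ?addr_ge0//=.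
  apply: (@le_trans _ _ (expR (- (j%:R ^+ 2 * (L + 1))) *
     (2 * expR (L * j%:R ^+ 2)))).
    by rewrite ler_wpM2l ?expR_ge0//; rewrite sqrrN in m2b; lra.
  rewrite mulrCA -expRD ler_pM2l// exprVn -[leRHS]opprK.
  rewrite (_ : _ + _ = - (j%:R * j%:R)); last ring.
  rewrite expRN opprK lef_pV2 ?posrE ?expR_gt0 ?exprn_gt0//.
  have e1 : 2 <= expR 1 :> R by have := expR_ge1Dx (1 : R); lra.
  apply: (@le_trans _ _ (expR 1 ^+ j)).
    by rewrite lerXn2r ?nnegrE ?expR_ge0.
  rewrite -expRM_natl mulr1 ler_expR -natrM ler_nat.
  by have [->//|j0] := posnP j; rewrite leq_pmulr.
have mf j : measurable_fun setT (f j).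
  by have [a [/has_mean_measurable]] := hf j.
have sum_le : (\int[P]_x (\sum_(j <oo) (f j x)%:E) <= 4%:E)%E.
  rewrite integral_nneseries//; last 2 first.
  - by move=> j; apply/measurable_EFinP; exact: mf.
  - by move=> j x _; rewrite lee_fin.
  apply: lime_le; first apply: is_cvg_nneseries => j _ _.
    by apply: integral_ge0 => x _; rewrite lee_fin.
  apply: nearW => n.
  apply: (@le_trans _ _ (\sum_(0 <= j < n) (2 * 2^-1 ^+ j)%:E)%E).
    apply: lee_sum => j _; have [a [[_ ->] /andP[_ ab]]] := hf j.
    by rewrite lee_fin.
  rewrite sumEFin lee_fin -mulr_sumr; rewrite (_ : \sum_(_ <= _ < _) _ = 2 - 2 * 2^-1 ^+ n).
    by have : 0 <= 2^-1 ^+ n :> R; [rewrite exprn_ge0|lra].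
  elim: n => [|n ih]; first by rewrite big_geq// expr0; lra.
  by rewrite big_nat_recr//= ih exprS; field.
pose F x := expR (kappa * Y x ^+ 2).
have mF : measurable_fun setT F.
  apply: measurableT_comp => //; apply: measurable_funM => //.
  exact: measurable_funX.
have FB : (\int[P]_x (F x)%:E <= (4 * expR (L + 1))%:E)%E.
  apply: (@le_trans _ _
    (\int[P]_x ((expR (L + 1))%:E * \sum_(j <oo) (f j x)%:E))%E).
    apply: ge0_le_integral => //.
    - by move=> x _; rewrite lee_fin expR_ge0.
    - exact/measurable_EFinP.
    - apply: measurable_funeM; apply: ge0_emeasurable_sum => j *.
        by rewrite lee_fin.
      exact/measurable_EFinP.
    move=> x _; have [j] := expR_sqr_le_linear (Y x) k0.
    rewrite mul1r kE -/(F x) -/(f j x) => Fj.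
    apply: (@le_trans _ _ ((expR (L + 1))%:E * (f j x)%:E)%E).
      by rewrite -EFinM lee_fin.
    rewrite lee_pmul2l// ?lte_fin ?expR_gt0//.
    rewrite (nneseriesD1 (n := j))//.
      rewrite leeDl// nneseries_ge0// => i _ _.
      by rewrite lee_fin.
    by move=> i _ ; rewrite lee_fin.
  rewrite ge0_integralZl//.
  - by rewrite mulrC EFinM lee_pmul2l// lte_fin expR_gt0.
  - apply: ge0_emeasurable_sum => j *; first by rewrite lee_fin.
    exact/measurable_EFinP.
  - by move=> x _; apply: nneseries_ge0 => j _ _; rewrite lee_fin.
have Fm := has_mean_ge0 mF (fun=> expR_ge0 _) (le_lt_trans FB (ltry _)).
exists (fine (\int[P]_x (F x)%:E)); split => //; case: Fm => _ FE.
rewrite -!lee_fin -FE FB andbT; apply: integral_ge0 => x _.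
by rewrite lee_fin expR_ge0.
Qed.

End SubgaussianMoments.

(** * Means of products over independent families *)

Section IndependentProducts.
Context d (T : measurableType d) (R : realType) (P : probability T R).
Context d' (T' : measurableType d').
Variable G : set (set T').
Hypothesis genG : @measurable _ T' = <<s G >>.
Hypotheses (GI : setI_closed G) (GT : G setT).

Let mG A : G A -> measurable A.
Proof. by rewrite genG => GA; exact: sub_sigma_algebra. Qed.

(** The sets satisfying the indicator identity form a Dynkin class, so that it need only be checked
    on the generating class G, stable under intersection. *)
Lemma has_mean_factor (X : T -> T') (g : T -> R) (c m : R) (f : T' -> R) :
  measurable_fun setT X -> (forall x, 0 <= g x) -> has_mean P g c ->
  (forall A, G A -> (\int[P]_x (\1_A (X x) * g x)%:E = P (X @^-1` A) * c%:E)%E) ->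
  measurable_fun setT f -> (forall y, 0 <= f y) -> has_mean P (f \o X) m ->
  has_mean P (fun x => f (X x) * g x) (m * c).
Proof.
move=> mX g0 hg hG mf f0 hf; have mg := has_mean_measurable hg.
have mXA A : measurable A -> measurable (X @^-1` A).
  by move=> mA; rewrite -[_ @^-1` _]setTI; exact: mX.
have restr A : measurable A ->
    (\int[P]_x (\1_A (X x) * g x)%:E = \int[P]_(x in X @^-1` A) (g x)%:E)%E.
  move=> mA; rewrite [RHS]integral_mkcond; apply: eq_integral => x _.
  rewrite patchE indicE; case: (pselect (A (X x))) => h.
    by rewrite !mem_set// mul1r.
  by rewrite !memNset// mul0r.
have all A : measurable A ->
    (\int[P]_x (\1_A (X x) * g x)%:E = P (X @^-1` A) * c%:E)%E.
  rewrite {1}genG => sA; apply: (@dynkin_induction _ T' G (fun A =>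
    (\int[P]_x (\1_A (X x) * g x)%:E = P (X @^-1` A) * c%:E)%E)) => //.
  - by apply: hG.
  - move=> S mS hS; have [gi gE] := hg.
    have : (\int[P]_x (\1_S (X x) * g x)%:E + \int[P]_x (\1_(~` S) (X x) * g x)%:E
        = c%:E)%E.
      rewrite !restr//; last exact: measurableC.
      rewrite -gE -[in RHS](setUv (X @^-1` S)) preimage_setC ge0_integral_setU//.
      + exact: mXA.
      + by apply: measurableC; exact: mXA.
      + apply: measurable_funTS; exact/measurable_EFinP.
      + by move=> x _; rewrite lee_fin.
      + by apply/disj_setPS => x [].
    rewrite hS -(preimage_setC X) probability_setC; last exact: mXA.
    rewrite -(fineK (fin_num_measure P _ (mXA _ mS))).
    move: (fine _) (\int[P]_x _)%E => p [r| |] //.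
    by rewrite -EFinM -EFinD => -[e]; rewrite -EFinB -EFinM; congr EFin; lra.
  move=> F mF tF hF; have mFX k := mXA _ (mF k).
  have mU : measurable (\bigcup_k F k) by exact: bigcupT_measurable.
  rewrite restr// preimage_bigcup ge0_integral_bigcup//.
  - rewrite measure_semi_bigcup//; last exact: bigcupT_measurable.
      rewrite muleC -nneseriesZl//.
      by apply: eq_eseriesr => i _; rewrite -restr// hF muleC.
    by move=> i j _ _ [x [/= Fi Fj]]; apply: tF => //; exists (X x).
  - apply: measurable_funTS; exact/measurable_EFinP.
  - by move=> x _; rewrite lee_fin.
  - by move=> i j _ _ [x [/= Fi Fj]]; apply: tF => //; exists (X x).
have c0 : (0 <= c%:E)%E.
  by case: hg => _ <-; apply: integral_ge0 => x _; rewrite lee_fin.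
have e : (\int[P]_x (f (X x) * g x)%:E = (m * c)%:E)%E.
  by rewrite (ge0_integral_factor mX mg g0 _ c0 all mf f0)//; case: hf => _ ->.
rewrite -[(m * c)%R]/(fine (m * c)%:E) -e; apply: has_mean_ge0.
- by apply: measurable_funM => //; exact: measurableT_comp.
- by move=> x; rewrite mulr_ge0.
- by rewrite e ltry.
Qed.

(** Induction on the list s of indices whose factor is an arbitrary function, the others being
    indicators of sets of G. If all are indicators this is independence; an index joins s by
    [has_mean_factor], whose hypothesis is the induction hypothesis with an indicator at that
    place. *)
Lemma has_mean_prod (I : finType) (Y : I -> T -> T') (F : I -> T' -> R) (m : I -> R) :
  (forall i, measurable_fun setT (Y i)) ->
  (forall B : I -> set T', (forall i, G (B i)) ->
     (P [set x | forall i, B i (Y i x)] = \prod_i P (Y i @^-1` B i))%E) ->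
  (forall i, measurable_fun setT (F i)) -> (forall i y, 0 <= F i y) ->
  (forall i, has_mean P (F i \o Y i) (m i)) ->
  has_mean P (fun x => \prod_i F i (Y i x)) (\prod_i m i).
Proof.
move=> mY indY; have mYA i A : G A -> measurable (Y i @^-1` A).
  by move=> /mG mA; rewrite -[_ @^-1` _]setTI; exact: mY.
suff key (s : seq I) : forall (F : I -> T' -> R) m,
    (forall i, measurable_fun setT (F i)) -> (forall i y, 0 <= F i y) ->
    (forall i, has_mean P (F i \o Y i) (m i)) ->
    (forall i, i \notin s -> exists2 A, G A & F i = \1_A) ->
    has_mean P (fun x => \prod_i F i (Y i x)) (\prod_i m i).
  by move=> mF F0 hF; apply: (key (enum I)) => // i; rewrite mem_enum.
elim: s => [|j s ih] {}F {}m mF F0 hF FG.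
  have /choice[B hB] i : exists A, G A /\ F i = \1_A.
    by have [A GA ->] := FG i isT; exists A.
  have -> : (fun x => \prod_i F i (Y i x))
      = \1_[set x | forall i, B i (Y i x)] :> (T -> R).
    apply/funext => x; rewrite indicE; case: (pselect (forall i, B i (Y i x))) => h.
      rewrite mem_set// big1// => i _; case: (hB i) => _ ->.
      by rewrite indicE mem_set.
    rewrite memNset//; have /existsNP[i hi] := h; rewrite (bigD1 i)//=.
    by case: (hB i) => _ ->; rewrite indicE memNset// mul0r.
  have mB : measurable [set x | forall i, B i (Y i x)].
    rewrite (_ : [set x | _] = \big[setI/setT]_(i in [set: I]%SET) (Y i @^-1` B i)).
      by apply: bigsetI_measurable => i _; apply: mYA; case: (hB i).
    apply/seteqP; split=> [x h|x].
      by rewrite /= -bigcap_seq_cond => i _; exact: h.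
    rewrite -bigcap_seq_cond => h i; apply: h => /=.
    by rewrite mem_index_enum/= inE.
  have eP : P [set x | forall i, B i (Y i x)] = (\prod_i m i)%:E.
    rewrite indY; last by move=> i; case: (hB i).
    rewrite -prodEFin; apply: eq_bigr => i _; case: (hB i) => GB FB.
    case: (hF i) => _ <-; rewrite FB /=.
    by rewrite integral_preimage_indic//; exact: mG.
  rewrite -[\prod_i m i]/(fine (\prod_i m i)%:E) -eP.
  exact: (@has_mean_indic _ _ _ P _ _ id).
have upd A : G A -> has_mean P (fun x => \1_A (Y j x) * \prod_(i | i != j) F i (Y i x))
     (fine (P (Y j @^-1` A)) * \prod_(i | i != j) m i).
  move=> GA; pose F' i := if i == j then \1_A else F i.
  pose m' i := if i == j then fine (P (Y j @^-1` A)) else m i.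
  have := ih F' m'.
  have -> : \prod_i m' i = fine (P (Y j @^-1` A)) * \prod_(i | i != j) m i.
    rewrite (bigD1 j)//= {1}/m' eqxx; congr (_ * _).
    by apply: eq_bigr => i /negbTE ij; rewrite /m' ij.
  have -> : (fun x => \prod_i F' i (Y i x))
      = fun x => \1_A (Y j x) * \prod_(i | i != j) F i (Y i x).
    apply/funext => x; rewrite (bigD1 j)//= {1}/F' eqxx; congr (_ * _).
    by apply: eq_bigr => i /negbTE ij; rewrite /F' ij.
  apply.
  - move=> i; rewrite /F'; case: ifP => // _; apply: measurable_indic; exact: mG.
  - by move=> i y; rewrite /F'; case: ifP.
  - move=> i; rewrite /F' /m'; case: eqP => [->|//].
    by apply: has_mean_indic => //; exact: mG.
  move=> i is_; rewrite /F'; case: eqP => [_|/eqP ij]; first by exists A.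
  by apply: FG; rewrite inE negb_or ij.
rewrite [X in has_mean _ _ X](bigD1 j)//=.
rewrite (_ : (fun x => _) = fun x => F j (Y j x) * \prod_(i | i != j) F i (Y i x)).
  apply: (@has_mean_factor (Y j)) => //.
  - by move=> x; apply: prodr_ge0.
  - have := upd setT GT; rewrite preimage_setT probability_setT mul1r.
    by under eq_fun do rewrite indicT mul1r.
  - move=> A GA; case: (upd A GA) => _ ->.
    by rewrite EFinM fineK// fin_num_measure//; exact: mYA.
by apply/funext => x; rewrite (bigD1 j).
Qed.

End IndependentProducts.

Section Transfer.
Local Open Scope ereal_scope.
Context d (T : measurableType d) d' (T' : measurableType d') (R : realType).
Variables (P : probability T R) (mu : probability T' R).

Lemma has_mean_law (X : T -> T') (f : T' -> R) m : measurable_fun setT X ->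
  (forall A, measurable A -> P (X @^-1` A) = mu A) ->
  has_mean mu f m -> has_mean P (f \o X) m.
Proof.
move=> mX lawX fm; have mf := has_mean_measurable fm; have [fi fE] := fm.
pose X' : {mfun T >-> T'} := HB.pack X (isMeasurableFun.Build _ _ _ _ X mX).
have lawE (g : T' -> \bar R) : \int[pushforward P X']_y g y = \int[mu]_y g y.
  by apply: eq_measure_integral => A mA _; exact: lawX.
have fXi : P.-integrable setT (EFin \o (f \o X)).
  apply/integrableP; split.
    by apply/measurable_EFinP; exact: measurableT_comp.
  have := ge0_integral_pushforward mX P measurableT (f := fun y => `|(f y)%:E|).
  rewrite preimage_setT => <-//.
  - by rewrite lawE; case/integrableP: fi.
  - by apply/measurableT_comp => //; exact/measurable_EFinP.
split => //; rewrite -fE -lawE.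
by rewrite (integral_pushforward mX)//; exact/measurable_EFinP.
Qed.

End Transfer.

(** * Exponential moments of a subgaussian map *)

Section SubgaussianRows.
Context {R : realType}.
Variables (mu : probability (measurableTypeR R) R) (c : R).
Hypotheses (c0 : 0 < c) (mean0 : (\int[mu]_x x%:E = 0)%E)
  (var1 : (\int[mu]_x (x ^+ 2)%:E = 1)%E)
  (orlicz : (\int[mu]_x (expR ((x / c) ^+ 2))%:E <= 2%:E)%E).

Lemma law_square : has_mean mu (fun x => x ^+ 2) 1.
Proof.
rewrite -[1]/(fine 1%:E) -var1; apply: has_mean_ge0.
- exact: measurable_funX.
- by move=> x; exact: sqr_ge0.
- by rewrite var1 ltry.
Qed.

Lemma law_mean : has_mean mu id 0.
Proof.
have h (x : R) : `|x| <= 1 + x ^+ 2.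
  have : 0 <= (`|x| - 1) ^+ 2 by exact: sqr_ge0.
  have : 0 <= `|x| by [].
  by rewrite -[x ^+ 2]real_normK ?num_real//; nra.
have [b mb] := @has_mean_le _ (measurableTypeR R) R mu id _ _ (@measurable_id _ _ _) h
  (has_meanD (has_mean_cst mu 1) law_square).
by move: (mb); case: mb => _; rewrite mean0 => -[<-].
Qed.

Lemma law_orlicz : exists Q, has_mean mu (fun x => expR ((x / c) ^+ 2)) Q /\ Q <= 2.
Proof.
have mE : measurable_fun setT (fun x : measurableTypeR R => expR ((x / c) ^+ 2)).
  apply: measurableT_comp => //; apply: measurable_funX.
  exact: measurable_funM.
have h := has_mean_ge0 mE (fun=> expR_ge0 _) (le_lt_trans orlicz (ltry _)).
by eexists; split; [exact: h|case: h => _ e; rewrite -lee_fin -e].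
Qed.

Variables (d t : nat) (D : probability (rmx R d) R).
Hypotheses (t0 : (0 < t)%N) (mapD : subgaussian_map mu t D).

(** Rescaled to have law [mu]. Off the fiber of t, a null set, the value is 0. *)
Definition sg_entry (i : 'I_t) (j : 'I_d) (G : rmx R d) : R :=
  Num.sqrt t%:R * mx_at t G i j.

Lemma measurable_sg_entry i j : measurable_fun setT (sg_entry i j).
Proof. by apply: measurable_funM => //; exact: measurable_mx_at. Qed.

Lemma subgaussian_fiber : D (fiber t) = 1%E.
Proof.
have -> : fiber t = @mxbox R d t (fun _ _ => setT).
  apply/seteqP; split=> [[r' M] /= rr'|_ [M _ <-]//].
  by rewrite /fiber/= in rr'; case: t / rr'; exists M.
rewrite (mapD (fun _ _ => measurableT)) big1// => i _.
by rewrite big1// => j _; rewrite preimage_setT probability_setT.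
Qed.

Lemma subgaussian_fiberE (A : set (rmx R d)) : measurable A -> D A = D (A `&` fiber t).
Proof.
move=> mA; rewrite (measureDI D (A := A) (B := fiber t))//; last exact: measurable_fiber.
rewrite [X in (X + _)%E](_ : _ = 0%E) ?add0e//; apply/eqP; rewrite -measure_le0.
apply: (@le_trans _ _ (D (~` fiber t))).
  apply: le_measure; rewrite ?inE//.
  - by apply: measurableD => //; exact: measurable_fiber.
  - by apply: measurableC; exact: measurable_fiber.
rewrite probability_setC; last exact: measurable_fiber.
by rewrite subgaussian_fiber subee.
Qed.

Lemma subgaussian_entries (B : 'I_t -> 'I_d -> set (measurableTypeR R)) :
  (forall i j, measurable (B i j)) ->
  D [set G | forall i j, B i j (sg_entry i j G)] = (\prod_i \prod_j mu (B i j))%E.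
Proof.
move=> mB; have s0 : Num.sqrt t%:R != 0 :> R.
  by rewrite gt_eqF// sqrtr_gt0 ltr0n.
pose B' i j : set (measurableTypeR R) := (fun w => Num.sqrt t%:R * w) @^-1` B i j.
have mB' i j : measurable (B' i j).
  have mul : measurable_fun setT
      (fun w : measurableTypeR R => (Num.sqrt t%:R : R) * w : measurableTypeR R).
    by apply: measurable_funM.
  by rewrite -[B' i j]setTI; exact: mul.
have E : [set G | forall i j, B i j (sg_entry i j G)] `&` fiber t = mxbox B'.
  apply/seteqP; split=> [G [/= h Gt]|_ [M hM <-]].
    by rewrite (mx_atK Gt); eexists; [|reflexivity] => i j; exact: h.
  by split=> //= i j; rewrite /sg_entry mx_atE; exact: hM.
rewrite subgaussian_fiberE ?E ?mapD//.
  apply: eq_bigr => i _; apply: eq_bigr => j _; congr (mu _).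
  by apply/seteqP; split=> w; rewrite /B' /= mulVKf.
rewrite (_ : [set G | _] = \bigcap_(ij in [set: 'I_t * 'I_d])
    (sg_entry ij.1 ij.2 @^-1` B ij.1 ij.2)).
  apply: fin_bigcap_measurable => [|ij _]; first exact: finite_finset.
  rewrite -[X in measurable X]setTI.
  exact: (@measurable_sg_entry ij.1 ij.2 measurableT _ (mB _ _)).
apply/seteqP; split=> [G h [i j] _|G h i j] /=; first exact: h.
exact: (h (i, j)).
Qed.

Lemma subgaussian_row i (B : 'I_d -> set (measurableTypeR R)) :
  (forall j, measurable (B j)) ->
  D [set G | forall j, B j (sg_entry i j G)] = (\prod_j mu (B j))%E.
Proof.
move=> mB; have := @subgaussian_entries (fun i' j => if i' == i then B j else setT).
rewrite (bigD1 i)//= eqxx [X in (_ * X)%E]big1 ?mule1 => [<-|i' /negbTE ->].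
- congr (D _); apply/seteqP; split=> G /= h; first by move=> i' j; case: eqP => [->|].
  by move=> j; have := h i j; rewrite eqxx.
- by move=> i' j; case: eqP.
by rewrite big1// => j _; rewrite probability_setT.
Qed.

Lemma subgaussian_entry i j (B : set (measurableTypeR R)) : measurable B ->
  D (sg_entry i j @^-1` B) = mu B.
Proof.
move=> mB; have := @subgaussian_row i (fun j' => if j' == j then B else setT).
rewrite (bigD1 j)//= eqxx [X in (_ * X)%E]big1 ?mule1 => [<-|j' /negbTE ->].
- congr (D _); apply/seteqP; split=> G /= h; first by move=> j'; case: eqP => [->|].
  by have := h j; rewrite eqxx.
- by move=> j'; case: eqP.
by rewrite probability_setT.
Qed.

Lemma has_mean_entry i j f m : has_mean mu f m ->
  has_mean D (fun G => f (sg_entry i j G)) m.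
Proof.
apply: (@has_mean_law _ _ _ (measurableTypeR R) _ D mu (sg_entry i j)).
  exact: measurable_sg_entry.
exact: subgaussian_entry.
Qed.

Lemma subgaussian_entry_pair i j l : j != l ->
  has_mean D (fun G => sg_entry i j G * sg_entry i l G) 0.
Proof.
move=> jl; rewrite -[0](mulr0 0); apply: has_mean_mul_indep; last 2 first.
- exact: has_mean_entry law_mean.
- exact: has_mean_entry law_mean.
move=> A B mA mB; rewrite !subgaussian_entry//.
have := @subgaussian_row i (fun k => if k == j then A else if k == l then B else setT).
have lj : (l == j) = false by rewrite eq_sym (negbTE jl).
rewrite (bigD1 j)//= eqxx (bigD1 l) ?lj//= eqxx.
rewrite [X in (_ * (_ * X))%E]big1 ?mule1 => [<-|k /andP[/negbTE -> /negbTE ->]].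
- congr (D _); apply/seteqP; split=> G /=.
    by move=> [hA hB] k; case: eqP => [->|_]//; case: eqP => [->|].
  move=> h; split; first by have := h j; rewrite eqxx.
  by have := h l; rewrite lj eqxx.
- by move=> k; do 2 case: ifP => // _.
by rewrite probability_setT.
Qed.

Definition sg_lin i (u : 'cV[R]_d) (G : rmx R d) : R := \sum_j u j 0 * sg_entry i j G.

Lemma measurable_sg_lin i u : measurable_fun setT (sg_lin i u).
Proof.
by apply: measurable_sum => j; apply: measurable_funM => //; exact: measurable_sg_entry.
Qed.

Lemma subgaussian_lin_cov i u v :
  has_mean D (fun G => sg_lin i u G * sg_lin i v G) (dotv u v).
Proof.
rewrite (_ : (fun G => _) = fun G => \sum_j \sum_l
    (u j 0 * v l 0) * (sg_entry i j G * sg_entry i l G)).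
  have -> : dotv u v = \sum_j \sum_l (u j 0 * v l 0) * (j == l)%:R.
    apply: eq_bigr => j _; rewrite (bigD1 j)//= eqxx mulr1 big1 ?addr0// => l.
    by rewrite eq_sym => /negbTE ->; rewrite mulr0.
  apply: has_mean_sum => j; apply: has_mean_sum => l; apply: has_meanZ.
  have [<-|jl] := eqVneq j l; last exact: subgaussian_entry_pair.
  exact: has_mean_entry law_square.
apply/funext => G; rewrite /sg_lin mulr_suml; apply: eq_bigr => j _.
by rewrite mulr_sumr; apply: eq_bigr => l _; ring.
Qed.

Lemma subgaussian_lin_mgf i u s : normsq u <= 1 ->
  exists m, has_mean D (fun G => expR (s * sg_lin i u G)) m /\
    0 <= m <= expR (5 * c ^+ 2 * s ^+ 2).
Proof.
move=> u1; have [Q [hQ Q2]] := law_orlicz.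
have /choice[m hm] j := subgaussian_mgf (s * u j 0) c0 law_mean hQ Q2.
exists (\prod_j m j); split.
  rewrite (_ : (fun G => _) = fun G => \prod_j expR (s * u j 0 * sg_entry i j G)).
    apply: (@has_mean_prod _ (rmx R d) R D _ (measurableTypeR R)
      (@measurable _ (measurableTypeR R)) _ _ _ _ (sg_entry i)
      (fun j x => expR (s * u j 0 * x))).
    - by rewrite sigma_algebra_id//; exact: sigma_algebra_measurable.
    - by move=> A B; exact: measurableI.
    - exact: measurableT.
    - exact: measurable_sg_entry.
    - move=> B mB; rewrite subgaussian_row//.
      by apply: eq_bigr => j _; rewrite subgaussian_entry.
    - by move=> j; apply: measurableT_comp => //; exact: measurable_funM.
    - by move=> j y; exact: expR_ge0.
    - by move=> j; case: (hm j) => h _; exact: has_mean_entry h.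
  apply/funext => G; rewrite -expR_sum mulr_sumr; congr expR.
  by apply: eq_bigr => j _; rewrite mulrA.
rewrite prodr_ge0 => [|j _]; last by case: (hm j) => _ /andP[].
apply: (@le_trans _ _ (\prod_j expR (5 * c ^+ 2 * (s * u j 0) ^+ 2))).
  by apply: ler_prod => j _; case: (hm j).
rewrite -expR_sum ler_expR.
rewrite (eq_bigr (fun j => 5 * c ^+ 2 * s ^+ 2 * u j 0 ^+ 2)) => [|j _]; last by ring.
rewrite -mulr_sumr -normsqE ler_piMr// mulr_ge0 ?sqr_ge0// mulr_ge0 ?sqr_ge0//.
Qed.

Let L := 5 * c ^+ 2.

Definition sg_kappa : R := (4 * (L + 1))^-1.

(** 8 e / kappa^2, the coefficient of the remainder in [subgaussian_row_mgf], times 8 exp (L + 1),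
    twice the bound of [subgaussian_square_mgf]. *)
Definition sg_const : R := 64 * expR (L + 2) / sg_kappa ^+ 2.

Let L0 : 0 <= L. Proof. by rewrite mulr_ge0 ?sqr_ge0. Qed.

Lemma sg_kappa_gt0 : 0 < sg_kappa.
Proof. by rewrite invr_gt0 mulr_gt0// ltr_wpDl. Qed.

Lemma sg_const_gt0 : 0 < sg_const.
Proof. apply: divr_gt0; first by rewrite mulr_gt0 ?expR_gt0.
by apply: exprn_gt0; exact: sg_kappa_gt0. Qed.

(** The product X of two linear forms, once centred, has no linear contribution. The quadratic
    remainder is controlled by exp (kappa |X|), and a b <= (a^2 + b^2) / 2 reduces this to
    exponentials of squares. *)
Lemma subgaussian_row_mgf i u v s : normsq u <= 1 -> normsq v <= 1 ->
  `|s| <= sg_kappa / 2 ->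
  exists m, has_mean D (fun G => expR (s * (sg_lin i u G * sg_lin i v G - dotv u v))) m /\
    0 <= m <= 1 + sg_const * s ^+ 2.
Proof.
move=> u1 v1 sk; have k0 := sg_kappa_gt0.
have k1 : sg_kappa <= 1.
  by rewrite invf_le1 ?mulr_gt0 ?ltr_wpDl//; have := L0; lra.
have [mu_ [hu /andP[_ ub]]] := subgaussian_square_mgf L0 (measurable_sg_lin i u)
  (fun s => subgaussian_lin_mgf i s u1).
have [mv_ [hv /andP[_ vb]]] := subgaussian_square_mgf L0 (measurable_sg_lin i v)
  (fun s => subgaussian_lin_mgf i s v1).
rewrite -/sg_kappa in hu hv.
set a := sg_lin i u in hu *; set b := sg_lin i v in hv *.
have uv1 : `|dotv u v| <= 1.
  have := cauchy_schwarz u v; rewrite -[dotv u v ^+ 2]real_normK ?num_real// => h.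
  have := normsq_ge0 u; have := normsq_ge0 v; have : 0 <= `|dotv u v| by [].
  nra.
pose X G := a G * b G - dotv u v.
have hX : has_mean D X 0.
  rewrite -[0](subrr (dotv u v)); apply: has_meanB; last exact: has_mean_cst.
  exact: subgaussian_lin_cov.
have ptw G : expR (s * X G) <= (1 + s * X G) + s ^+ 2 * (8 * expR 1 / sg_kappa ^+ 2) *
    (expR (sg_kappa * a G ^+ 2) + expR (sg_kappa * b G ^+ 2)).
  apply: le_trans (expR_le_quadratic _) _; rewrite lerD2l exprMn.
  rewrite -[leRHS]mulrA -(mulrA (s ^+ 2) (X G ^+ 2)); apply: ler_wpM2l.
    exact: sqr_ge0.
  (* Half of the exponent kappa pays for X^2, by x^2 <= 4 exp x at x = kappa |X| / 2, and the other
     half for exp |s X|. *)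
  have x2 : X G ^+ 2 <= 16 / sg_kappa ^+ 2 * expR (sg_kappa / 2 * `|X G|).
    have h0 : 0 <= sg_kappa / 2 * `|X G| by rewrite mulr_ge0// divr_ge0// ltW.
    have := sqr_le_expR h0; rewrite exprMn real_normK ?num_real// => h.
    rewrite mulrAC ler_pdivlMr ?exprn_gt0//; lra.
  apply: (@le_trans _ _ (16 / sg_kappa ^+ 2 * expR (sg_kappa * `|X G|))).
    have -> : sg_kappa * `|X G| = sg_kappa / 2 * `|X G| + sg_kappa / 2 * `|X G|.
      by field.
    rewrite expRD mulrA ler_pM ?sqr_ge0 ?expR_ge0// ler_expR normrM.
    by rewrite ler_wpM2r.
  have eX : expR (sg_kappa * `|X G|) <= expR 1 *
      ((expR (sg_kappa * a G ^+ 2) + expR (sg_kappa * b G ^+ 2)) / 2).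
    apply: (@le_trans _ _ (expR 1 *
        (expR (sg_kappa / 2 * a G ^+ 2) * expR (sg_kappa / 2 * b G ^+ 2)))).
      rewrite -!expRD ler_expR.
      have h1 : `|X G| <= `|a G * b G| + 1.
        by rewrite (le_trans (ler_normB _ _))// lerD2l.
      have h2 : `|a G * b G| <= (a G ^+ 2 + b G ^+ 2) / 2.
        rewrite normrM -[a G ^+ 2]real_normK ?num_real//.
        rewrite -[b G ^+ 2]real_normK ?num_real//.
        have : 0 <= (`|a G| - `|b G|) ^+ 2 by exact: sqr_ge0.
        lra.
      have : sg_kappa * `|X G| <= sg_kappa * ((a G ^+ 2 + b G ^+ 2) / 2 + 1).
        by rewrite ler_wpM2l ?(ltW k0)//; lra.
      lra.
    rewrite ler_wpM2l ?expR_ge0//.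
    have eE x : expR (sg_kappa * x) = expR (sg_kappa / 2 * x) ^+ 2.
      by rewrite expr2 -expRD; congr expR; field.
    rewrite !eE.
    have : 0 <= (expR (sg_kappa / 2 * a G ^+ 2) - expR (sg_kappa / 2 * b G ^+ 2)) ^+ 2.
      exact: sqr_ge0.
    lra.
  apply: le_trans (ler_wpM2l _ eX) _; first by rewrite divr_ge0// sqr_ge0.
  by rewrite le_eqVlt; apply/orP; left; apply/eqP; field; rewrite gt_eqF.
have mE : measurable_fun setT (fun G => expR (s * X G)).
  apply: measurableT_comp => //; apply: measurable_funM => //.
  exact: has_mean_measurable hX.
have hg := has_meanD (has_meanD (has_mean_cst D 1) (has_meanZ s hX))
  (has_meanZ (s ^+ 2 * (8 * expR 1 / sg_kappa ^+ 2)) (has_meanD hu hv)).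
have [m [hm /andP[m0 mb]]] := has_mean_dominated mE (fun=> expR_ge0 _) ptw hg.
exists m; split => //; rewrite m0/=; apply: le_trans mb _.
rewrite mulr0 addr0 lerD2l /sg_const.
have -> : L + 2 = 1 + (L + 1) by ring.
rewrite (expRD 1 (L + 1)) -(mulrA (s ^+ 2)) [leRHS]mulrC.
apply: ler_wpM2l; first exact: sqr_ge0.
apply: (@le_trans _ _ (8 * expR 1 / sg_kappa ^+ 2 * (8 * expR (L + 1)))).
  apply: ler_wpM2l; last lra.
  by apply: divr_ge0; [rewrite mulr_ge0 ?expR_ge0|exact: sqr_ge0].
by rewrite le_eqVlt; apply/orP; left; apply/eqP; field; rewrite gt_eqF.
Qed.

Local Notation rowbox := (fun B : 'I_d -> set (measurableTypeR R) =>
  [set v : 'rV[R]_d | forall j, B j (v 0 j)]).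

(** A whole row is treated as one random variable. The boxes are stable under intersection and
    generate the sigma-algebra, as [has_mean_prod] requires. *)
Let rowboxes : set (set 'rV[R]_d) :=
  [set rowbox B | B in [set B | forall j, measurable (B j)]].

Local Notation rowT := (g_sigma_algebraType rowboxes).

Let sg_row i (G : rmx R d) : rowT := \row_j sg_entry i j G.

Let sg_row_box i B : sg_row i @^-1` rowbox B = [set G | forall j, B j (sg_entry i j G)].
Proof. by apply/seteqP; split=> G /= h j; have := h j; rewrite mxE. Qed.

Lemma measurable_sg_row i : measurable_fun setT (sg_row i).
Proof.
apply: (@measurability _ _ _ rowT setT _ rowboxes) => // _ [_ [B mB <-] <-].
rewrite setTI sg_row_box (_ : [set G | _] = \bigcap_(j in [set: 'I_d])
    (sg_entry i j @^-1` B j)).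
  apply: fin_bigcap_measurable => [|j _]; first exact: finite_finset.
  rewrite -[X in measurable X]setTI.
  exact: (@measurable_sg_entry i j measurableT _ (mB _)).
by apply/seteqP; split=> [G h j _|G h j] /=; [exact: h|exact: (h j)].
Qed.

Lemma measurable_row_coord j : measurable_fun setT (fun v : rowT => (v : 'rV[R]_d) 0 j).
Proof.
move=> _ B mB; rewrite setTI; apply: sub_sigma_algebra.
exists (fun j' => if j' == j then B else setT) => [j'|]; first by case: eqP.
apply/seteqP; split=> v /= h; first by have := h j; rewrite eqxx.
by move=> j'; case: eqP => [->|].
Qed.

Let sg_row_lin i (w : 'cV[R]_d) G :
  \sum_j w j 0 * (sg_row i G : 'rV[R]_d) 0 j = sg_lin i w G.
Proof. by apply: eq_bigr => j _; rewrite mxE. Qed.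

(** The deviation of the form is the average of t independent centred products, one for each row;
    each contributes at most 1 + C (s/t)^2 <= exp (C (s/t)^2). *)
Lemma subgaussian_form_mgf (u v : 'cV[R]_d) s : normsq u <= 1 -> normsq v <= 1 ->
  0 <= s <= sg_kappa / 2 * t%:R ->
  exists m, has_mean D (fun G => expR (s *
      (dotv (mx_at t G *m u) (mx_at t G *m v) - dotv u v))) m /\
    0 <= m <= expR (sg_const * s ^+ 2 / t%:R).
Proof.
move=> u1 v1 /andP[s0 sk]; have tR : 0 < t%:R :> R by rewrite ltr0n.
have st : `|s / t%:R| <= sg_kappa / 2.
  by rewrite ger0_norm ?divr_ge0 ?(ltW tR)// ler_pdivrMr.
have /choice[m hm] i := subgaussian_row_mgf i u1 v1 st.
exists (\prod_i m i); split.
  rewrite (_ : (fun G => _) = fun G => \prod_i expR (s / t%:R *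
      ((\sum_j u j 0 * (sg_row i G : 'rV[R]_d) 0 j) *
       (\sum_j v j 0 * (sg_row i G : 'rV[R]_d) 0 j) - dotv u v))).
    apply: (@has_mean_prod _ (rmx R d) R D _ rowT rowboxes _ _ _ _ sg_row
      (fun i w => expR (s / t%:R *
      ((\sum_j u j 0 * (w : 'rV[R]_d) 0 j) *
       (\sum_j v j 0 * (w : 'rV[R]_d) 0 j) - dotv u v)))) => //.
    - move=> _ _ [B mB <-] [B' mB' <-]; exists (fun j => B j `&` B' j).
        by move=> j; exact: measurableI.
      by apply/seteqP; split=> [w h|w [h h'] j]; split=> // j; case: (h j).
    - exists (fun=> setT) => [j|]; first exact: measurableT.
      by apply/seteqP; split.
    - exact: measurable_sg_row.
    - move=> C hC; have /choice[B hB] i : exists B, (forall j, measurable (B j)) /\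
          C i = rowbox B by case: (hC i) => B mB <-; exists B.
      have -> : [set G | forall i, C i (sg_row i G)]
          = [set G | forall i j, B i j (sg_entry i j G)].
        apply/seteqP; split=> G /= h i; have := h i; case: (hB i) => _ ->.
          by move=> /= hh j; have := hh j; rewrite mxE.
        by move=> hh j; rewrite mxE; exact: hh.
      rewrite subgaussian_entries; last by move=> i; case: (hB i).
      apply: eq_bigr => i _; case: (hB i) => mB ->.
      by rewrite sg_row_box subgaussian_row.
    - move=> i; apply: measurableT_comp => //; apply: measurable_funM => //.
      apply: measurable_funB => //; apply: measurable_funM;
        apply: measurable_sum => j; apply: measurable_funM => //;
        exact: measurable_row_coord.
    - move=> i; rewrite [X in has_mean _ X](_ : _ = fun G =>
          expR (s / t%:R * (sg_lin i u G * sg_lin i v G - dotv u v))).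
        by case: (hm i).
      by apply/funext => G; rewrite /= !sg_row_lin.
  apply/funext => G; rewrite -expR_sum; congr expR.
  have lin (w : 'cV[R]_d) i : (mx_at t G *m w) i 0 =
      (Num.sqrt t%:R)^-1 * \sum_j w j 0 * (sg_row i G : 'rV[R]_d) 0 j.
    rewrite mxE mulr_sumr; apply: eq_bigr => j _; rewrite mxE /sg_entry.
    by field; rewrite gt_eqF// sqrtr_gt0.
  rewrite -mulr_sumr sumrB sumr_const card_ord -[dotv u v *+ t]mulr_natr.
  rewrite -mulrA; congr (_ * _).
  rewrite mulrBr mulrCA mulVf ?gt_eqF// mulr1 mulr_sumr; congr (_ - _).
  apply: eq_bigr => i _; rewrite !lin mulrACA -invfM -expr2 sqr_sqrtr ?ler0n//.
rewrite prodr_ge0 => [|i _]; last by case: (hm i) => _ /andP[].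
apply: (@le_trans _ _ (\prod_(i < t) expR (sg_const * (s / t%:R) ^+ 2))).
  apply: ler_prod => i _; case: (hm i) => _ /andP[-> h] /=.
  exact: le_trans h (expR_ge1Dx _).
rewrite prodr_const card_ord -expRM_natl ler_expR le_eqVlt; apply/orP; left.
by apply/eqP; field; rewrite gt_eqF.
Qed.

End SubgaussianRows.

(** * Nets and blocks of singular directions *)

Section Nets.
Context {R : realType}.

Definition coord_proj p (J : pred 'I_p) : 'M[R]_p := diag_mx (\row_i (J i)%:R).

Lemma coord_projE p (J : pred 'I_p) (y : 'cV[R]_p) i :
  (coord_proj J *m y) i 0 = (J i)%:R * y i 0.
Proof. by rewrite mul_diag_mx !mxE. Qed.

Lemma coord_projT p (J : pred 'I_p) : (coord_proj J)^T = coord_proj J.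
Proof. exact: tr_diag_mx. Qed.

Lemma coord_proj_id p (J : pred 'I_p) :
  coord_proj J *m coord_proj J = coord_proj J.
Proof.
apply/matrixP => i j; rewrite mul_diag_mx !mxE.
by case: (J i); rewrite ?mul1r// mul0r mul0rn.
Qed.

Lemma l2norm_coord_proj p (J : pred 'I_p) (y : 'cV[R]_p) :
  l2norm (coord_proj J *m y) <= l2norm y.
Proof.
rewrite -[leRHS]mul1r l2norm_le// expr1n mul1r !normsqE.
apply: ler_sum => i _; rewrite coord_projE exprMn.
by case: (J i); rewrite ?expr1n ?mul1r// expr0n mul0r sqr_ge0.
Qed.

(** With radius 1/4 on either side, passing to net points costs at most half of the operator norm
    ([net_opnorm]). *)
Definition unit_net p (J : pred 'I_p) q (N : 'I_q -> 'cV[R]_p) : Prop :=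
  (forall a, l2norm (N a) <= 1) /\
  forall y, l2norm y <= 1 -> coord_proj J *m y = y ->
    exists a, l2norm (y - N a) <= 1 / 4.

(* Integer points z with sum z_i^2 <= 16 m, scaled down by 4 sqrt m. Their
   number is at most the sum of 2^(16 m - sum z_i^2), which factorizes. *)
Lemma exists_unit_net p (J : pred 'I_p) m : (0 < m)%N -> (#|J| <= m)%N ->
  exists q (N : 'I_q -> 'cV[R]_p), (q <= 2 ^ (18 * m))%N /\ unit_net J N.
Proof.
move=> m0 Jm; pose idx := {ffun 'I_p -> 'I_(4 * m).+1 * bool}.
pose h : R := 4 * Num.sqrt m%:R.
have mR : 0 < m%:R :> R by rewrite ltr0n.
have h0 : 0 < h by rewrite mulr_gt0// sqrtr_gt0.
have hh : h ^+ 2 = 16 * m%:R by rewrite exprMn sqr_sqrtr ?ler0n//; ring.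
pose pt (f : idx) : 'cV[R]_p := \col_i ((-1) ^+ (f i).2 * ((f i).1)%:R / h).
pose ok : pred idx := fun f => [forall i, J i || (f i == (ord0, false))] &&
  (\sum_i (f i).1 ^ 2 <= 16 * m)%N.
exists #|ok|, (fun a => pt (enum_val a)); split.
  pose g i (a : 'I_(4 * m).+1 * bool) : R :=
    if J i then 2^-1 ^+ a.1 else (a == (ord0, false))%:R.
  have g0 i a : 0 <= g i a by rewrite /g; case: ifP => // _; rewrite exprn_ge0.
  have geo k : \sum_(j < k) 2^-1 ^+ j <= 2 :> R.
    suff -> : \sum_(j < k) 2^-1 ^+ j = 2 - 2 * 2^-1 ^+ k :> R.
      by have : 0 <= 2^-1 ^+ k :> R; [rewrite exprn_ge0|lra].
    elim: k => [|k ih]; first by rewrite big_ord0 expr0; lra.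
    by rewrite big_ord_recr/= ih exprS; field.
  have gsum i : \sum_a g i a <= if J i then 4 else 1.
    rewrite /g; case: ifP => _.
      rewrite -(pair_bigA _ (fun (j : 'I_(4 * m).+1) (b : bool) => 2^-1 ^+ j : R))/=.
      rewrite (eq_bigr (fun j : 'I_(4 * m).+1 => 2 * 2^-1 ^+ j)) => [|j _].
        by rewrite -mulr_sumr; have := geo (4 * m).+1; lra.
      by rewrite sumr_const card_bool mulr_natl.
    by rewrite (bigD1 (ord0, false))// eqxx big1 => [|a /negbTE -> //]; rewrite /= addr0.
  have okg f : ok f -> 1 <= 2 ^+ (16 * m) * \prod_i g i (f i).
    move=> /andP[/forallP supp sz].
    apply: (@le_trans _ _ (2 ^+ (16 * m) * \prod_i 2^-1 ^+ ((f i).1 ^ 2))).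
      by rewrite prodrXr exprVn ler_pdivlMr ?exprn_gt0// mul1r ler_eXn2l ?ltr1n.
    rewrite ler_wpM2l ?exprn_ge0// ler_prod// => i _; rewrite exprn_ge0//= /g.
    case: ifP => [_|Ji].
      rewrite ler_iXn2l ?invr_gt0 ?invf_lt1 ?ltr1n//.
      by case: (nat_of_ord _) => // k; rewrite expnS leq_pmulr// expn1.
    by have := supp i; rewrite Ji => /= /eqP ->; rewrite eqxx expr0.
  rewrite -(ler_nat R) -sum1_card natr_sum.
  apply: (@le_trans _ _ (\sum_(f : idx) 2 ^+ (16 * m) * \prod_i g i (f i))).
    rewrite [leRHS](bigID ok)/=; apply: ler_wpDr.
      by apply: sumr_ge0 => f _; rewrite mulr_ge0 ?exprn_ge0// prodr_ge0.
    by apply: ler_sum => f; exact: okg.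
  rewrite -mulr_sumr -(bigA_distr_bigA g).
  apply: (@le_trans _ _ (2 ^+ (16 * m) * 4 ^+ m)); last first.
    rewrite -!natrX -natrM ler_nat -(expnM 2 2 m) -expnD leq_exp2l//; lia.
  rewrite ler_wpM2l ?exprn_ge0//.
  apply: (@le_trans _ _ (\prod_i (if J i then 4 else 1 : R))).
    by apply: ler_prod => i _; rewrite gsum sumr_ge0.
  by rewrite -big_mkcond prodr_const ler_weXn2l ?ler1n.
split=> [a|y y1 yJ].
  have := enum_valP a; rewrite unfold_in => /andP[_ sz].
  rewrite -[leRHS]sqrtr1 l2normE ler_wsqrtr// normsqE.
  rewrite (eq_bigr (fun i => ((enum_val a i).1 ^ 2)%:R / (16 * m%:R))) => [|i _].
    by rewrite -mulr_suml -natr_sum ler_pdivrMr ?mulr_gt0// mul1r -natrM ler_nat.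
  by rewrite mxE !exprMn sqrr_sign mul1r exprVn hh natrX.
(* Rounding towards 0 keeps the point in the unit ball. Each of the at most m coordinates in J errs
   by at most 1/h, and m / (16 m) = (1/4)^2. *)
pose z i := Num.truncn (h * `|y i 0|).
have hy i : 0 <= h * `|y i 0| by rewrite mulr_ge0// ltW.
have zle i : (z i)%:R <= h * `|y i 0| by have /andP[] := truncn_itv (hy i).
have zgt i : h * `|y i 0| < (z i)%:R + 1.
  by have /andP[_] := truncn_itv (hy i); rewrite -natr1.
have y0 i : ~~ J i -> y i 0 = 0.
  by move=> /negbTE Ji; rewrite -yJ coord_projE Ji mul0r.
have z2 : (\sum_i z i ^ 2 <= 16 * m)%N.
  rewrite -(ler_nat R) natr_sum natrM -hh.
  apply: (@le_trans _ _ (\sum_i h ^+ 2 * y i 0 ^+ 2)).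
    apply: ler_sum => i _; rewrite natrX -[y i 0 ^+ 2]real_normK ?num_real//.
    by rewrite -exprMn ler_sqr ?nnegrE.
  rewrite -mulr_sumr -normsqE ler_piMr ?sqr_ge0// -sqr_l2norm.
  by rewrite exprn_ile1 ?l2norm_ge0.
have zm i : (z i < (4 * m).+1)%N.
  have : (z i ^ 2 <= (4 * m) ^ 2)%N.
    apply: (@leq_trans (16 * m)).
      by apply: leq_trans z2; rewrite (bigD1 i)//= leq_addr.
    by rewrite expnMn leq_mul2l /= -{1}[m]muln1 leq_mul2l m0 orbT.
  by rewrite leq_sqr ltnS.
pose f : idx := [ffun i => (inord (z i), y i 0 < 0)].
have fz i : (f i).1 = z i :> nat by rewrite ffunE /= inordK.
have okf : ok f.
  apply/andP; split; last by rewrite (eq_bigr (fun i => z i ^ 2)%N) => // i _; rewrite fz.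
  apply/forallP => i; case Ji : (J i) => //=; rewrite ffunE y0 ?Ji// ltxx.
  apply/eqP; congr (_, _); apply/val_inj; rewrite /= inordK//.
  by rewrite /z y0 ?Ji// normr0 mulr0 truncn0.
exists (enum_rank_in okf f); rewrite enum_rankK_in//.
rewrite -[leRHS]ger0_norm// -sqrtr_sqr l2normE ler_wsqrtr// normsqE.
apply: (@le_trans _ _ (\sum_(i | J i) (16 * m%:R)^-1)); last first.
  rewrite sumr_const -[_ *+ _]mulr_natr mulrC ler_pdivrMr ?mulr_gt0//.
  have : #|J|%:R <= m%:R :> R by rewrite ler_nat.
  lra.
rewrite [leRHS]big_mkcond; apply: ler_sum => i _.
have -> : (y - pt f) i 0 = (-1) ^+ (y i 0 < 0)%R * (`|y i 0| - (z i)%:R / h).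
  rewrite !mxE fz ffunE /= mulrBr -mulrA; congr (_ - _).
  have [yn|yp] := ltP (y i 0) 0; first by rewrite ltr0_norm// expr1 mulN1r opprK.
  by rewrite ger0_norm// expr0 mul1r.
rewrite exprMn sqrr_sign mul1r; case: ifPn => [_|Ji]; last first.
  by rewrite /z y0// normr0 mulr0 truncn0 mul0r subrr expr0n.
rewrite -hh -exprVn ler_sqr ?nnegrE ?invr_ge0 ?(ltW h0)//.
  by rewrite lerBlDr -{1}[h^-1]mul1r -mulrDl ler_pdivlMr// mulrC addrC ltW.
by rewrite subr_ge0 ler_pdivrMr// mulrC.
Qed.

(** With y and x' maximizing the bilinear form of X, whose value is then Z, replacing y and then x'
    by net points loses at most Z/4 each time. *)
Lemma net_opnorm p (J J' : pred 'I_p) q q' (N : 'I_q -> 'cV[R]_p)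
    (N' : 'I_q' -> 'cV[R]_p) (F : 'M[R]_p) : unit_net J N -> unit_net J' N' ->
  exists a b, opnorm (coord_proj J *m F *m coord_proj J') <=
    2 * dotv (coord_proj J *m N a) (F *m (coord_proj J' *m N' b)).
Proof.
move=> [N1 netN] [N'1 netN']; set X := _ *m coord_proj J'.
have [x [x1 xX]] : exists x, l2norm x <= 1 /\ l2norm (X *m x) = opnorm X.
  have [U [V sX]] := exists_singvals X^T; set s := singvals _ in sX.
  have [p0|p0] := posnP (minn p p).
    exists 0; rewrite mulmx0 !l2norm0 ler01; split => //.
    by rewrite -opnorm_trmx (svd_opnorm sX) sval_nth0// p0.
  exists (first_cols 1 U *m const_mx 1).
  have c1 : l2norm (const_mx 1 : 'cV[R]_1) = 1.
    by rewrite l2normE normsqE big_ord1 mxE expr1n sqrtr1.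
  have Ul : l2norm (first_cols 1 U *m const_mx 1) = 1.
    by rewrite l2norm_isom// (first_cols_isom sX).
  split; first by rewrite Ul.
  have := opnorm_bound X (first_cols 1 U *m const_mx 1); rewrite Ul mulr1 => ub.
  apply/eqP; rewrite eq_le ub/=.
  have := svd_top sX (const_mx 1) p0; rewrite trmxK c1 mulr1.
  by rewrite -(svd_opnorm sX) opnorm_trmx.
set Z := opnorm X in xX *; have Z0 : 0 <= Z by exact: opnorm_ge0.
(* If Z = 0, its inverse is 0 and so is y, for which the estimates below still hold. *)
pose y := Z^-1 *: (X *m x); pose x' := coord_proj J' *m x.
have Xx' : X *m x' = X *m x by rewrite /x' /X -!mulmxA (mulmxA _ _ x) coord_proj_id.
have [a ya] : exists a, l2norm (y - N a) <= 1 / 4.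
  apply: netN.
    by rewrite l2normZ xX ger0_norm ?invr_ge0//; have [->|z] := eqVneq Z 0;
      rewrite ?mulr0// mulVf.
  by rewrite /y -scalemxAr; congr (_ *: _); rewrite /X !mulmxA coord_proj_id.
have [b xb] : exists b, l2norm (x' - N' b) <= 1 / 4.
  apply: netN'; first by rewrite (le_trans (l2norm_coord_proj _ _)).
  by rewrite /x' mulmxA coord_proj_id.
exists a, b.
have -> : dotv (coord_proj J *m N a) (F *m (coord_proj J' *m N' b))
    = dotv (N a) (X *m N' b).
  by rewrite dotv_adj coord_projT /X !mulmxA.
have yX : dotv y (X *m x') = Z.
  rewrite Xx' dotvZl -/(normsq _) -sqr_l2norm xX; have [->|z] := eqVneq Z 0.
    by rewrite expr0n mulr0.
  by rewrite expr2 mulKf.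
have e : dotv y (X *m x') = dotv (N a) (X *m N' b) + dotv (y - N a) (X *m x')
    + dotv (N a) (X *m (x' - N' b)).
  by rewrite mulmxBr dotvBr dotvBl; ring.
have e1 : dotv (y - N a) (X *m x') <= 1 / 4 * Z.
  rewrite (le_trans (dotv_le _ _))// ler_pM ?l2norm_ge0//.
  by rewrite Xx' xX.
have e2 : dotv (N a) (X *m (x' - N' b)) <= Z * (1 / 4).
  rewrite (le_trans (dotv_le _ _))// -[leRHS]mul1r ler_pM ?l2norm_ge0//.
  by rewrite (le_trans (opnorm_bound _ _))// ler_wpM2l.
lra.
Qed.

End Nets.

Section Blocks.
Context {R : realType}.

Lemma frobnorm_svd m n p (X : 'M[R]_(m, n)) (U : 'M[R]_(m, p)) s V :
  svd X U s V -> frobnorm X ^+ 2 = \sum_i s 0 i ^+ 2.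
Proof.
case=> UU VV _ _ ->.
have isom q r (Q : 'M[R]_(q, p)) (Y : 'M[R]_(p, r)) : Q^T *m Q = 1%:M ->
    frobnorm (Q *m Y) ^+ 2 = frobnorm Y ^+ 2.
  move=> QQ; rewrite !sqr_frobnorm exchange_big [RHS]exchange_big/=.
  apply: eq_bigr => j _; have := normsq_isom (col j Y) QQ.
  have -> : Q *m col j Y = col j (Q *m Y) by rewrite !colE mulmxA.
  rewrite !normsqE => h.
  by transitivity (\sum_i col j (Q *m Y) i 0 ^+ 2);
    [|rewrite h]; apply: eq_bigr => i _; rewrite [col _ _ _ _]mxE.
rewrite -mulmxA isom// -frobnorm_trmx trmx_mul trmxK isom// sqr_frobnorm.
apply: eq_bigr => i _; rewrite (bigD1 i)//= big1 => [|j ji].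
  by rewrite !mxE eqxx addr0.
by rewrite !mxE (negbTE ji) mulr0n expr0n.
Qed.

(** m consecutive indices. Blocks are numbered by all w < p; those beyond the last index are
    empty. *)
Definition block p m (w : 'I_p) : pred 'I_p := fun i => (i %/ m == w)%N.

Lemma card_block p m (w : 'I_p) : (0 < m)%N -> (#|block m w| <= m)%N.
Proof.
move=> m0; pose f (i : 'I_p) : 'I_m := Ordinal (ltn_pmod i m0).
rewrite -[leqRHS]card_ord -(card_in_imset (f := f) (D := block m w)).
  exact: max_card.
move=> i j; rewrite !unfold_in => /eqP iw /eqP jw /(congr1 val)/= ij.
by apply/val_inj; rewrite /= (divn_eq i m) (divn_eq j m) iw jw ij.
Qed.

Lemma sum_block p m (y : 'cV[R]_p) : (0 < m)%N ->
  y = \sum_w coord_proj (block m w) *m y.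
Proof.
move=> m0; apply/matrixP => i j; rewrite (ord1 j) summxE.
have ip : (i %/ m < p)%N by rewrite (leq_ltn_trans (leq_div _ _)).
rewrite (bigD1 (Ordinal ip))//= coord_projE {1}/block eqxx mul1r big1 ?addr0//.
by move=> w wi; rewrite coord_projE /block eq_sym -val_eqE/= in wi *; rewrite (negbTE wi) mul0r.
Qed.

Lemma normsq_block p m (y : 'cV[R]_p) : (0 < m)%N ->
  normsq y = \sum_w normsq (coord_proj (block m w) *m y).
Proof.
move=> m0; rewrite {1}/normsq {2}(sum_block y m0).
rewrite -[LHS]/(dotv y _); elim/big_ind2 : _ => //.
- by rewrite dotv0r.
- by move=> a b c d <- <-; rewrite dotvDr.
move=> w _; rewrite /normsq dotv_adj coord_projT mulmxA coord_proj_id.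
by rewrite dotv_adjr.
Qed.

Lemma dotv_sumr n (I : finType) (u : 'cV[R]_n) (v : I -> 'cV[R]_n) :
  dotv u (\sum_i v i) = \sum_i dotv u (v i).
Proof.
by elim/big_ind2 : _ => // [|a b c d <- <-]; rewrite ?dotv0r ?dotvDr.
Qed.

Definition block_sval p m (s : 'rV[R]_p) (w : nat) : R := sval_nth s (w * m).+1.

Lemma block_sval_bound p m (s : 'rV[R]_p) (w : 'I_p) (y : 'cV[R]_p) :
  (forall i, 0 <= s 0 i) -> (forall i j : 'I_p, (i <= j)%N -> s 0 j <= s 0 i) ->
  l2norm (diag_mx s *m (coord_proj (block m w) *m y))
  <= block_sval m s w * l2norm (coord_proj (block m w) *m y).
Proof.
move=> s0 sd; rewrite l2norm_le ?sval_nth_ge0// normsq_diag normsqE mulr_sumr.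
apply: ler_sum => i _; rewrite coord_projE.
case: (boolP (block m w i)) => [/eqP iw|_]; last by rewrite mul0r expr0n !mulr0.
rewrite ler_wpM2r ?sqr_ge0// ler_sqr ?nnegrE ?sval_nth_ge0//.
by rewrite -sval_nthE sval_nth_dec// -iw leq_divM.
Qed.

(** [nv y] collects the norms of the blocks of y and is as long as y. The bilinear form is thus
    bounded by that of the matrix Z of block norms, whose operator norm is at most its Frobenius
    norm. *)
Lemma opnorm_blocks p m (s : 'rV[R]_p) (F : 'M[R]_p) : (0 < m)%N ->
  (forall i, 0 <= s 0 i) -> (forall i j : 'I_p, (i <= j)%N -> s 0 j <= s 0 i) ->
  opnorm (diag_mx s *m F *m diag_mx s) ^+ 2 <=
  \sum_(w < p) \sum_(w' < p) (block_sval m s w * block_sval m s w' *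
    opnorm (coord_proj (block m w) *m F *m coord_proj (block m w'))) ^+ 2.
Proof.
move=> m0 s0 sd; pose D w : 'M[R]_p := coord_proj (block m w).
pose a w := block_sval m s w; have a0 w : 0 <= a w by exact: sval_nth_ge0.
pose Z : 'M[R]_p := \matrix_(w, w') (a w * a w' * opnorm (D w *m F *m D w')).
have -> : \sum_(w < p) \sum_(w' < p) (a w * a w' * opnorm (D w *m F *m D w')) ^+ 2
    = frobnorm Z ^+ 2.
  rewrite sqr_frobnorm; apply: eq_bigr => w _; apply: eq_bigr => w' _.
  by rewrite mxE.
rewrite ler_sqr ?nnegrE ?opnorm_ge0 ?frobnorm_ge0//.
pose nv (y : 'cV[R]_p) : 'cV[R]_p := \col_w l2norm (D w *m y).
have nvE y : l2norm (nv y) = l2norm y.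
  rewrite !l2normE (normsq_block y m0) normsqE; congr Num.sqrt.
  by apply: eq_bigr => w _; rewrite mxE sqr_l2norm.
have key y x : dotv y (diag_mx s *m F *m diag_mx s *m x)
    <= frobnorm Z * l2norm x * l2norm y.
  apply: (@le_trans _ _ (dotv (nv y) (Z *m nv x))); last first.
    rewrite (le_trans (dotv_le _ _))// mulrC nvE ler_wpM2r ?l2norm_ge0//.
    by rewrite -(nvE x) frobnorm_bound.
  rewrite {1}(sum_block y m0) dotvC dotv_sumr [leRHS]/dotv.
  apply: ler_sum => w _; rewrite [nv y w 0]mxE [(Z *m _) w 0]mxE mulr_sumr.
  rewrite {1}(sum_block x m0) mulmx_sumr dotvC dotv_sumr.
  apply: ler_sum => w' _; rewrite [nv x w' 0]mxE [Z w w']mxE -/(D w) -/(D w').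
  have DD v : D v *m D v = D v by exact: coord_proj_id.
  have DT v : (D v)^T = D v by exact: coord_projT.
  have Ds v : D v *m diag_mx s = diag_mx s *m D v by exact: diag_mx_comm.
  have -> : dotv (D w *m y) (diag_mx s *m F *m diag_mx s *m (D w' *m x))
      = dotv (diag_mx s *m (D w *m y))
          ((D w *m F *m D w') *m (diag_mx s *m (D w' *m x))).
    rewrite [RHS]dotv_adj tr_diag_mx !mulmxA -(Ds w) -(mulmxA _ (D w') (diag_mx s)).
    rewrite (Ds w') mulmxA -(mulmxA _ (D w') (D w')) DD -!mulmxA.
    by rewrite [RHS]dotv_adjr DT (mulmxA (D w) (D w)) DD.
  apply: le_trans (dotv_le _ _) _.
  apply: (@le_trans _ _ ((a w * l2norm (D w *m y)) *
      (opnorm (D w *m F *m D w') * (a w' * l2norm (D w' *m x))))).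
    apply: ler_pM; rewrite ?l2norm_ge0//; first exact: block_sval_bound.
    apply: le_trans (opnorm_bound _ _) _; rewrite ler_wpM2l ?opnorm_ge0//.
    exact: block_sval_bound.
  by rewrite le_eqVlt; apply/orP; left; apply/eqP; ring.
apply: opnorm_le => [|v]; first exact: frobnorm_ge0.
set z := _ *m v; have := key z v; rewrite -/z -/(normsq z) -sqr_l2norm expr2.
have [->|z0] := eqVneq (l2norm z) 0.
  by rewrite mulr_ge0 ?frobnorm_ge0 ?l2norm_ge0.
by rewrite ler_pM2r// lt_def z0 l2norm_ge0.
Qed.

(** The leading value of a block is at most each of the m values of the preceding block; the first
    block has no predecessor and accounts for the term in [sval_nth s 1]. *)
Lemma sum_block_sval p m (s : 'rV[R]_p) W :
  (forall i, 0 <= s 0 i) -> (forall i j : 'I_p, (i <= j)%N -> s 0 j <= s 0 i) ->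
  m%:R * \sum_(w < W) block_sval m s w ^+ 2
  <= m%:R * sval_nth s 1 ^+ 2 + \sum_i s 0 i ^+ 2.
Proof.
move=> s0 sd; pose g i := sval_nth s i.+1 ^+ 2.
have g0 i : 0 <= g i by exact: sqr_ge0.
have gsum n : \sum_(0 <= i < n) g i <= \sum_i s 0 i ^+ 2.
  apply: (@le_trans _ _ (\sum_(0 <= i < p + n) g i)).
    rewrite (big_cat_nat (n := n) (p := p + n))//= ?leq_addl// lerDl.
    exact: sumr_ge0.
  rewrite (big_cat_nat (n := p))//= ?leq_addr// [X in _ + X]big_nat_cond.
  rewrite [X in _ + X]big1 => [|i /andP[/andP[pi _] _]]; last first.
    by rewrite /g sval_nth0// expr0n.
  rewrite addr0 big_mkord; apply: ler_sum => i _.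
  by rewrite /g sval_nthE.
case: W => [|W].
  rewrite big_ord0 mulr0; apply: addr_ge0.
    by apply: mulr_ge0 => //; exact: sqr_ge0.
  by apply: sumr_ge0 => i _; exact: sqr_ge0.
apply: le_trans (_ : _ <= m%:R * sval_nth s 1 ^+ 2 + \sum_(0 <= i < W * m) g i) _.
  elim: W => [|W ih].
    by rewrite big_ord1 /block_sval mul0n big_geq// addr0.
  rewrite big_ord_recr/= mulrDr (big_cat_nat (n := W * m))//=; last first.
    by rewrite leq_mul2r leqnSn orbT.
  rewrite addrA lerD//.
  apply: (@le_trans _ _ (\sum_(W * m <= i < W.+1 * m) block_sval m s W.+1 ^+ 2)).
    by rewrite sumr_const_nat mulSn addnK mulr_natl.
  apply: ler_sum_nat => i /andP[_ im].
  rewrite ler_sqr ?nnegrE ?sval_nth_ge0//; apply: sval_nth_dec => //.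
  exact: ltnW.
by rewrite lerD2l.
Qed.

End Blocks.

(** For h = z/q - 1 >= 0 the left side is h^2 + 2 h <= 4 (1 + h/2)^2 <= 4 exp h. Subtracting 1 makes
    it nonpositive for z below the threshold q. *)
Lemma expR_excess (R : realType) (lam z q : R) : 0 <= z -> 0 < q -> 1 <= lam * q ->
  (z / q) ^+ 2 - 1 <= 4 * (expR (- (lam * q)) * expR (lam * z)).
Proof.
move=> z0 q0 lq; rewrite -expRD; have [zq|qz] := leP z q.
  apply: (@le_trans _ _ 0); last by rewrite mulr_ge0 ?expR_ge0.
  by rewrite subr_le0 expr_le1// ?divr_ge0 ?(ltW q0)// ler_pdivrMr// mul1r.
set h := z / q - 1; have h0 : 0 <= h by rewrite subr_ge0 ler_pdivlMr// mul1r ltW.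
have hl : h / 2 + h / 2 <= - (lam * q) + lam * z.
  have -> : - (lam * q) + lam * z = lam * q * h by rewrite /h; field; rewrite gt_eqF.
  by rewrite -splitr ler_peMl.
apply: (@le_trans _ _ (4 * (expR (h / 2) * expR (h / 2)))); last first.
  by rewrite ler_pM2l// -expRD ler_expR.
have e := expR_ge1Dx (h / 2).
have : (1 + h / 2) * (1 + h / 2) <= expR (h / 2) * expR (h / 2).
  by rewrite ler_pM// addr_ge0// divr_ge0.
have -> : (z / q) ^+ 2 - 1 = h ^+ 2 + 2 * h by rewrite /h; ring.
nra.
Qed.

Section MeanBounds.
Context d (T : measurableType d) (R : realType) (P : probability T R).

Definition mean_le (f : T -> R) (b : R) : Prop :=
  exists a, has_mean P f a /\ 0 <= a <= b.

Lemma mean_le_sum (I : finType) (f : I -> T -> R) (b : I -> R) :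
  (forall i, mean_le (f i) (b i)) ->
  mean_le (fun x => \sum_i f i x) (\sum_i b i).
Proof.
move=> /choice[a ha]; exists (\sum_i a i); split.
  by apply: has_mean_sum => i; case: (ha i).
rewrite sumr_ge0 => [|i _]; last by case: (ha i) => _ /andP[].
by apply: ler_sum => i _; case: (ha i) => _ /andP[].
Qed.

Lemma mean_leZ f b c : 0 <= c -> mean_le f b -> mean_le (fun x => c * f x) (c * b).
Proof.
move=> c0 [a [fa /andP[a0 ab]]]; exists (c * a); split; first exact: has_meanZ.
by rewrite mulr_ge0//= ler_wpM2l.
Qed.

Lemma mean_le_markov f b (B : set T) : measurable B -> mean_le f b ->
  (forall x, 0 <= f x) -> (forall x, B x -> 1 <= f x) -> (P B <= b%:E)%E.
Proof.
move=> mB [a [fa /andP[_ ab]]] f0 f1; apply: (@le_trans _ _ a%:E); last first.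
  by rewrite lee_fin.
have mf := has_mean_measurable fa; case: fa => _ <-.
rewrite -(setIT B) -integral_indic//; apply: ge0_le_integral => //.
- by apply/measurable_EFinP; exact: measurable_indic.
- by apply/measurable_EFinP.
move=> x _; rewrite lee_fin indicE; case: (pselect (B x)) => Bx.
  by rewrite mem_set// f1.
by rewrite memNset.
Qed.

End MeanBounds.

Section Majorant.
Context {R : realType}.
(* On the exceptional event some pair of blocks of singular directions of A has
   a deviation larger than e / 4, in the average with weights c w w'. *)
Lemma gram_deviation_majorant (n d m : nat) (A : 'M[R]_(n, d)) (e lam : R) :
  (0 < m)%N -> 0 < opnorm A -> frobnorm A ^+ 2 <= m%:R * opnorm A ^+ 2 ->
  0 < e -> 4 <= lam * e -> exists (p : nat) (c : 'I_p -> 'I_p -> R)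
    (q : 'I_p -> nat) (N : forall w, 'I_(q w) -> 'cV[R]_d),
  [/\ forall w w', 0 <= c w w', \sum_w \sum_w' c w w' <= 1,
      forall w, (q w <= 2 ^ (18 * m))%N, forall w a, l2norm (N w a) <= 1
    & forall r (M : 'M[R]_(r, d)),
       e * opnorm A ^+ 2 <= opnorm (A *m M^T *m M *m A^T - A *m A^T) ->
       1 <= \sum_w \sum_w' c w w' * (4 * expR (- (lam * e / 4)) *
         \sum_a \sum_b expR (2 * lam * (dotv (M *m N w a) (M *m N w' b)
                                        - dotv (N w a) (N w' b))))].
Proof.
move=> m0 A0 Am e0 le4.
have lam0 : 0 < lam by rewrite -(pmulr_lgt0 _ e0) (lt_le_trans _ le4).
have [U [V sA]] := exists_singvals A; set s := singvals A in sA.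
set p := minn n d in U s V sA; have [UU VV s0 sd AE] := sA.
set K := opnorm A in A0 Am *.
have sK : sval_nth s 1 = K by rewrite /K (svd_opnorm sA).
pose net (w : 'I_p) := cid (@exists_unit_net R p _ m m0 (card_block w m0)).
pose q w := sval (net w); pose N' w := sval (cid (svalP (net w))).
have hN w : (q w <= 2 ^ (18 * m))%N /\ unit_net (block m w) (N' w).
  exact: (svalP (cid (svalP (net w)))).
pose D (w : 'I_p) : 'M[R]_p := coord_proj (block m w).
pose a (w : 'I_p) := block_sval m s w.
(* The normalization is (2 K^2)^2, since the squares of the leading values add up to at most 2
   K^2. *)
pose c w w' := (a w) ^+ 2 * (a w') ^+ 2 / (4 * K ^+ 4).
have K4 : 0 < 4 * K ^+ 4 by rewrite mulr_gt0// exprn_gt0.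
have csum : \sum_w \sum_w' c w w' <= 1.
  have a2 : \sum_w (a w) ^+ 2 <= 2 * K ^+ 2.
    have mR : 0 < m%:R :> R by rewrite ltr0n.
    rewrite -(ler_pM2l mR); apply: le_trans (sum_block_sval m p s0 sd) _.
    by rewrite -(frobnorm_svd sA) sK; lra.
  have -> : \sum_w \sum_w' c w w' = (\sum_w (a w) ^+ 2) ^+ 2 / (4 * K ^+ 4).
    rewrite expr2 !mulr_suml; apply: eq_bigr => w _.
    by rewrite mulr_sumr mulr_suml.
  rewrite ler_pdivrMr// mul1r.
  have -> : 4 * K ^+ 4 = (2 * K ^+ 2) ^+ 2 by ring.
  have sa0 : 0 <= \sum_w (a w) ^+ 2 by apply: sumr_ge0 => w _; exact: sqr_ge0.
  by rewrite ler_sqr ?nnegrE// (le_trans sa0).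
exists p, c, q, (fun w x => V *m (D w *m N' w x)); split.
- by move=> w w'; rewrite divr_ge0 ?(ltW K4)// mulr_ge0// sqr_ge0.
- exact: csum.
- by move=> w; case: (hN w).
- move=> w x; rewrite l2norm_isom// (le_trans (l2norm_coord_proj _ _))//.
  by case: (hN w) => _ [].
move=> r M bad; pose F := V^T *m (M^T *m M - 1%:M) *m V.
pose Z w w' := opnorm (D w *m F *m D w').
have badF : e * K ^+ 2 <= opnorm (diag_mx s *m F *m diag_mx s).
  apply: le_trans bad _.
  have -> : A *m M^T *m M *m A^T - A *m A^T
      = U *m (diag_mx s *m F *m diag_mx s) *m U^T.
    have -> : A *m M^T *m M *m A^T - A *m A^T = A *m (M^T *m M - 1%:M) *m A^T.
      by rewrite mulmxBr mulmxBl mulmx1 !mulmxA.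
    by rewrite {1 2}AE !trmx_mul trmxK tr_diag_mx /F !mulmxA.
  apply: opnorm_le => [|v]; first exact: opnorm_ge0.
  set X := diag_mx s *m F *m diag_mx s.
  have -> : U *m X *m U^T *m v = U *m (X *m (U^T *m v)) by rewrite !mulmxA.
  rewrite l2norm_isom// (le_trans (opnorm_bound _ _))// ler_wpM2l ?opnorm_ge0//.
  by rewrite -[leRHS]mul1r l2norm_le// expr1n mul1r (bessel sA).
have Zsum : e ^+ 2 / 4 <= \sum_w \sum_w' c w w' * Z w w' ^+ 2.
  have := opnorm_blocks F m0 s0 sd.
  have -> : \sum_(w < p) \sum_(w' < p) (block_sval m s w * block_sval m s w' *
      opnorm (coord_proj (block m w) *m F *m coord_proj (block m w'))) ^+ 2
      = 4 * K ^+ 4 * \sum_w \sum_w' c w w' * Z w w' ^+ 2.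
    rewrite mulr_sumr; apply: eq_bigr => w _; rewrite mulr_sumr.
    by apply: eq_bigr => w' _; rewrite -/(a w) -/(a w') -/(Z w w') /c; field; rewrite gt_eqF.
  have : (e * K ^+ 2) ^+ 2 <= opnorm (diag_mx s *m F *m diag_mx s) ^+ 2.
    by rewrite ler_sqr ?nnegrE ?opnorm_ge0// mulr_ge0 ?sqr_ge0// ltW.
  move=> h1 h2; have := le_trans h1 h2.
  have -> : (e * K ^+ 2) ^+ 2 = 4 * K ^+ 4 * (e ^+ 2 / 4) by field.
  by rewrite ler_pM2l.
(* With threshold e/4 the weighted sum of (Z / (e/4))^2 is at least 16/e^2 * e^2/4 = 4; subtracting
   the total weight, at most 1, leaves more than 1. *)
apply: (@le_trans _ _ (\sum_w \sum_w' c w w' * ((Z w w' / (e / 4)) ^+ 2 - 1))).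
  have -> : \sum_w \sum_w' c w w' * ((Z w w' / (e / 4)) ^+ 2 - 1)
    = 16 / e ^+ 2 * (\sum_w \sum_w' c w w' * Z w w' ^+ 2) - \sum_w \sum_w' c w w'.
    rewrite mulr_sumr -sumrB; apply: eq_bigr => w _; rewrite mulr_sumr -sumrB.
    by apply: eq_bigr => w' _; field; rewrite gt_eqF.
  have : 16 / e ^+ 2 * (e ^+ 2 / 4) <= 16 / e ^+ 2 * (\sum_w \sum_w' c w w' * Z w w' ^+ 2).
    by rewrite ler_wpM2l// divr_ge0// sqr_ge0.
  have -> : 16 / e ^+ 2 * (e ^+ 2 / 4) = 4 by field; rewrite gt_eqF.
  lra.
apply: ler_sum => w _; apply: ler_sum => w' _; apply: ler_wpM2l.
  by rewrite divr_ge0 ?(ltW K4)// mulr_ge0// sqr_ge0.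
have q0 : 0 < e / 4 by rewrite divr_gt0.
have lq : 1 <= lam * (e / 4) by lra.
apply: le_trans (expR_excess (opnorm_ge0 _) q0 lq) _.
rewrite mulrA mulrA ler_wpM2l ?mulr_ge0 ?expR_ge0//.
case: (hN w) => _ netw; case: (hN w') => _ netw'.
have [x [y xy]] := net_opnorm F netw netw'.
(* The pair of net points is not known in advance, so all pairs are summed; the terms being
   positive, the good pair suffices here. *)
rewrite (bigD1 x)//= (bigD1 y)//= -addrA; apply: ler_wpDr.
  by rewrite addr_ge0// !sumr_ge0// => *; rewrite ?sumr_ge0// => *; exact: expR_ge0.
rewrite ler_expR -mulrA mulrCA ler_pM2l//; apply: le_trans xy _.
rewrite ler_pM2l// le_eqVlt; apply/orP; left; apply/eqP.
rewrite /F -!mulmxA dotv_adjr trmxK mulmxBl mul1mx dotvBr; congr (_ - _).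
by rewrite -!mulmxA [RHS]dotv_adj.
Qed.

End Majorant.

(** * Subgaussian sketches *)

Section SubgaussianSketch.
Context {R : realType}.
Variables (mu : probability (measurableTypeR R) R) (c : R).
Hypotheses (c0 : 0 < c) (mean0 : (\int[mu]_x x%:E = 0)%E)
  (var1 : (\int[mu]_x (x ^+ 2)%:E = 1)%E)
  (orlicz : (\int[mu]_x (expR ((x / c) ^+ 2))%:E <= 2%:E)%E).

(** The first bound keeps 2 lam, for lam = [sg_rate] e t, in the range of [subgaussian_form_mgf].
    With x = [sg_rate] e^2 t, the second makes the quadratic cost at most x/8, against a gain lam e
    / 4 = x/4. *)
Definition sg_rate : R := Num.min (sg_kappa c / 4) (32 * sg_const c)^-1.

Lemma sg_rate_gt0 : 0 < sg_rate.
Proof.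
by rewrite lt_min divr_gt0 ?sg_kappa_gt0//= invr_gt0 mulr_gt0// sg_const_gt0.
Qed.

Lemma subgaussian_tail n d m t (A : 'M[R]_(n, d)) (D : probability (rmx R d) R) e :
  (0 < t)%N -> subgaussian_map mu t D -> (0 < m)%N -> 0 < opnorm A ->
  frobnorm A ^+ 2 <= m%:R * opnorm A ^+ 2 -> 0 < e <= 1 ->
  4 <= sg_rate * e ^+ 2 * t%:R ->
  (D [set G | (e * opnorm A^T ^+ 2 <= opnorm ((A^T)^T *m (mx_of G)^T *m mx_of G
      *m A^T - (A^T)^T *m A^T))%R]
   <= (4 * 2 ^+ (36 * m) * expR (- (sg_rate * e ^+ 2 * t%:R / 8)))%:E)%E.
Proof.
move=> t0 mapD m0 A0 Am /andP[e0 e1] large; set B : set (rmx R d) := [set G | _].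
have tR : 0 < t%:R :> R by rewrite ltr0n.
have r0 := sg_rate_gt0; set lam := sg_rate * e * t%:R.
have lam0 : 0 < lam by rewrite !mulr_gt0.
have le4 : 4 <= lam * e by rewrite /lam; lra.
have mB : measurable B by exact: measurable_gram_event.
rewrite (subgaussian_fiberE mapD mB).
have [p [w [q [N [w0 w1 qm N1 major]]]]] := gram_deviation_majorant m0 A0 Am e0 le4.
pose f (G : rmx R d) : R := \sum_i \sum_j w i j * (4 * expR (- (lam * e / 4)) *
  \sum_a \sum_b expR (2 * lam * (dotv (mx_at t G *m N i a) (mx_at t G *m N j b)
                                 - dotv (N i a) (N j b)))).
pose E := expR (sg_const c * (2 * lam) ^+ 2 / t%:R).
have fE : mean_le D f (\sum_i \sum_j w i j * (4 * expR (- (lam * e / 4)) *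
    \sum_(a < q i) \sum_(b < q j) E)).
  apply: mean_le_sum => i; apply: mean_le_sum => j; apply: mean_leZ => //.
  apply: mean_leZ; first by rewrite mulr_ge0 ?expR_ge0.
  apply: mean_le_sum => a; apply: mean_le_sum => b.
  have nN i' a' : normsq (N i' a') <= 1.
    by rewrite -sqr_l2norm exprn_ile1 ?l2norm_ge0.
  have range : 0 <= 2 * lam <= sg_kappa c / 2 * t%:R.
    rewrite mulr_ge0 ?(ltW lam0)//= /lam.
    have k1 : sg_rate <= sg_kappa c / 4 by rewrite /sg_rate ge_min lexx.
    have : sg_rate * e * t%:R <= sg_kappa c / 4 * t%:R.
      by rewrite ler_wpM2r ?(ltW tR)// -[leRHS]mulr1 ler_pM// ltW.
    lra.
  exact: (subgaussian_form_mgf c0 mean0 var1 orlicz t0 mapD (nN _ _) (nN _ _) range).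
apply: (@le_trans _ _ (\sum_i \sum_j w i j * (4 * expR (- (lam * e / 4)) *
    \sum_(a < q i) \sum_(b < q j) E))%:E).
  apply: (mean_le_markov _ fE).
  - by apply: measurableI => //; exact: measurable_fiber.
  - move=> G; apply: sumr_ge0 => i _; apply: sumr_ge0 => j _.
    apply: mulr_ge0 => //; apply: mulr_ge0; first by rewrite mulr_ge0 ?expR_ge0.
    by apply: sumr_ge0 => a _; apply: sumr_ge0 => b _; exact: expR_ge0.
  move=> G [BG Gt]; apply: major; move: BG; rewrite (mx_atK Gt) /B /= mx_atE.
  by rewrite trmxK opnorm_trmx.
(* The weights add up to at most 1, so a bound for one pair of blocks is enough, and the number of
   blocks does not enter. *)
rewrite lee_fin; apply: (@le_trans _ _ (\sum_i \sum_j w i j *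
    (4 * 2 ^+ (36 * m) * expR (- (sg_rate * e ^+ 2 * t%:R / 8))))); last first.
  under eq_bigr do rewrite -mulr_suml.
  rewrite -mulr_suml ler_piMl// mulr_ge0 ?expR_ge0// mulr_ge0 ?exprn_ge0//.
apply: ler_sum => i _; apply: ler_sum => j _; apply: ler_wpM2l => //.
rewrite -[leLHS]mulrA -[leRHS]mulrA ler_pM2l//.
apply: (@le_trans _ _ (expR (- (lam * e / 4)) * (2 ^+ (36 * m) * E))).
  rewrite ler_wpM2l ?expR_ge0// sumr_const card_ord sumr_const card_ord.
  rewrite -mulrnA -[leLHS]mulr_natl ler_wpM2r ?expR_ge0//.
  have -> : (36 * m = 18 * m + 18 * m)%N by rewrite -mulnDl.
  by rewrite -natrX ler_nat expnD leq_mul.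
rewrite mulrCA ler_wpM2l ?exprn_ge0// -expRD ler_expR.
have c1 : sg_const c * sg_rate <= 1 / 32.
  rewrite mulrC -ler_pdivlMr ?sg_const_gt0// mul1r -invfM mulrC.
  by rewrite /sg_rate ge_min mulrC lexx orbT.
have -> : sg_const c * (2 * lam) ^+ 2 / t%:R
    = 4 * (sg_const c * sg_rate) * (sg_rate * e ^+ 2 * t%:R).
  by rewrite /lam; field; rewrite gt_eqF.
have -> : lam * e / 4 = sg_rate * e ^+ 2 * t%:R / 4 by rewrite /lam; ring.
have x0 : 0 < sg_rate * e ^+ 2 * t%:R by rewrite (lt_le_trans _ large).
have : sg_const c * sg_rate * (sg_rate * e ^+ 2 * t%:R)
    <= 1 / 32 * (sg_rate * e ^+ 2 * t%:R) by rewrite ler_pM2r.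
lra.
Qed.

End SubgaussianSketch.

Lemma stable_rank_ge1 (R : realType) m n (X : 'M[R]_(m, n)) : 0 < opnorm X ->
  1 <= stable_rank X.
Proof.
move=> X0; rewrite /stable_rank ler_pdivlMr ?exprn_gt0// mul1r.
by rewrite ler_sqr ?nnegrE ?opnorm_ge0 ?frobnorm_ge0// opnorm_le_frob.
Qed.

Lemma gap_le1 (R : realType) m n (X : 'M[R]_(m, n)) k : 0 < opnorm X ->
  gap X k.+1 <= 1.
Proof.
move=> X0; rewrite /gap ler_pdivrMr ?sigma1 ?exprn_gt0// mul1r lerBlDr.
apply: (@le_trans _ _ (opnorm X ^+ 2)); last by rewrite lerDl sqr_ge0.
by rewrite -sigma1 ler_sqr ?nnegrE ?sigma_ge0// sigma_dec.
Qed.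

Lemma eps_right_bounds (R : realType) (nu g : R) : 0 < nu < 1 / 2 -> 0 <= g ->
  nu * g / 3 <= eps_right nu g <= g.
Proof.
move=> /andP[nu0 nu1] g0; rewrite /eps_right.
have -> : 2 * (1 + nu / 2) = 2 + nu by field.
have n2 : 0 < 2 + nu by lra.
apply/andP; split; last by rewrite ler_piMl// ler_pdivrMr//; lra.
rewrite [leRHS]mulrAC; apply: ler_wpM2l; first by rewrite mulr_ge0// ltW.
by rewrite lef_pV2 ?posrE//; lra.
Qed.

(** 8 * 2^(36 m) = 2^(36 m + 3) is at most exp (36 m + 3), as 2 <= e. *)
Lemma exponential_union_bound (R : realType) (m : nat) (x delta : R) : 0 < delta ->
  36 * m%:R + 3 + ln (1 / delta) <= x -> 4 * 2 ^+ (36 * m) * expR (- x) <= delta / 2.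
Proof.
move=> d0 hx.
suff: 8 * 2 ^+ (36 * m) * expR (- x) <= delta.
  by move: (2 ^+ _) (expR _) => u v; lra.
have two : 2 <= expR 1 :> R by have := expR_ge1Dx (1 : R); lra.
rewrite expRN ler_pdivrMr ?expR_gt0// [leRHS]mulrC -ler_pdivrMr//.
have -> : delta^-1 = expR (ln (1 / delta)) by rewrite div1r lnK ?posrE ?invr_gt0.
apply: (@le_trans _ _ (expR (36 * m%:R + 3) * expR (ln (1 / delta)))); last first.
  by rewrite -expRD ler_expR.
rewrite ler_wpM2r ?expR_ge0//.
have -> : 8 * 2 ^+ (36 * m) = 2 ^+ (36 * m + 3) :> R.
  by rewrite addnC exprD -[2 ^+ 3]natrX.
have -> : expR (36 * m%:R + 3) = expR 1 ^+ (36 * m + 3) :> R.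
  by rewrite -expRM_natl mulr1 natrD natrM.
by rewrite lerXn2r ?nnegrE ?expR_ge0.
Qed.

Lemma subgaussian_sketch (R : realType) (mu : probability (measurableTypeR R) R) :
  subgaussian_law mu ->
  exists2 C : R, 0 < C &
  forall (n d k : nat) (A : 'M[R]_(n, d)) (nu delta : R)
      (t : nat) (D : probability (rmx R d) R),
    sigma A k.+2 < sigma A k.+1 -> 0 < nu < 1 / 2 -> 0 < delta < 1 / 2 ->
    C * ((stable_rank A + ln (1 / delta)) / (gap A k.+1 ^+ 2 * nu ^+ 2)) <= t%:R ->
    subgaussian_map mu t D ->
    approx_gram D A^T (eps_right nu (gap A k.+1)) (delta / 2).
Proof.
move=> [mean0 var1 [c c0 orlicz]]; have r0 := sg_rate_gt0 c.
have tail n d m t A D e :=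
  @subgaussian_tail R mu c c0 mean0 var1 orlicz n d m t A D e.
move: mean0 var1 orlicz => _ _ _.
(* 5400 = 9 * 600: the 9 comes from e >= nu g / 3. And 600 = 8 * 75, for the 8 dividing the exponent
   and for 36 m + 3 <= 75 sr, where m <= sr + 1 and sr >= 1. *)
have [K K0 hK] : exists2 K, 0 < K &
    forall x y, K * x <= y -> 5400 * x <= sg_rate c * y.
  exists (5400 / sg_rate c); first by apply: divr_gt0; rewrite ?ltr0n.
  by move=> x y; rewrite mulrAC ler_pdivrMr// (mulrC y).
exists K => //.
move=> n d k A nu delta t D gapA /andP[nu0 nu1] /andP[de0 de1] ht mapD.
have s0 : 0 < sigma A k.+1 by rewrite (le_lt_trans _ gapA)// sigma_ge0.
have A0 : 0 < opnorm A by rewrite -sigma1 (lt_le_trans s0)// sigma_dec.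
set g := gap A k.+1 in ht *.
have K2 : 0 < sigma A 1 ^+ 2 by rewrite sigma1 exprn_gt0.
have g0 : 0 < g.
  by rewrite /g /gap divr_gt0// subr_gt0 ltr_sqr ?nnegrE ?sigma_ge0.
have g1 : g <= 1 := gap_le1 k A0.
have sr1 := stable_rank_ge1 A0; set sr := stable_rank A in ht sr1 *.
have ln0 : 0 <= ln (1 / delta).
  by rewrite ln_ge0// ler_pdivlMr// mul1r; lra.
set e := eps_right nu g.
have /andP[e3 eg] : nu * g / 3 <= e <= g.
  by apply: eps_right_bounds; rewrite ?nu0// ltW.
have e0 : 0 < e by rewrite (lt_le_trans _ e3)// divr_gt0// mulr_gt0.
have e1 : e <= 1 := le_trans eg g1.
have gn0 : 0 < g ^+ 2 * nu ^+ 2.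
  by apply: mulr_gt0; exact: exprn_gt0.
have large : 600 * (sr + ln (1 / delta)) <= sg_rate c * e ^+ 2 * t%:R.
  rewrite mulrA ler_pdivrMr// in ht.
  have h : (nu * g / 3) ^+ 2 <= e ^+ 2.
    by rewrite ler_sqr ?nnegrE// ?(ltW e0)// divr_ge0// mulr_ge0 ?(ltW nu0) ?(ltW g0).
  have : sg_rate c * t%:R * (nu * g / 3) ^+ 2 <= sg_rate c * t%:R * e ^+ 2.
    by rewrite ler_wpM2l// mulr_ge0// ltW.
  have := hK _ _ ht.
  lra.
have t0 : (0 < t)%N.
  rewrite lt0n; apply/eqP => t0; move: large; rewrite t0 mulr0; lra.
(* The least integer above the stable rank, so that |A|_F^2 <= m |A|^2. *)
pose m := (Num.truncn sr).+1.
have sr0 : 0 <= sr by lra.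
have /andP[m1 m2] := truncn_itv sr0.
have Am : frobnorm A ^+ 2 <= m%:R * opnorm A ^+ 2.
  rewrite -ler_pdivrMr ?exprn_gt0//; exact: ltW m2.
have large4 : 4 <= sg_rate c * e ^+ 2 * t%:R by lra.
have e01 : 0 < e <= 1 by rewrite e0.
apply: le_trans (tail _ _ _ _ _ _ _ t0 mapD _ A0 Am e01 large4) _ => //.
rewrite lee_fin.
apply: exponential_union_bound => //.
have : m%:R <= sr + 1 by rewrite /m -natr1 lerD2r.
lra.
Qed.

Theorem theorem16 (R : realType) :
  (forall (n d k : nat) (A : 'M[R]_(n, d)) (nu delta : R)
      (UA : 'M[R]_(n, minn n d)) (sA : 'rV[R]_(minn n d))
      (VA : 'M[R]_(d, minn n d))
      (disp : measure_display) (Om : measurableType disp)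
      (P : probability Om R) (f : 'cV[R]_n) (xi : 'I_n -> {RV P >-> R}) (s : R)
      (DG : probability (rmx R d) R) (DS : R.-pker (rmx R d) ~> (rmx R n)),
    (0 < k)%N -> (k <= \rank A)%N -> sigma A k.+1 < sigma A k ->
    0 < nu < 1 / 2 -> 0 < delta < 1 / 2 ->
    thin_svd A UA sA VA ->
    white_noise s xi ->
    approx_gram DG A^T (eps_right nu (gap A k)) (delta / 2) ->
    {ae DG, forall G : rmx R d, 0 < gap (A *m (mx_of G)^T) k ->
       approx_gram (DS G) (A *m (mx_of G)^T)
         (eps_left nu (gap (A *m (mx_of G)^T) k)) (delta / 2)} ->
    exists E : set (rmx R d * rmx R n),
      [/\ measurable E, ((1 - delta)%:E <= joint_law DG DS E)%E
        & forall (G : rmx R d) (S : rmx R n), E (G, S) ->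
          forall U t V, thin_svd (mx_of S *m A *m (mx_of G)^T) U t V ->
          let Rm := (mx_of G)^T *m first_cols k V in
          forall U' t' V', thin_svd (A *m Rm) U' t' V' ->
          let xR := sketched_sol A Rm V' k in
          let b := response f xi in
          (forall w, approx_pcp A UA VA k nu nu (b w) (A *m xR (b w))) /\
          (excess_risk P A b xR <= excess_risk P A b (pcr_sol A VA k)
             + ((2 * nu + nu ^+ 2) * l2norm f ^+ 2 / n%:R)%:E)%E])
  /\
  (exists2 C : R, 0 < C &
    forall (n d k : nat) (A : 'M[R]_(n, d)) (nu delta : R) (G : rmx R d)
        (r : nat) (D : probability (rmx R n) R),
      (0 < k)%N -> (k <= \rank A)%N -> sigma A k.+1 < sigma A k ->
      0 < nu < 1 / 2 -> 0 < delta < 1 / 2 ->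
      let X := A *m (mx_of G)^T in
      0 < gap X k ->
      C * (stable_rank X ^+ 2 / (gap X k ^+ 2 * nu ^+ 2 * delta)) <= r%:R ->
      countsketch r D ->
      approx_gram D X (eps_left nu (gap X k)) (delta / 2))
  /\
  (forall mu : probability (measurableTypeR R) R, subgaussian_law mu ->
    exists2 C : R, 0 < C &
    forall (n d k : nat) (A : 'M[R]_(n, d)) (nu delta : R)
        (t : nat) (D : probability (rmx R d) R),
      (0 < k)%N -> (k <= \rank A)%N -> sigma A k.+1 < sigma A k ->
      0 < nu < 1 / 2 -> 0 < delta < 1 / 2 ->
      C * ((stable_rank A + ln (1 / delta)) / (gap A k ^+ 2 * nu ^+ 2))
        <= t%:R ->
      subgaussian_map mu t D ->
      approx_gram D A^T (eps_right nu (gap A k)) (delta / 2)).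
Proof.
split; last split; last first.
- move=> mu /subgaussian_sketch[C C0 sketch]; exists C => //.
  move=> n d [//|k] A nu delta t D _ _; exact: sketch.
- exists 256; first by rewrite ltr0n.
  move=> n d [//|k] A nu delta G r D _ _ _ nu01 /andP[d0 _] X.
  exact: countsketch_sketch.
move=> n d [//|k] A nu delta UA sA VA disp Om P f xi s DG DS _ _ gapA.
move=> /andP[nu0 nu1] /andP[de0 de1] svdA noise gramG gramS.
have sA_ := thin_svd_svd svdA.
have nu01 : 0 < nu < 1 by rewrite nu0 (lt_trans nu1)//; lra.
have skA : 0 < sigma A k.+1 ^+ 2 - sigma A k.+2 ^+ 2.
  by rewrite subr_gt0 ltr_pXn2r// nnegrE sigma_ge0.
have opA (m : nat) (X : 'M[R]_(n, m)) :
    0 < sigma X k.+1 ^+ 2 - sigma X k.+2 ^+ 2 -> 0 < opnorm X.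
  move=> h; rewrite -sigma1; apply: lt_le_trans (sigma_dec X (leq0n k)).
  rewrite lt_def sigma_ge0 andbT; apply/eqP => X0; move: h.
  by rewrite X0 expr0n/= sub0r oppr_gt0 ltNge sqr_ge0.
have [/andP[tau0 tau1] tauE] := tau_ofE nu01; set tau := tau_of nu in tau0 tau1 tauE.
set e := nu / 2 / (1 + nu / 2) * (sigma A k.+1 ^+ 2 - sigma A k.+2 ^+ 2).
set E1 := left_event A e; set E2 := right_event k A (tau / (1 + tau)).
exists ((E1 `*` setT) `&` E2); split.
- apply: measurableI; last exact: measurable_right_event.
  by apply: measurableX => //; exact: measurable_left_event.
(* The two failures of probability delta/2 combine, since (1 - delta/2)^2 >= 1 - delta. *)
- apply: (@le_trans _ _ ((1 - delta / 2) * (1 - delta / 2))%:E).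
    by rewrite lee_fin; nra.
  apply: joint_law_ge.
  + exact: measurable_left_event.
  + exact: measurable_right_event.
  + lra.
  + have := approx_gram_good (probability_setT DG) gramG; rewrite trmxK.
    by rewrite eps_right_opnorm// opA.
  apply: filterS gramS => G hG E1G.
  have skX := left_event_gap nu01 skA E1G.
  have DST : DS G setT = 1%E by exact: prob_kernel.
  have /hG/(approx_gram_good DST) : 0 < gap (A *m (mx_of G)^T) k.+1.
    by rewrite /gap divr_gt0// sigma1 exprn_gt0// opA.
  rewrite eps_left_opnorm ?opA//; congr (_ <= DS G _)%E.
  by apply/seteqP; split=> S; rewrite xsectionE.
move=> G S [[E1G _] E2GS] U t V svdY Rm U' t' V' svdR.
rewrite /= in E1G.
have kA : (k < minn n d)%N.
  by apply: (@sval_gt0_lt _ _ sA); rewrite -(sigmaE _ sA_) (le_lt_trans (sigma_ge0 _ _) gapA).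
(* A R has k + 1 columns and, as sigma_{k+1}(A) > 0 in this numbering, at least as many rows: its
   thin decomposition has exactly k + 1 columns. *)
have kn : k.+1 = minn n k.+1.
  by apply/esym/minn_idPr; rewrite (leq_trans kA)// geq_minl.
set X := A *m (mx_of G)^T.
have XE : A *m (mx_of G)^T *m mx_of G *m A^T = X *m X^T.
  by rewrite -mulmxA -[in RHS]/X trmx_mul trmxK.
have YE : X^T *m (mx_of S)^T *m mx_of S *m X = (mx_of S *m X)^T *m (mx_of S *m X).
  by rewrite [in RHS]trmx_mul mulmxA.
have sY : svd (mx_of S *m X) U t V by rewrite /X mulmxA; exact: thin_svd_svd.
have den1 : 0 < 1 + nu / 2 by lra.
have den2 : 0 < 1 + tau by rewrite ltr_wpDr// ltW.
have hG : opnorm (X *m X^T - A *m A^T) * (1 + nu / 2)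
    <= nu / 2 * (sigma A k.+1 ^+ 2 - sigma A k.+2 ^+ 2).
  by rewrite -ler_pdivlMr// mulrAC -XE ltW.
have hS : opnorm ((mx_of S *m X)^T *m (mx_of S *m X) - X^T *m X) * (1 + tau)
    <= tau * (sigma X k.+1 ^+ 2 - sigma X k.+2 ^+ 2).
  by rewrite -ler_pdivlMr// mulrAC -YE ltW.
have tau01 : 0 < tau < 1 by rewrite tau0.
have [inj close] := two_sided_projection sA_ sY nu01 tau01 tauE gapA hG hS.
set W := first_cols k.+1 V in inj close.
have ARm : A *m Rm = X *m W by rewrite /Rm mulmxA.
have sR := thin_svd_svd svdR.
have VV : (first_cols k.+1 V')^T *m first_cols k.+1 V' = 1%:M.
  have kn' : (k.+1 <= minn n k.+1)%N by rewrite -kn.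
  have iso := first_cols_isom (svd_trmx sR) kn'.
  exact: iso.
(* The first k + 1 columns of V' form a square orthogonal matrix, so A R V' and A R = X W have the
   same range. *)
have VVT : first_cols k.+1 V' *m (first_cols k.+1 V')^T = 1%:M by exact: isom_square.
set M := A *m Rm *m first_cols k.+1 V'.
have injM (c : 'cV[R]_k.+1) : M *m c = 0 -> c = 0.
  rewrite /M -mulmxA ARm => /inj Vc.
  by rewrite -(mul1mx c) -VV -mulmxA Vc mulmx0.
have [[MYM YMY MYT _] YM] := pinv_inj injM.
have sk0 : 0 < sval_nth sA k.+1.
  by rewrite -(sigmaE _ sA_) (le_lt_trans (sigma_ge0 _ _) gapA).
have XWE : X *m W = M *m (first_cols k.+1 V')^T.
  by rewrite /M -mulmxA VVT mulmx1 ARm.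
have cl : opnorm (M *m Defs.pinv M - proj_first k.+1 UA) <= nu.
  apply: close => //.
  - by rewrite mulmxA MYM.
  - by rewrite XWE mulmxA MYM.
  move=> v; exists (first_cols k.+1 V' *m (Defs.pinv M *m v)).
  by rewrite -ARm (mulmxA (A *m Rm)) -/M mulmxA.
have := excess_risk_perturbed f noise sA_ sk0 (ltW nu0) injM cl; exact.
Qed.
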